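(* Let $(\Delta,g)$ be a rank-two sub-Riemannian structure on a smooth manifold $M$ with a global orthonormal frame $X_1,X_2$. Let $\gamma:[0,T]\to M$ be a normal and regular abnormal geodesic. Assume that the function $t\mapsto\dim(\mathcal{A}_t)$ is discontinuous at time $\tau\in(0,T)$, with $$\dim(\mathcal{A}_\tau)=k+1,\qquad \dim(\mathcal{A}_t)=k\quad\forall t\in(\tau,T],$$ for some $k\ge1$. Let $\bar\gamma:[0,T]\to M$ be a normal geodesic that branches from $\gamma$ at time $\tau$. Then $\bar\gamma$ does not admit a regular abnormal lift. In particular, the regular abnormal geodesics that branch from $\gamma$ at time $\tau$ are strictly abnormal.
   Context: Setting: $M$ is a smooth manifold, $\Delta\subset TM$ a smooth totally nonholonomic (bracket-generating) distribution of constant rank $2$, $g$ a Riemannian metric on $\Delta$, and $X_1,X_2$ a fixed global $g$-orthonormal frame of smooth vector fields for $\Delta$. A horizontal curve is an absolutely continuous $\gamma:[0,T]\to M$ with $\dot\gamma=u_1X_1(\gamma)+u_2X_2(\gamma)$ a.e. for some (unique) control $u\in L^2([0,T],\mathbb{R}^2)$; its length is $L(\gamma)=\int_0^T|u(t)|\,dt$, and $d(p,q)$ is the infimum of lengths of horizontal curves from $p$ to $q$. A horizontal curve is a length minimizer if its length equals the distance $d$ between its endpoints; a geodesic is a horizontal curve with constant speed such that every $t\in[0,T]$ has an $\varepsilon>0$ for which the restriction to $[t-\varepsilon,t+\varepsilon]\cap[0,T]$ is a length minimizer. Notation: $\pi:T^*M\to M$ is the projection, $h_X(\lambda)=\langle\lambda,X(\pi(\lambda))\rangle$,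 $X_{i_1\dots i_k}=[X_{i_1},\dots,[X_{i_{k-1}},X_{i_k}]\dots]$, $h_{i_1\dots i_k}=h_{X_{i_1\dots i_k}}$. For a smooth function $h$ on $T^*M$, $\vec h$ is its Hamiltonian vector field, $\omega(\cdot,\vec h)=dh$ with $\omega$ the canonical symplectic form (in canonical coordinates $\dot x=\partial_p h$, $\dot p=-\partial_x h$). A normal lift of a horizontal curve $\gamma$ is an integral curve $\lambda(\cdot)$ of $\vec H$, $H=\frac12(h_1^2+h_2^2)$, with $\pi\circ\lambda=\gamma$; a normal geodesic is a geodesic admitting a normal lift. An abnormal lift of a horizontal curve $\gamma$ with control $u$ is an absolutely continuous $\lambda(\cdot)$ in $T^*M$ with $\pi\circ\lambda=\gamma$, $\lambda(t)\neq0$, $h_1(\lambda(t))=h_2(\lambda(t))=0$ for all $t$, and $\dot\lambda=u_1\vec h_1(\lambda)+u_2\vec h_2(\lambda)$ a.e. A curve is strictly abnormal if it has an abnormal lift and no normal lift. For $t\in(0,T]$, $\mathcal{A}_t\subset T^*_{\gamma(0)}M$ is the vector space consisting of $0$ and of the initial covectors $\lambda(0)$ of all abnormal lifts $\lambda(\cdot)$ of $\gamma|_{[0,t]}$. Let $\Delta_2^\perp=\{h_1=h_2=h_{12}=0\}$, $\Delta_3^\perp=\{h_1=h_2=h_{12}=h_{112}=h_{212}=0\}\subset T^*M$ and $\mathcal{R}=\Delta_2^\perp\setminus\Delta_3^\perp$, a submanifold of $T^*M$. On $\mathcal{R}$ the vector field (tangent to $\mathcal R$) $$\vec G=\frac{-h_{212}}{\sqrt{h_{212}^2+h_{112}^2}}\,\vec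 h_1+\frac{h_{112}}{\sqrt{h_{212}^2+h_{112}^2}}\,\vec h_2$$ is defined. A regular abnormal lift of a curve is a lift contained in $\mathcal{R}$ that is an integral curve of $\vec G$ or of $-\vec G$; a regular abnormal path is a curve admitting a regular abnormal lift. It is known that every regular abnormal path is a (unit-speed) geodesic; it is then called a regular abnormal geodesic. A normal (resp. regular abnormal) geodesic $\bar\gamma$ defined on $[0,b]$, $b>\tau$, branches from $\gamma$ at time $\tau$ if $\bar\gamma|_{[0,\tau]}=\gamma|_{[0,\tau]}$ and $\bar\gamma|_{[0,\tau+\varepsilon]}\neq\gamma|_{[0,\tau+\varepsilon]}$ for all sufficiently small $\varepsilon>0$. *)

(* Defs.v *)
From HB Require Import structures.
From mathcomp Require Import all_boot all_order all_algebra.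
From mathcomp Require Import all_classical all_reals all_analysis.
Set Implicit Arguments.
Unset Strict Implicit.
Unset Printing Implicit Defensive.
Import Order.TTheory GRing.Theory Num.Theory.
Import numFieldNormedType.Exports.
Local Open Scope classical_set_scope.
Local Open Scope ring_scope.

(* Vectors and covectors are rows: the matrix J of a linear map acts on vectors
   by v |-> v *m J and on covectors of the target by p |-> p *m J^T. *)

Section Calculus.
Context {R : realType}.

Definition basis_vec n (i : 'I_n) : 'rV[R]_n := delta_mx 0 i.

Fixpoint Ck_on n (W : normedModType R) (k : nat) (O : set 'rV[R]_n)
    (f : 'rV[R]_n -> W) : Prop :=
  (forall x, O x -> {for x, continuous f}) /\
  (if k is k'.+1 then
     forall i, (forall x, O x -> derivable f x (basis_vec i)) /\
               Ck_on k' O (fun x => 'D_(basis_vec i) f x)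
   else True).

(* Meaningful for open O: the values of f outside O play no role. *)
Definition smooth_on n (W : normedModType R) (O : set 'rV[R]_n)
    (f : 'rV[R]_n -> W) : Prop :=
  forall k, Ck_on k O f.

Definition abs_continuous (W : normedModType R) (a b : R) (f : R -> W) : Prop :=
  forall e, 0 < e -> exists2 d, 0 < d &
    forall (N : nat) (I : 'I_N -> R * R),
      (forall i, [/\ a <= (I i).1, (I i).1 <= (I i).2 & (I i).2 <= b]) ->
      trivIset setT (fun i => `](I i).1, (I i).2[%classic) ->
      \sum_i ((I i).2 - (I i).1) < d ->
      \sum_i `|f (I i).2 - f (I i).1| < e.

(* Derivative at t of f restricted to A; one-sided at the endpoints of an
   interval. *)
Definition has_derivative_within (W : normedModType R) (A : set R) (f : R -> W)
    (t : R) (v : W) : Prop :=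
  (fun s => (s - t)^-1 *: (f s - f t)) @ within A (dnbhs t) --> v.

(* The subspace whose underlying set is A (the zero subspace if A is not a
   vector subspace). *)
Definition vspace_of_set n (A : set 'rV[R]_n) : {vspace 'rV[R]_n} :=
  xget 0%VS [set V | [set v | v \in V] = A].

End Calculus.

Section Manifolds.
Context {R : realType}.

Record chart (M : topologicalType) (n : nat) := Chart {
  dom : set M;
  fwd : M -> 'rV[R]_n;
  bwd : 'rV[R]_n -> M }.

Definition codom_chart M n (c : chart M n) : set 'rV[R]_n := fwd c @` dom c.

Definition is_chart M n (c : chart M n) : Prop :=
  [/\ open (dom c),
      open (codom_chart c),
      (forall q, dom c q -> bwd c (fwd c q) = q),
      (forall q, dom c q -> {for q, continuous (fwd c)}) &
      (forall x, codom_chart c x -> {for x, continuous (bwd c)})].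

Definition transition M n (c c' : chart M n) : 'rV[R]_n -> 'rV[R]_n :=
  fwd c' \o bwd c.

(* A smooth n-manifold, with a preferred chart [chart_at q] around each point.
   The tangent space at q is 'rV_n, a tangent vector being given by its
   components in [chart_at q]; the cotangent space is 'rV_n likewise.  All
   notions below are independent of the preferred charts. *)
Record manifold (n : nat) := Manifold {
  carrier :> topologicalType;
  atlas : set (chart carrier n);
  chart_at : carrier -> chart carrier n;
  manifold_hausdorff : hausdorff_space carrier;
  manifold_second_countable : @second_countable carrier;
  atlas_chart : forall c, atlas c -> is_chart c;
  atlas_chart_at : forall q, atlas (chart_at q);
  dom_chart_at : forall q, dom (chart_at q) q;
  atlas_smooth : forall c c', atlas c -> atlas c' ->
    smooth_on (fwd c @` (dom c `&` dom c')) (transition c c') }.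

End Manifolds.
Arguments chart R M n : clear implicits.
Arguments manifold R n : clear implicits.

Section Fields.
Context {R : realType} {n : nat} {M : manifold R n}.
Implicit Types (c : chart R M n) (q : M) (X Y : M -> 'rV[R]_n).

Definition smooth_fun_on (O : set M) (f : M -> R) : Prop :=
  forall c, atlas c -> smooth_on (fwd c @` (O `&` dom c)) (f \o bwd c).

(* Components in the chart c of the tangent vector v at q. *)
Definition vec_coord c q (v : 'rV[R]_n) : 'rV[R]_n :=
  v *m jacobian (transition (chart_at q) c) (fwd (chart_at q) q).

Definition field_coord c X (x : 'rV[R]_n) : 'rV[R]_n :=
  vec_coord c (bwd c x) (X (bwd c x)).

Definition smooth_field_on (O : set M) X : Prop :=
  forall c, atlas c -> smooth_on (fwd c @` (O `&` dom c)) (field_coord c X).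

Definition lie_bracket X Y : M -> 'rV[R]_n := fun q =>
  let c := chart_at q in let x := fwd c q in
  'D_(field_coord c X x) (field_coord c Y) x
  - 'D_(field_coord c Y x) (field_coord c X) x.

End Fields.

Section SubRiemannian.
Context {R : realType} {n : nat} (M : manifold R n).
Implicit Types (D : M -> {vspace 'rV[R]_n}) (X Y : M -> 'rV[R]_n).

Definition section_on D (O : set M) X : Prop := forall q, O q -> X q \in D q.

Definition smooth_distribution (r : nat) D : Prop :=
  (forall q, \dim (D q) = r) /\
  (forall q, exists2 O : set M, open O /\ O q &
    exists Y : 'I_r -> M -> 'rV[R]_n,
      (forall i, smooth_field_on O (Y i)) /\
      (forall p, O p -> D p = <<[seq Y i p | i <- enum 'I_r]>>%VS)).

(* The Lie algebra generated by the smooth sections of D. *)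
Inductive lie_generated D : (M -> 'rV[R]_n) -> Prop :=
| lie_generated_section X :
    smooth_field_on setT X -> section_on D setT X -> lie_generated D X
| lie_generated_add X Y :
    lie_generated D X -> lie_generated D Y ->
    lie_generated D (fun q => X q + Y q)
| lie_generated_scale (a : R) X :
    lie_generated D X -> lie_generated D (fun q => a *: X q)
| lie_generated_bracket X Y :
    lie_generated D X -> lie_generated D Y ->
    lie_generated D (lie_bracket X Y).

Definition totally_nonholonomic D : Prop :=
  forall q (v : 'rV[R]_n), exists2 X, lie_generated D X & X q = v.

Definition riemannian_metric_on D (g : M -> 'rV[R]_n -> 'rV[R]_n -> R) : Prop :=
  [/\ (forall q v w, v \in D q -> w \in D q -> g q v w = g q w v),
      (forall q (a : R) v v' w, v \in D q -> v' \in D q -> w \in D q ->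
         g q (a *: v + v') w = a * g q v w + g q v' w),
      (forall q v, v \in D q -> v != 0 -> 0 < g q v v) &
      (forall O X Y, open O ->
         smooth_field_on O X -> section_on D O X ->
         smooth_field_on O Y -> section_on D O Y ->
         smooth_fun_on O (fun q => g q (X q) (Y q)))].

Record sub_riemannian (r : nat) := SubRiemannian {
  distribution : M -> {vspace 'rV[R]_n};
  metric : M -> 'rV[R]_n -> 'rV[R]_n -> R;
  distribution_smooth : smooth_distribution r distribution;
  distribution_nonholonomic : totally_nonholonomic distribution;
  metric_riemannian : riemannian_metric_on distribution metric }.

Definition orthonormal_frame (S : sub_riemannian 2) X1 X2 : Prop :=
  [/\ smooth_field_on setT X1, smooth_field_on setT X2,
      (forall q, distribution S q = <<[:: X1 q; X2 q]>>%VS),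
      (forall q, metric S q (X1 q) (X1 q) = 1 /\ metric S q (X2 q) (X2 q) = 1) &
      (forall q, metric S q (X1 q) (X2 q) = 0)].

End SubRiemannian.

Section Horizontal.
Context {R : realType} {n : nat} {M : manifold R n}.
Variables X1 X2 : M -> 'rV[R]_n.
Implicit Types (gamma : R -> M) (u : R -> R * R) (a b T : R).

(* Curves on [a, b] are functions on R of which only the values on [a, b]
   matter. *)

Definition ac_curve a b gamma : Prop :=
  {within `[a, b], continuous gamma} /\
  (forall c s t, atlas c -> a <= s -> s < t -> t <= b ->
     (forall r, s <= r <= t -> dom c (gamma r)) ->
     abs_continuous s t (fwd c \o gamma)).

Definition speed u (t : R) : R := Num.sqrt ((u t).1 ^+ 2 + (u t).2 ^+ 2).

Definition L2_control a b u : Prop :=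
  [/\ measurable_fun `[a, b] (fun t => (u t).1),
      measurable_fun `[a, b] (fun t => (u t).2) &
      (lebesgue_measure.-integrable `[a, b] (fun t => (speed u t ^+ 2)%:E))].

Definition horizontal a b gamma u : Prop :=
  [/\ ac_curve a b gamma, L2_control a b u &
      {ae lebesgue_measure, forall t, t \in `[a, b] ->
        has_derivative_within `[a, b] (fwd (chart_at (gamma t)) \o gamma) t
          ((u t).1 *: X1 (gamma t) + (u t).2 *: X2 (gamma t))}].

Definition control_length a b u : \bar R :=
  (\int[lebesgue_measure]_(t in `[a, b]) (speed u t)%:E)%E.

Definition sr_dist (p q : M) : \bar R :=
  ereal_inf [set l | exists T gamma u,
    [/\ 0 < T, horizontal 0 T gamma u, gamma 0 = p, gamma T = q
      & l = control_length 0 T u]].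

Definition length_minimizer a b gamma : Prop :=
  exists2 u, horizontal a b gamma u &
    control_length a b u = sr_dist (gamma a) (gamma b).

Definition geodesic T gamma : Prop :=
  (exists u (v : R), horizontal 0 T gamma u /\
     {ae lebesgue_measure, forall t, t \in `[0, T] -> speed u t = v}) /\
  (forall t, 0 <= t <= T -> exists2 e, 0 < e &
     length_minimizer (Num.max 0 (t - e)) (Num.min T (t + e)) gamma).

End Horizontal.

Section Cotangent.
Context {R : realType} {n : nat} {M : manifold R n}.

(* (q, xi) is the covector at q with components xi in [chart_at q]. *)
Definition cotangent : Type := (M * 'rV[R]_n)%type.

Implicit Types (c : chart R M n) (l : cotangent) (h : cotangent -> R)
  (V : cotangent -> 'rV[R]_n * 'rV[R]_n) (lam : R -> cotangent).

(* Canonical coordinates (x, p) on T*M induced by the chart c. *)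
Definition ctg_coord c l : 'rV[R]_n * 'rV[R]_n :=
  let x := fwd c l.1 in
  (x, l.2 *m (jacobian (transition c (chart_at l.1)) x)^T).

Definition of_ctg_coord c (x p : 'rV[R]_n) : cotangent :=
  let q := bwd c x in
  (q, p *m (jacobian (transition (chart_at q) c) (fwd (chart_at q) q))^T).

(* A tangent vector to T*M at l is given by its components in the canonical
   coordinates induced by [chart_at l.1]; here these are
   (dh/dp, - dh/dx). *)
Definition hamiltonian_field h l : 'rV[R]_n * 'rV[R]_n :=
  let c := chart_at l.1 in
  let x := (ctg_coord c l).1 in let p := (ctg_coord c l).2 in
  (\row_i 'D_(basis_vec i) (fun p' => h (of_ctg_coord c x p')) p,
   - \row_i 'D_(basis_vec i) (fun x' => h (of_ctg_coord c x' p)) x).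

Definition hfun (X : M -> 'rV[R]_n) l : R := \sum_i l.2 0 i * X l.1 0 i.

Definition integral_curve a b V lam : Prop :=
  {within `[a, b], continuous (fst \o lam)} /\
  forall t, a <= t <= b ->
    has_derivative_within `[a, b] (ctg_coord (chart_at (lam t).1) \o lam) t
      (V (lam t)).

Definition ac_ctg_curve a b lam : Prop :=
  {within `[a, b], continuous (fst \o lam)} /\
  (forall c s t, atlas c -> a <= s -> s < t -> t <= b ->
     (forall r, s <= r <= t -> dom c (lam r).1) ->
     abs_continuous s t (ctg_coord c \o lam)).

Definition is_lift a b (gamma : R -> M) lam : Prop :=
  forall t, a <= t <= b -> (lam t).1 = gamma t.

End Cotangent.
Arguments cotangent {R n} M.

Section Extremals.
Context {R : realType} {n : nat} {M : manifold R n}.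
Variables X1 X2 : M -> 'rV[R]_n.
Implicit Types (gamma : R -> M) (lam : R -> cotangent M) (T tau : R).

Local Notation X12 := (lie_bracket X1 X2).
Local Notation h1 := (hfun X1).
Local Notation h2 := (hfun X2).
Local Notation h12 := (hfun X12).
Local Notation h112 := (hfun (lie_bracket X1 X12)).
Local Notation h212 := (hfun (lie_bracket X2 X12)).

Definition sr_hamiltonian (l : cotangent M) : R := 2^-1 * (h1 l ^+ 2 + h2 l ^+ 2).

Definition normal_lift T gamma lam : Prop :=
  is_lift 0 T gamma lam /\
  integral_curve 0 T (hamiltonian_field sr_hamiltonian) lam.

Definition normal_geodesic T gamma : Prop :=
  geodesic X1 X2 T gamma /\ exists lam, normal_lift T gamma lam.

Definition abnormal_lift T gamma lam : Prop :=
  exists2 u, horizontal X1 X2 0 T gamma u &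
  [/\ ac_ctg_curve 0 T lam, is_lift 0 T gamma lam,
      (forall t, 0 <= t <= T ->
         [/\ (lam t).2 != 0, h1 (lam t) = 0 & h2 (lam t) = 0]) &
      {ae lebesgue_measure, forall t, t \in `[0, T] ->
        has_derivative_within `[0, T]
          (ctg_coord (chart_at (lam t).1) \o lam) t
          ((u t).1 *: hamiltonian_field h1 (lam t)
           + (u t).2 *: hamiltonian_field h2 (lam t))}].

Definition strictly_abnormal T gamma : Prop :=
  (exists lam, abnormal_lift T gamma lam) /\
  ~ (exists lam, normal_lift T gamma lam).

Definition abnormal_covectors gamma t : set 'rV[R]_n :=
  [set xi | xi = 0 \/
     exists2 lam, abnormal_lift t gamma lam & lam 0 = (gamma 0, xi)].

Definition dim_abnormal gamma t : nat :=
  \dim (vspace_of_set (abnormal_covectors gamma t)).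

Definition Delta2_perp : set (cotangent M) :=
  [set l | [/\ h1 l = 0, h2 l = 0 & h12 l = 0]].

Definition Delta3_perp : set (cotangent M) :=
  [set l | [/\ h1 l = 0, h2 l = 0, h12 l = 0, h112 l = 0 & h212 l = 0]].

Definition regular_set : set (cotangent M) := Delta2_perp `\` Delta3_perp.

Definition G_field (l : cotangent M) : 'rV[R]_n * 'rV[R]_n :=
  let N := Num.sqrt (h212 l ^+ 2 + h112 l ^+ 2) in
  (- h212 l / N) *: hamiltonian_field h1 l
  + (h112 l / N) *: hamiltonian_field h2 l.

Definition regular_abnormal_lift T gamma lam : Prop :=
  [/\ is_lift 0 T gamma lam,
      (forall t, 0 <= t <= T -> regular_set (lam t)) &
      integral_curve 0 T G_field lam \/
      integral_curve 0 T (fun l => - G_field l) lam].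

Definition regular_abnormal_geodesic T gamma : Prop :=
  geodesic X1 X2 T gamma /\ exists lam, regular_abnormal_lift T gamma lam.

End Extremals.

(* Here gbar branches from gamma.  The last clause does not depend on the values
   of either curve beyond its domain, since e may be taken arbitrarily small. *)
Definition branches_at {R : realType} {n : nat} {M : manifold R n}
    (tau : R) (gamma gbar : R -> M) : Prop :=
  (forall t, 0 <= t <= tau -> gbar t = gamma t) /\
  (\forall e \near 0^'+, exists2 t, 0 <= t <= tau + e & gbar t <> gamma t).

(* Main.v *)
Require Import Defs.
From HB Require Import structures.
From mathcomp Require Import all_boot all_order all_algebra.
From mathcomp Require Import all_classical all_reals all_analysis.
From mathcomp Require Import measurable_realfun lra.
Import Order.TTheory GRing.Theory Num.Theory.
Import numFieldNormedType.Exports.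
Local Open Scope classical_set_scope.
Local Open Scope ring_scope.
Set Implicit Arguments.
Unset Strict Implicit.
Unset Printing Implicit Defensive.

(** Why the theorem holds. Write [lam] and [lamb] for normal lifts of [gamma] and of the
    branch [gbar], [nu] for a regular abnormal lift of [gbar], and compare everything on
    a common interval [[0, b]] with [tau < b]. All these lifts satisfy one equation,
    linear in the covector, whose control is determined by the velocity of the curve.

    On [[0, tau]] the two curves coincide, so [lam] and [lamb] have the same momenta and
    [lamb - lam] is an abnormal lift of [gamma] (or zero); [nu] is one as well. Both
    initial covectors lie in the space W attached to [tau], of dimension [k.+1], which
    contains the space V attached to [b], of dimension [k]. Hence, either [nu 0] lies in
    V, or [(lamb - lam) 0 - a nu 0] lies in V for some number [a].

    In the first case [nu] on [[0, tau]] extends to an abnormal lift [xi] of [gamma] on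
    [[0, b]]. Differentiating the relations [h1 = h2 = 0] and then [h12 = 0] along [xi]
    gives [u1 h112 + u2 h212 = 0]; as the control is a unit vector and [xi] is regular
    at [tau], [xi] is just after [tau] an integral curve of the same field, [G_field] or
    its opposite, as [nu] ([regular_unique_forward]).

    In the second case let [xi] be the abnormal lift of [gamma] on [[0, b]] starting
    at that element of V, or the zero lift. Adding an abnormal lift to a normal one
    gives a normal lift, so [lam + xi] is a normal lift of [gamma] and [lamb - a nu] one
    of [gbar]; they start at the same covector and the normal flow is deterministic
    ([normal_unique_forward]).

    In both cases [gbar] and [gamma] coincide just after [tau], so [gbar] does not
    branch from [gamma] there ([no_regular_normal_branch]). A regular branch is
    therefore not normal, and its regular lift is an abnormal lift.

    Two points need care. Integral curves are given at each time in the preferred chart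
    of that time, so the lift equation and the brackets must be shown invariant under
    changes of charts, which rests on the symmetry of second derivatives
    ([Schwarz_C2], [field_coord_bracket], [lift_eq_change]). Abnormal lifts satisfy
    their equation only almost everywhere, with a square integrable control; along a
    curve with continuous control they are shown to be differentiable
    ([ac_growth], [ac_lift_follows]). *)

(** * Cousin's lemma and the mean value inequality *)

Section IntervalAnalysis.
Context {R : realType}.

(** Supremum argument: intervals starting at [a] on which [P] holds cannot stop
    short of [b]. The radius [d] may depend on the point [t], so differentiability
    at each point, without any uniformity, is enough to apply it. *)
Lemma cousin (a b : R) (P : R -> R -> Prop) : a <= b ->
  (forall x y z, x <= y -> y <= z -> P x y -> P y z -> P x z) ->
  (forall t, a <= t <= b -> exists2 d, 0 < d &
     forall x y, a <= x -> x <= t -> t <= y -> y <= b ->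
       t - d < x -> y < t + d -> P x y) ->
  P a b.
Proof.
move=> ab Padd Ploc.
pose S := [set x | a <= x <= b /\ P a x].
have Paa : P a a.
  have [|d d0 H] := Ploc a; first by rewrite lexx ab.
  by apply: H => //; lra.
have Sa : S a by split=> //; rewrite lexx ab.
have Sub : ubound S b by move=> x [/andP[]].
have hS : has_sup S by split; [exists a | exists b].
have as_ : a <= sup S by apply: ub_le_sup => //; exists b.
have sb : sup S <= b by apply: ge_sup => //; exists a.
have [|d d0 H] := Ploc (sup S); first by rewrite as_ sb.
have [x Sx xs] := sup_adherent d0 hS.
have xsup : x <= sup S by apply: ub_le_sup => //; exists b.
case: Sx => /andP[ax xb] Pax.
pose y := Num.min b (sup S + d / 2).
have yb : y <= b by rewrite /y ge_min lexx.
have ys : sup S <= y by rewrite /y le_min sb; lra.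
have yd : y < sup S + d by rewrite /y gt_min; apply/orP; right; lra.
have Pay : P a y.
  by apply: (Padd a x y) => //; [exact: le_trans ys | exact: H].
have : y <= sup S.
  apply: ub_le_sup; first by exists b.
  by split=> //; rewrite yb (le_trans as_ ys).
rewrite /y ge_min => /orP[bs|]; last by lra.
suff -> : b = y by [].
by apply/eqP; rewrite eq_le yb (le_trans bs ys).
Qed.

Section W.
Context {W : normedModType R}.
Implicit Types (A : set R) (f : R -> W) (v : W).

(** Free of quotients; at [s = t] both sides vanish, so the point [t] need not be
    excluded. *)
Lemma hdwP A f t v : has_derivative_within A f t v <->
  forall e, 0 < e -> exists2 d, 0 < d &
    forall s, A s -> `|s - t| < d ->
      `|f s - f t - (s - t) *: v| <= e * `|s - t|.
Proof.
rewrite /has_derivative_within; split.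
  move=> /cvgrPdist_le H e e0; have := H _ e0.
  rewrite !near_withinE => /nbhs_ballP[d /= d0 Hd]; exists d => // s As std.
  have [->|st] := eqVneq s t; first by rewrite !subrr scale0r subr0 !normr0 mulr0.
  have := Hd s; rewrite /ball /= distrC => /(_ std st As).
  have st0 : s - t != 0 by rewrite subr_eq0.
  move=> h.
  have -> : f s - f t - (s - t) *: v =
     - ((s - t) *: (v - (s - t)^-1 *: (f s - f t))).
    by rewrite scalerBr scalerA divff// scale1r opprB.
  by rewrite normrN normrZ mulrC ler_wpM2r.
move=> H; apply/cvgrPdist_le => e e0; have [d d0 Hd] := H _ e0.
rewrite !near_withinE; apply/nbhs_ballP; exists d => // s /=.
rewrite /ball /= distrC => std st As.
have st0 : s - t != 0 by rewrite subr_eq0.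
have := Hd s As std.
have -> : f s - f t - (s - t) *: v =
     - ((s - t) *: (v - (s - t)^-1 *: (f s - f t))).
    by rewrite scalerBr scalerA divff// scale1r opprB.
rewrite normrN normrZ mulrC ler_pM2r //.
by rewrite normr_gt0.
Qed.

(** In a general normed space there is no intermediate point as in Rolle's theorem.
    The inequality with a slightly larger constant holds on small intervals around
    each point, and Cousin's lemma adds these up. *)
Lemma mean_value_ineq (a b K : R) f (f' : R -> W) : a <= b ->
  (forall t, a <= t <= b -> has_derivative_within `[a, b] f t (f' t)) ->
  (forall t, a <= t <= b -> `|f' t| <= K) ->
  `|f b - f a| <= K * (b - a).
Proof.
move=> ab df bf; apply/ler_addgt0Pl => e e0.
pose e' := e / (b - a + 1).
have ba1 : 0 < b - a + 1 by lra.
have e'0 : 0 < e' by rewrite divr_gt0.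
have : `|f b - f a| <= (K + e') * (b - a).
  pose P x y := `|f y - f x| <= (K + e') * (y - x).
  apply: (@cousin a b P) => //.
    move=> x y z xy yz; rewrite /P => h1 h2.
    have -> : f z - f x = (f z - f y) + (f y - f x) by rewrite addrA subrK.
    by apply: le_trans (ler_normD _ _) _; lra.
  move=> t tab; have /hdwP/(_ _ e'0)[d d0 Hd] := df _ tab.
  exists d => // x y ax xt ty yb tx yt; rewrite /P.
  have step s : a <= s -> s <= b -> `|s - t| < d ->
      `|f s - f t| <= (K + e') * `|s - t|.
    move=> as_ sb std.
    have -> : f s - f t = (f s - f t - (s - t) *: f' t) + (s - t) *: f' t.
      by rewrite subrK.
    apply: le_trans (ler_normD _ _) _.
    rewrite addrC mulrDl lerD//.
      by rewrite normrZ mulrC ler_wpM2r// bf.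
    by apply: Hd => //=; rewrite in_itv /= as_ sb.
  have -> : f y - f x = (f y - f t) - (f x - f t) by rewrite opprB addrA subrK.
  apply: le_trans (ler_normB _ _) _.
  have := step x ax (le_trans xt (le_trans ty yb)).
  have := step y (le_trans ax (le_trans xt ty)) yb.
  rewrite (ger0_norm (_ : 0 <= y - t)) ?subr_ge0//.
  rewrite (ler0_norm (_ : x - t <= 0)) ?subr_le0//.
  move=> h1 h2.
  have := h1 _; have := h2 _; lra.
move/le_trans; apply.
rewrite mulrDl addrC lerD2r /e'.
rewrite mulrAC ler_pdivrMr// ler_pM2l//; lra.
Qed.

(** Connectedness of [[a, b]], in a form where the set of points satisfying [Q] need
    not be known to be closed. *)
Lemma interval_propagate (a b : R) (Q : R -> Prop) : a <= b ->
  (forall t, a <= t <= b -> exists2 d, 0 < d &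
     forall s r, a <= s <= b -> a <= r <= b ->
       `|s - t| < d -> `|r - t| < d -> Q s -> Q r) ->
  Q a <-> Q b.
Proof.
move=> ab Hloc; apply: (@cousin a b (fun x y => Q x <-> Q y)) => //.
  by move=> x y z _ _ [? ?] [? ?]; split; auto.
move=> t tab; have [d d0 H] := Hloc t tab; exists d => // x y ax xt ty yb tx yt.
have [xab yab] : a <= x <= b /\ a <= y <= b by split; apply/andP; split; lra.
have [dx dy] : `|x - t| < d /\ `|y - t| < d.
  by split; rewrite ltr_norml; apply/andP; split; lra.
by split; apply: H.
Qed.

End W.
End IntervalAnalysis.

(** * Absolutely continuous curves *)

Section AC.
Context {R : realType} {W : normedModType R}.
Local Notation mu := (@lebesgue_measure R).

(** The points where the bound on the derivative fails lie in an open set [U] of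
    small measure. In a subdivision given by Cousin's lemma, the intervals tagged at
    such points lie in [U], and absolute continuity makes their total contribution
    small; on the others the mean value estimate applies. *)
Lemma ac_growth (a b K : R) (f : R -> W) : a <= b -> 0 <= K ->
  abs_continuous a b f ->
  {ae mu, forall t, t \in `[a, b] ->
     exists2 v, has_derivative_within `[a, b] f t v & `|v| <= K} ->
  `|f b - f a| <= K * (b - a).
Proof.
move=> ab K0 acf [N [mN N0 HN]]; apply/ler_addgt0Pl => e e0.
pose e' := e / 2 / (b - a + 1).
have ba1 : 0 < b - a + 1 by lra.
have e'0 : 0 < e' by rewrite !divr_gt0.
have e20 : 0 < e / 2 by rewrite divr_gt0.
have [d d0 Hd] := acf _ e20.
have [U [oU NU muU]] : exists U : set R,
    [/\ open U, N `<=` U & (mu (U `\` N) < d%:E)%E].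
  by apply: lebesgue_regularity_outer => //;
      apply: (@le_lt_trans _ _ 0%E); [rewrite le_eqVlt; apply/orP; left; apply/eqP; exact: N0 | exact: ltry].
have muUd : (mu U < d%:E)%E.
  have mU : measurable U by exact: open_measurable.
  have <- : ((U `\` N) `|` N) = U by rewrite setUC setDUK.
  apply: le_lt_trans (measureU2 _ _ _) _ => //; first exact: measurableD.
  apply: (@le_lt_trans _ _ (mu (U `\` N) + 0)%E); last by rewrite adde0.
  by rewrite leeD2l// le_eqVlt; apply/orP; left; apply/eqP; exact: N0.
(* transitive, so the intervals of a sorted list are pairwise disjoint *)
pose le2 (I J : R * R) := (I.2 <= J.1) && (J.1 <= J.2).
(* the list s holds the subintervals contained in U, from left to right *)
pose P x y := exists s : seq (R * R), [/\ path le2 (x, x) (rcons s (y, y)),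
  (forall I, I \in s -> `]I.1, I.2[%classic `<=` U) &
  `|f y - f x| <= (K + e') * (y - x) + \sum_(I <- s) `|f I.2 - f I.1|].
have [s [sp sU fs]] : P a b.
  apply: (@cousin R a b P) => //.
    move=> x y z xy yz [s [p1 u1 b1]] [s' [p2 u2 b2]].
    (* the empty interval at y keeps the concatenation ordered *)
    exists (s ++ (y, y) :: s'); split.
    - have -> : rcons (s ++ (y, y) :: s') (z, z)
          = rcons s (y, y) ++ rcons s' (z, z).
        by rewrite rcons_cat rcons_cons cat_rcons.
      by rewrite cat_path p1 last_rcons.
    - move=> I; rewrite mem_cat inE => /or3P[/u1//|/eqP->|/u2//] /=.
      by move=> r /=; rewrite in_itv /= => /andP[]; lra.
    - rewrite big_cat big_cons /= subrr normr0 add0r.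
      have -> : f z - f x = (f z - f y) + (f y - f x) by rewrite addrA subrK.
      by apply: le_trans (ler_normD _ _) _; lra.
  move=> t tab; have [Ut|nUt] := pselect (U t).
    have /nbhs_ballP[r /= r0 Hr] := open_nbhs_nbhs (conj oU Ut).
    exists r => // x y ax xt ty yb tx yt; exists [:: (x, y)]; split.
    - by rewrite /= /le2 /= !lexx andbT (le_trans xt ty).
    - move=> I; rewrite inE => /eqP-> q /=; rewrite in_itv /= => /andP[xq qy].
      apply: Hr; rewrite /ball /= ltr_norml; apply/andP; split; lra.
    - rewrite big_seq1 /= lerDr mulr_ge0//; lra.
  have [v dv Kv] : exists2 v, has_derivative_within `[a, b] f t v & `|v| <= K.
    apply: contrapT => h; apply/nUt/NU/HN => /= h'; apply: h; apply: h'.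
    by rewrite in_itv /=.
  have /hdwP/(_ _ e'0)[r r0 Hr] := dv.
  exists r => // x y ax xt ty yb tx yt; exists [::]; split => //.
    by rewrite /= /le2 /= lexx (le_trans xt ty).
  rewrite big_nil addr0.
  have step s : a <= s -> s <= b -> `|s - t| < r ->
      `|f s - f t| <= (K + e') * `|s - t|.
    move=> as_ sb std.
    have -> : f s - f t = (f s - f t - (s - t) *: v) + (s - t) *: v.
      by rewrite subrK.
    apply: le_trans (ler_normD _ _) _.
    rewrite addrC mulrDl lerD//.
      by rewrite normrZ mulrC ler_wpM2r.
    by apply: Hr => //=; rewrite in_itv /= as_ sb.
  have -> : f y - f x = (f y - f t) - (f x - f t) by rewrite opprB addrA subrK.
  apply: le_trans (ler_normB _ _) _.
  have := step x ax (le_trans xt (le_trans ty yb)).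
  have := step y (le_trans ax (le_trans xt ty)) yb.
  rewrite (ger0_norm (_ : 0 <= y - t)) ?subr_ge0//.
  rewrite (ler0_norm (_ : x - t <= 0)) ?subr_le0//.
  by move=> h1 h2; have := h1 _; have := h2 _; lra.
have le2_trans : transitive le2.
  move=> J I L /andP[h1 h2] /andP[h3 h4]; rewrite /le2 h4 andbT.
  exact: le_trans h1 (le_trans h2 h3).
pose I0 : R * R := (0, 0).
have sort_s : sorted le2 s.
  by move: sp; rewrite rcons_path => /andP[/path_sorted].
have all_s I : I \in s -> [/\ a <= I.1, I.1 <= I.2 & I.2 <= b].
  move=> Is; have := sp; rewrite (path_sortedE le2_trans) => /andP[/allP h1 _].
  have /andP[/= aI II] : le2 (a, a) I by apply: h1; rewrite mem_rcons inE Is orbT.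
  split=> //.
  have : sorted le2 (rcons s (b, b)) by apply: path_sorted sp.
  rewrite -[rcons _ _]revK rev_rcons.
  rewrite rev_sorted /= (path_sortedE (rev_trans le2_trans)) => /andP[/allP + _].
  by move=> /(_ I); rewrite mem_rev => /(_ Is) /andP[].
have triv : trivIset setT
    (fun i : 'I_(size s) => `](nth I0 s i).1, (nth I0 s i).2[%classic).
  have key (i j : 'I_(size s)) x : (i < j)%N ->
      `](nth I0 s i).1, (nth I0 s i).2[%classic x ->
      `](nth I0 s j).1, (nth I0 s j).2[%classic x -> False.
    move=> ij; have := sorted_ltn_nth le2_trans I0 sort_s.
    move=> /(_ i j (ltn_ord i) (ltn_ord j) ij) /andP[h1 h2] /=.
    by rewrite !in_itv /= => /andP[? ?] /andP[? ?]; lra.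
  move=> i j _ _ [x [xi xj]]; apply/val_inj/eqP; rewrite eqn_leq.
  by apply/andP; split; rewrite leqNgt; apply/negP => ij;
    [apply: (key j i x) | apply: (key i j x)].
have sum_len : \sum_(i < size s) ((nth I0 s i).2 - (nth I0 s i).1) < d.
  rewrite -lte_fin; apply: le_lt_trans muUd.
  rewrite -sumEFin.
  have -> : (\sum_(i < size s) ((nth I0 s i).2 - (nth I0 s i).1)%:E)%E =
     (\sum_(i < size s) mu (`](nth I0 s i).1, (nth I0 s i).2[%classic))%E.
    apply: eq_bigr => i _; rewrite lebesgue_measure_itv /= lte_fin.
    have [_ h _] := all_s _ (mem_nth I0 (ltn_ord i)).
    case: ltP => [_|h']; first by rewrite EFinB.
    have -> : (nth I0 s i).1 = (nth I0 s i).2 by lra.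
    by rewrite subrr.
  have mI (i : 'I_(size s)) : measurable (`](nth I0 s i).1, (nth I0 s i).2[%classic : set R).
    exact: measurable_itv.
  rewrite -(measure_semi_additive_ord mu mI triv); last first.
    by apply: bigsetU_measurable => i _; exact: mI.
  apply: le_measure; rewrite ?inE.
  - by apply: bigsetU_measurable => i _; exact: mI.
  - exact: open_measurable.
  - move=> x; rewrite -bigcup_seq => -[i _ xi].
    by apply: (sU (nth I0 s i)) => //; exact: mem_nth.
have := Hd _ (fun i : 'I_(size s) => nth I0 s i) _ triv sum_len.
rewrite (big_nth I0) big_mkord in fs.
move=> /(_ (fun i => all_s _ (mem_nth I0 (ltn_ord i)))) hh.
have : (K + e') * (b - a) <= K * (b - a) + e / 2.
  rewrite mulrDl lerD2l /e' mulrAC ler_pdivrMr// ler_pM2l//; lra.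
by move: fs hh; lra.
Qed.

End AC.

(** * Calculus of derivatives within a set *)

Section Toolkit.
Context {R : realType}.
Implicit Types (A B : set R) (t : R).
Local Notation mu := (@lebesgue_measure R).

Definition non_isolated A t := forall d, 0 < d -> exists2 s, A s & 0 < `|s - t| < d.

Lemma non_isolated_itv (a b t : R) : a < b -> a <= t <= b ->
  non_isolated `[a, b] t.
Proof.
move=> ab /andP[at_ tb] d d0.
have [tb'|bt] := ltP t b.
  pose s := Num.min b (t + d / 2).
  have st : t < s by rewrite lt_min tb' /=; lra.
  have sb : s <= b by rewrite ge_min lexx.
  have sd : s <= t + d / 2 by rewrite ge_min lexx orbT.
  exists s; first by rewrite /= in_itv /= sb; lra.
  by rewrite gtr0_norm ?subr_gt0//; lra.
pose s := Num.max a (t - d / 2).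
have st : s < t by rewrite gt_max; lra.
have sa : a <= s by rewrite le_max lexx.
have sd : t - d / 2 <= s by rewrite le_max lexx orbT.
exists s; first by rewrite /= in_itv /= sa; lra.
by rewrite ltr0_norm ?subr_lt0//; lra.
Qed.

Lemma cvg_within_sub (T : topologicalType) A B (f : R -> T) (t : R) (l : T) : B `<=` A ->
  f @ within A (nbhs t) --> l -> f @ within B (nbhs t) --> l.
Proof.
move=> BA H; apply: cvg_trans H; apply: cvg_app => P.
rewrite !nbhs_simpl /within /=; apply: (@filterS _ (nbhs t) _) => s As Bs.
exact: As (BA _ Bs).
Qed.

Section One.
Context {W : normedModType R}.

Lemma within_cvgP (f : R -> W) A t (l : W) :
  f @ within A (nbhs t) --> l <->
  (forall e, 0 < e -> exists2 d, 0 < d &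
    forall s, A s -> `|s - t| < d -> `|f s - l| < e).
Proof.
split.
  move=> /cvgrPdist_lt H e e0; have := H _ e0.
  rewrite near_withinE => /nbhs_ballP[d /= d0 Hd]; exists d => // s As sd.
  by rewrite distrC; apply: Hd => //; rewrite /ball /= distrC.
move=> H; apply/cvgrPdist_lt => e e0; have [d d0 Hd] := H _ e0.
rewrite near_withinE; apply/nbhs_ballP; exists d => // s.
by rewrite /ball /= distrC => sd As; rewrite distrC Hd.
Qed.

(** One-sided derivatives at the endpoints of an interval are unique as well, since
    these are not isolated. *)
Lemma hdw_unique A (f : R -> W) t v w : non_isolated A t ->
  has_derivative_within A f t v -> has_derivative_within A f t w -> v = w.
Proof.
move=> accA /hdwP hv /hdwP hw; apply/eqP; rewrite -subr_eq0 -normr_eq0.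
rewrite eq_le normr_ge0 andbT; apply/ler_addgt0Pl => e e0; rewrite addr0.
have e20 : 0 < e / 2 by rewrite divr_gt0.
have [d1 d10 H1] := hv _ e20; have [d2 d20 H2] := hw _ e20.
have [|s As /andP[s0 sd]] := accA (Num.min d1 d2); first by rewrite lt_min d10.
move: sd; rewrite lt_min => /andP[sd1 sd2].
rewrite -(ler_pM2r s0).
have := H1 s As sd1; have := H2 s As sd2 => h2 h1.
rewrite [leLHS]mulrC -normrZ scalerBr.
have -> : (s - t) *: v - (s - t) *: w =
   (f s - f t - (s - t) *: w) - (f s - f t - (s - t) *: v).
  by rewrite [in RHS]opprB [RHS]addrC subrKA.
apply: le_trans (ler_normB _ _) _; lra.
Qed.

Lemma hdw_local A B (f g : R -> W) t v d : 0 < d -> f t = g t ->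
  (forall s, B s -> `|s - t| < d -> A s /\ f s = g s) ->
  has_derivative_within A f t v -> has_derivative_within B g t v.
Proof.
move=> d0 fgt H /hdwP hf; apply/hdwP => e e0; have [d' d'0 Hd'] := hf _ e0.
exists (Num.min d d'); first by rewrite lt_min d0.
move=> s Bs; rewrite lt_min => /andP[sd sd'].
by have [As fgs] := H s Bs sd; rewrite -fgs -fgt; apply: Hd'.
Qed.

Lemma hdw_sub A B (f : R -> W) t v : B `<=` A ->
  has_derivative_within A f t v -> has_derivative_within B f t v.
Proof. by move=> BA; apply: (@hdw_local _ _ _ _ _ _ 1) => // s /BA. Qed.

Lemma hdw_cvg A (f : R -> W) t v : has_derivative_within A f t v ->
  f @ within A (nbhs t) --> f t.
Proof.
move=> /hdwP h; apply/within_cvgP => e e0.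
have [d d0 Hd] := h 1 ltr01.
have v1 : 0 < 1 + `|v| by rewrite ltr_pwDl.
exists (Num.min d (e / (1 + `|v|))); first by rewrite lt_min d0 divr_gt0.
move=> s As; rewrite lt_min => /andP[sd]; rewrite ltr_pdivlMr// => se.
have -> : f s - f t = (f s - f t - (s - t) *: v) + (s - t) *: v by rewrite subrK.
apply: le_lt_trans (ler_normD _ _) _.
have := Hd s As sd; rewrite normrZ; lra.
Qed.

Lemma hdw_cst A (c : W) t : has_derivative_within A (fun=> c) t 0.
Proof.
apply/hdwP => e e0; exists 1 => // s _ _.
by rewrite subrr scaler0 subr0 normr0 mulr_ge0// ltW.
Qed.

Lemma hdw_id A t : has_derivative_within A (id : R -> R) t 1.
Proof.
apply/hdwP => e e0; exists 1 => // s _ _.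
have -> : (s - t) *: (1 : R) = s - t by rewrite /GRing.scale /= mulr1.
by rewrite subrr normr0 mulr_ge0// ltW.
Qed.

Lemma hdwD A (f g : R -> W) t v w :
  has_derivative_within A f t v -> has_derivative_within A g t w ->
  has_derivative_within A (fun s => f s + g s) t (v + w).
Proof.
move=> /hdwP hf /hdwP hg; apply/hdwP => e e0.
have e20 : 0 < e / 2 by rewrite divr_gt0.
have [d1 d10 H1] := hf _ e20; have [d2 d20 H2] := hg _ e20.
exists (Num.min d1 d2); first by rewrite lt_min d10.
move=> s As; rewrite lt_min => /andP[sd1 sd2].
have -> : f s + g s - (f t + g t) - (s - t) *: (v + w) =
   (f s - f t - (s - t) *: v) + (g s - g t - (s - t) *: w).
  by rewrite scalerDr !opprD !addrA; rewrite (ACl (1*3*5*2*4*6)).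
apply: le_trans (ler_normD _ _) _.
have := H1 s As sd1; have := H2 s As sd2; lra.
Qed.

End One.

Section Two.
Context {V W : normedModType R}.

Lemma hdw_mul A (a : R -> R) (f : R -> W) t a' v :
  has_derivative_within A a t a' -> has_derivative_within A f t v ->
  has_derivative_within A (fun s => a s *: f s) t (a' *: f t + a t *: v).
Proof.
move=> ha hf; have /within_cvgP ca := hdw_cvg ha.
move: ha hf => /hdwP ha /hdwP hf.
apply/hdwP => e e0.
pose Ca := 1 + `|a t|; have Ca0 : 0 < Ca by rewrite ltr_pwDl.
pose Cv := 1 + `|v|; have Cv0 : 0 < Cv by rewrite ltr_pwDl.
pose Cf := 1 + `|f t|; have Cf0 : 0 < Cf by rewrite ltr_pwDl.
have e30 : 0 < e / 3 by rewrite divr_gt0.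
have [d1 d10 H1] := ha _ (divr_gt0 e30 Cf0).
have [d2 d20 H2] := hf _ (divr_gt0 e30 Ca0).
have [d3 d30 H3] := ca _ (divr_gt0 e30 Cv0).
have [d4 d40 H4] := ca _ ltr01.
exists (Num.min (Num.min d1 d2) (Num.min d3 d4)).
  by rewrite !lt_min d10 d20 d30.
move=> s As; rewrite !lt_min => /andP[/andP[sd1 sd2] /andP[sd3 sd4]].
have -> : a s *: f s - a t *: f t - (s - t) *: (a' *: f t + a t *: v) =
   a s *: (f s - f t - (s - t) *: v) + (a s - a t - (s - t) * a') *: f t +
   (s - t) *: ((a s - a t) *: v).
  have za (Z : zmodType) (F G P X Q T : Z) :
      F - X - (Q + T) = F - G - P + (G - X - Q) + (P - T).
    rewrite opprD !addrA [RHS](ACl (1*5*6*8*(2*4)*(3*7))) /=.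
    by rewrite !addNr !addr0.
  move: (s - t) => h.
  rewrite [h *: (a' *: f t + _)]scalerDr (za W _ (a s *: f t) (h *: (a s *: v))).
  rewrite !(scalerBr, scalerBl) [a s *: (h *: v)]scalerA [a s * h]mulrC.
  by rewrite -[(h * a s) *: v]scalerA -[(h * a') *: f t]scalerA.
have B1 : `|a s *: (f s - f t - (s - t) *: v)| <= e / 3 * `|s - t|.
  rewrite normrZ; apply: (@le_trans _ _ (Ca * (e / 3 / Ca * `|s - t|))).
    apply: ler_pM => //; last exact: H2.
    rewrite /Ca -lerBlDr; apply: le_trans (lerB_dist _ _) _.
    exact: ltW (H4 s As sd4).
  by rewrite mulrA mulrCA divff ?gt_eqF// mulr1.
have B2 : `|(a s - a t - (s - t) * a') *: f t| <= e / 3 * `|s - t|.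
  rewrite normrZ; apply: (@le_trans _ _ ((e / 3 / Cf * `|s - t|) * Cf)).
    apply: ler_pM => //; first exact: H1.
    by rewrite lerDr.
  by rewrite mulrAC divfK ?gt_eqF.
have B3 : `|(s - t) *: ((a s - a t) *: v)| <= e / 3 * `|s - t|.
  rewrite normrZ mulrC ler_wpM2r// normrZ.
  apply: (@le_trans _ _ ((e / 3 / Cv) * Cv)).
    apply: ler_pM => //; first exact: ltW (H3 s As sd3).
    by rewrite lerDr.
  by rewrite divfK ?gt_eqF.
apply: le_trans (ler_normD _ _) _.
have := ler_normD (a s *: (f s - f t - (s - t) *: v))
   ((a s - a t - (s - t) * a') *: f t); lra.
Qed.

Lemma diff_eps (g : V -> W) x : differentiable g x ->
  forall e, 0 < e -> exists2 d, 0 < d &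
    forall y, `|y - x| < d -> `|g y - g x - 'd g x (y - x)| <= e * `|y - x|.
Proof.
move=> /diff_locally /eqaddoP h e e0; have := h _ e0.
move=> /nbhs_ballP[d /= d0 Hd]; exists d => // y yx.
have := Hd (y - x); rewrite -ball_normE /ball_ /= sub0r normrN => /(_ yx).
by rewrite !fctE /= subrK opprD addrA.
Qed.

Lemma eps_diff (g : V -> W) (L : {linear V -> W}) x : continuous L ->
  (forall e, 0 < e -> exists2 d, 0 < d &
    forall y, `|y - x| < d -> `|g y - g x - L (y - x)| <= e * `|y - x|) ->
  differentiable g x /\ 'd g x = L :> (V -> W).
Proof.
move=> cL H.
have h : g \o shift x = cst (g x) + L +o_ 0 id.
  apply/eqaddoP => e e0; have [d d0 Hd] := H _ e0.
  apply/nbhs_ballP; exists d => // h; rewrite -ball_normE /ball_ /= sub0r normrN => hd.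
  rewrite !fctE /=; have := Hd (h + x); rewrite addrK => /(_ hd).
  by rewrite opprD addrA.
have dg := diff_unique cL h; split=> //.
by apply/diff_locallyP; rewrite dg.
Qed.

Lemma hdw_comp A (f : R -> V) (g : V -> W) t v :
  has_derivative_within A f t v -> differentiable g (f t) ->
  has_derivative_within A (g \o f) t ('d g (f t) v).
Proof.
move=> hf dg; have /hdwP hf' := hf; have /within_cvgP cf := hdw_cvg hf.
have [k k0 Hk] := linear_lipschitz (diff_continuous dg).
apply/hdwP => e e0.
have [b b0 Hb] := hf' _ ltr01.
pose e1 := e / 2 / (1 + `|v|).
have v1 : 0 < 1 + `|v| by rewrite ltr_pwDl.
have e10 : 0 < e1 by rewrite !divr_gt0.
have [d1 d10 H1] := diff_eps dg e10.
have [d2 d20 H2] := cf _ d10.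
have e30 : 0 < e / 2 / k by rewrite !divr_gt0.
have [d3 d30 H3] := hf' _ e30.
exists (Num.min b (Num.min d2 d3)); first by rewrite !lt_min b0 d20.
move=> s As; rewrite !lt_min => /and3P[sb sd2 sd3] /=.
have fb : `|f s - f t| <= (1 + `|v|) * `|s - t|.
  have -> : f s - f t = (f s - f t - (s - t) *: v) + (s - t) *: v by rewrite subrK.
  apply: le_trans (ler_normD _ _) _.
  have := Hb s As sb; rewrite normrZ; lra.
have := H1 _ (H2 s As sd2); have := H3 s As sd3.
move=> h3 h1.
have -> : g (f s) - g (f t) - (s - t) *: 'd g (f t) v =
   (g (f s) - g (f t) - 'd g (f t) (f s - f t)) +
   'd g (f t) (f s - f t - (s - t) *: v).
  move: (f s - f t) => u; rewrite (linearB ('d g (f t)) u).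
  by rewrite [RHS]addrA subrK; congr (_ - _); rewrite linearZ.
apply: le_trans (ler_normD _ _) _.
have h4 := Hk (f s - f t - (s - t) *: v).
have h5 : k * `|f s - f t - (s - t) *: v| <= e / 2 * `|s - t|.
  by rewrite -ler_pdivlMl// mulrA [k^-1 * _]mulrC.
have h6 : e1 * `|f s - f t| <= e / 2 * `|s - t|.
  rewrite /e1 mulrAC ler_pdivrMr// -(mulrA (e / 2)) ler_pM2l ?divr_gt0//.
  by rewrite mulrC.
have := le_trans h1 h6; have := le_trans h4 h5; lra.
Qed.

Lemma hdwZ A (c : R) (f : R -> W) t v : has_derivative_within A f t v ->
  has_derivative_within A (fun s => c *: f s) t (c *: v).
Proof.
by move=> hf; have := hdw_mul (@hdw_cst R^o A c t) hf; rewrite scale0r add0r.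
Qed.

Lemma hdw_pair A (f : R -> V) (g : R -> W) t v w :
  has_derivative_within A (fun s => (f s, g s)) t (v, w) <->
  has_derivative_within A f t v /\ has_derivative_within A g t w.
Proof.
have E s : `|(f s, g s) - (f t, g t) - (s - t) *: (v, w)| =
  Num.max `|f s - f t - (s - t) *: v| `|g s - g t - (s - t) *: w| by [].
split.
  move=> /hdwP h; split; apply/hdwP => e e0; have [d d0 Hd] := h _ e0;
    exists d => // s As sd; have := Hd s As sd; rewrite E ge_max => /andP[] //.
move=> [/hdwP h1 /hdwP h2]; apply/hdwP => e e0.
have [d1 d10 H1] := h1 _ e0; have [d2 d20 H2] := h2 _ e0.
exists (Num.min d1 d2); first by rewrite lt_min d10.
move=> s As; rewrite lt_min => /andP[sd1 sd2].
by rewrite E ge_max H1// H2.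
Qed.

End Two.

Lemma hdw_sum (W : normedModType R) A n (f : 'I_n -> R -> W) t (v : 'I_n -> W) :
  (forall i, has_derivative_within A (f i) t (v i)) ->
  has_derivative_within A (fun s => \sum_i f i s) t (\sum_i v i).
Proof.
move=> H; elim: n f v H => [|n IH] f v H.
  have -> : (fun s => \sum_i f i s) = fun=> 0.
    by apply/funext => s; rewrite big_ord0.
  by rewrite big_ord0; exact: hdw_cst.
rewrite big_ord_recr /=.
have -> : (fun s => \sum_i f i s) =
    fun s => \sum_(i < n) f (widen_ord (leqnSn n) i) s + f ord_max s.
  by apply/funext => s; rewrite big_ord_recr.
by apply: hdwD => //; apply: IH => i; exact: H.
Qed.

Lemma rV_norm_leP m (x : 'rV[R]_m) (e : R) : 0 <= e ->
  (`|x| <= e) <-> (forall j, `|x 0 j| <= e).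
Proof.
move=> e0; split.
  move=> xe j; apply: le_trans xe; rewrite [leRHS]mx_normrE.
  exact: (@le_bigmax _ _ _ 0 (fun ij : 'I_1 * 'I_m => `|x ij.1 ij.2|) (0, j)).
move=> H; rewrite [leLHS]mx_normrE; apply/bigmax_leP; split=> // -[i j] _ /=.
by rewrite ord1.
Qed.

Lemma hdw_rowP m A (f : R -> 'rV[R]_m) t v :
  has_derivative_within A f t v <->
  forall j, has_derivative_within A (fun s => f s 0 j) t (v 0 j).
Proof.
split.
  move=> /hdwP h j; apply/hdwP => e e0; have [d d0 Hd] := h _ e0.
  exists d => // s As sd; have e1 : 0 <= e * `|s - t| by rewrite mulr_ge0// ltW.
  by have /(rV_norm_leP _ e1)/(_ j) := Hd s As sd; rewrite !mxE.
move=> H; apply/hdwP => e e0.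
have [d d0 Hd] : exists2 d, 0 < d & forall s, A s -> `|s - t| < d -> forall j,
    `|f s 0 j - f t 0 j - (s - t) *: v 0 j| <= e * `|s - t|.
  have : forall j, exists d, 0 < d /\ forall s, A s -> `|s - t| < d ->
    `|f s 0 j - f t 0 j - (s - t) *: v 0 j| <= e * `|s - t|.
    by move=> j; have /hdwP/(_ _ e0)[d ? ?] := H j; exists d.
  move=> /choice[D HD]; exists (\big[Num.min/1]_j D j).
    by apply/bigmin_gtP; split=> // j _; have [] := HD j.
  move=> s As sd j; have [_] := HD j; apply=> //.
  by apply: lt_le_trans sd _; exact: bigmin_le_cond.
exists d => // s As sd; apply/rV_norm_leP; first by rewrite mulr_ge0// ltW.
by move=> j; have := Hd s As sd j; rewrite !mxE.
Qed.

End Toolkit.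

(** * Curves in normed spaces: uniqueness and regularity *)

Section Curves.
Context {R : realType} {W : normedModType R}.
Local Notation mu := (@lebesgue_measure R).

Lemma ae_impl (P Q : R -> Prop) : (forall t, P t -> Q t) ->
  {ae mu, forall t, P t} -> {ae mu, forall t, Q t}.
Proof. by move=> PQ [N [mN N0 H]]; exists N; split=> // t nQ; apply: H => /PQ. Qed.

Lemma within_itv_continuousP (T : topologicalType) (a b : R) (f : R -> T) :
  {within `[a, b], continuous f} <->
  (forall t, a <= t <= b -> f @ within `[a, b] (nbhs t) --> f t).
Proof.
split; first by move=> /subspace_continuousP h t tab; apply: h; rewrite /= in_itv.
by move=> h; apply/subspace_continuousP => t; rewrite /= in_itv /=; exact: h.
Qed.

Lemma subitv (a b s r : R) : a <= s -> r <= b -> `[s, r] `<=` `[a, b].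
Proof.
move=> as_ rb x; rewrite /= !in_itv /= => /andP[sx xr].
by rewrite (le_trans as_ sx) (le_trans xr rb).
Qed.

Lemma mean_value_abs (a b K : R) (f f' : R -> W) :
  (forall t, a <= t <= b -> has_derivative_within `[a, b] f t (f' t)) ->
  (forall t, a <= t <= b -> `|f' t| <= K) ->
  forall s r, a <= s <= b -> a <= r <= b -> `|f s - f r| <= K * `|s - r|.
Proof.
move=> df bf.
suff H s r : a <= s -> s <= r -> r <= b -> `|f r - f s| <= K * `|r - s|.
  move=> s r /andP[? ?] /andP[? ?]; have [sr|rs] := leP s r.
    by rewrite distrC (distrC s); apply: H.
  by apply: H => //; exact: ltW.
move=> as_ sr rb; rewrite (ger0_norm (_ : 0 <= r - s)) ?subr_ge0//.
apply: (mean_value_ineq sr (f' := f')) => t /andP[st tr].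
  apply: hdw_sub (subitv as_ rb) (df _ _).
  by rewrite (le_trans as_ st) (le_trans tr rb).
by apply: bf; rewrite (le_trans as_ st) (le_trans tr rb).
Qed.

(** At a maximum [m] of [`|w|] the mean value inequality gives
    [`|w m| <= `|w m| / 2]. The restriction on the length of the interval is
    harmless once uniqueness is propagated along intervals. *)
Lemma gronwall_local (a b L c : R) (w w' : R -> W) : 0 <= L ->
  L * (b - a) <= 2^-1 ->
  (forall t, a <= t <= b -> has_derivative_within `[a, b] w t (w' t)) ->
  (forall t, a <= t <= b -> `|w' t| <= L * `|w t|) ->
  a <= c <= b -> w c = 0 -> forall t, a <= t <= b -> w t = 0.
Proof.
move=> L0 Lab dw bw cab wc.
have ab : a <= b by case/andP: cab => ac cb; exact: le_trans ac cb.
have cw : {within `[a, b], continuous (fun t => `|w t|)}.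
  apply/within_itv_continuousP => t tab.
  by apply: cvg_norm; apply: hdw_cvg (dw _ tab).
have [m mab Hm] := EVT_max ab cw.
move: mab; rewrite in_itv /= => mab.
have wm : `|w m - w c| <= L * `|w m| * `|m - c|.
  apply: (mean_value_abs dw) => // t tab; apply: le_trans (bw _ tab) _.
  by rewrite ler_wpM2l// Hm// in_itv.
have mc : `|m - c| <= b - a by rewrite ler_norml; apply/andP; split; lra.
(* |m - c| <= b - a, so L * |m - c| <= 1/2 *)
have w0 : `|w m| = 0.
  apply/eqP; rewrite eq_le normr_ge0 andbT.
  move: wm; rewrite wc subr0 => wm.
  have : L * `|w m| * `|m - c| <= 2^-1 * `|w m|.
    rewrite mulrAC ler_wpM2r//.
    by apply: le_trans Lab; rewrite ler_wpM2l.
  lra.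
move=> t tab; apply/eqP; rewrite -normr_eq0 eq_le normr_ge0 andbT -w0.
by apply: Hm; rewrite in_itv.
Qed.

Lemma lipschitz_ac (a b K : R) (f : R -> W) : 0 <= K ->
  (forall s r, a <= s <= b -> a <= r <= b -> `|f s - f r| <= K * `|s - r|) ->
  abs_continuous a b f.
Proof.
move=> K0 fK e e0; have K1 : 0 < K + 1 by lra.
exists (e / (K + 1)); first by rewrite divr_gt0.
move=> N I HI _; rewrite ltr_pdivlMr// => h.
apply: le_lt_trans h; rewrite mulr_suml; apply: ler_sum => i _.
have [h1 h2 h3] := HI i.
apply: le_trans (fK _ _ _ _) _; [by apply/andP; split; lra|by apply/andP; split; lra|].
rewrite ger0_norm ?subr_ge0// mulrC ler_wpM2l ?subr_ge0//; lra.
Qed.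

Lemma ac_sub (a b s r : R) (f : R -> W) : a <= s -> r <= b ->
  abs_continuous a b f -> abs_continuous s r f.
Proof.
move=> as_ rb acf e e0; have [d d0 Hd] := acf e e0; exists d => // N I HI.
by apply: Hd => i; have [h1 h2 h3] := HI i; split=> //; lra.
Qed.

Lemma acB (a b : R) (f g : R -> W) :
  abs_continuous a b f -> abs_continuous a b g ->
  abs_continuous a b (fun t => f t - g t).
Proof.
move=> acf acg e e0; have e20 : 0 < e / 2 by rewrite divr_gt0.
have [d1 d10 H1] := acf _ e20; have [d2 d20 H2] := acg _ e20.
exists (Num.min d1 d2); first by rewrite lt_min d10.
move=> N I HI tI; rewrite lt_min => /andP[l1 l2].
rewrite [ltRHS]splitr; apply: le_lt_trans (ltrD (H1 N I HI tI l1) (H2 N I HI tI l2)).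
rewrite -big_split; apply: ler_sum => i _ /=.
have -> : f (I i).2 - g (I i).2 - (f (I i).1 - g (I i).1) =
  (f (I i).2 - f (I i).1) - (g (I i).2 - g (I i).1).
  by rewrite !opprB !addrA (ACl (1*4*3*2)).
exact: ler_normB.
Qed.

(** An absolutely continuous solution of an equation with continuous right-hand side
    is a classical solution. This is how abnormal lifts, which satisfy their equation
    almost everywhere only, become differentiable. *)
Lemma ac_derivative_continuous (a b t0 : R) (f g : R -> W) :
  abs_continuous a b f ->
  {ae mu, forall t, t \in `[a, b] -> has_derivative_within `[a, b] f t (g t)} ->
  a <= t0 <= b -> g @ within `[a, b] (nbhs t0) --> g t0 ->
  has_derivative_within `[a, b] f t0 (g t0).
Proof.
move=> acf df t0ab /within_cvgP cg; apply/hdwP => e e0.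
have [d d0 Hd] := cg _ e0; exists d => // s; rewrite /= in_itv /= => sab sd.
(* the derivative of F is small near t0, so F is almost constant there *)
pose F r := f r - r *: g t0.
have step x y : a <= x -> x <= y -> y <= b -> `|x - t0| < d -> `|y - t0| < d ->
    `|F y - F x| <= e * `|y - x|.
  move=> ax xy yb xd yd; rewrite (ger0_norm (_ : 0 <= y - x)) ?subr_ge0//.
  apply: ac_growth => //; first exact: ltW.
    apply: acB; first exact: ac_sub acf.
    apply: (@lipschitz_ac _ _ `|g t0|) => // p q _ _.
    by rewrite -scalerBl normrZ mulrC.
  apply: ae_impl df => r Hr; rewrite in_itv /= => /andP[xr ry].
  have rab : a <= r <= b by rewrite (le_trans ax xr) (le_trans ry yb).
  have := Hr; rewrite in_itv /= => /(_ rab) dfr.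
  exists (g r - g t0).
    have := hdwD (hdw_sub (subitv ax yb) dfr)
      (hdw_mul (hdw_id `[x, y] r) (hdw_cst `[x, y] (- g t0) r)).
    rewrite scaler0 addr0 scale1r.
    by congr (has_derivative_within _ _ _ _); apply/funext => q; rewrite scalerN.
  apply/ltW/Hd; first by rewrite /= in_itv.
  move: xd yd; rewrite !ltr_norml => /andP[? ?] /andP[? ?].
  by apply/andP; split; lra.
have -> : f s - f t0 - (s - t0) *: g t0 = F s - F t0.
  by rewrite /F scalerBl !opprB !addrA [LHS](ACl (1*4*3*2)).
have t0d : `|t0 - t0| < d by rewrite subrr normr0.
case/andP: sab => as_ sb; case/andP: t0ab => at0 t0b.
have [st|ts] := leP s t0.
  by rewrite distrC (distrC s); apply: step.
by apply: step => //; exact: ltW.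
Qed.

End Curves.

(** * Differentiability and symmetry of second derivatives *)

Section Lines.
Context {R : realType} {V W : normedModType R}.

(** Directional derivatives are derivatives of curves, so that product and chain
    rules for curves apply to them. *)
Lemma is_derive_lineP (f : V -> W) x v d :
  is_derive x v f d <-> has_derivative_within setT (fun s => f (s *: v + x)) 0 d.
Proof.
have E : (fun h => h^-1 *: ((f \o shift x) (h *: v) - f x)) =
  (fun s => (s - 0)^-1 *: (f (s *: v + x) - f (0 *: v + x))).
  by apply/funext => h; rewrite subr0 scale0r add0r.
split.
  move=> [df <-]; rewrite /has_derivative_within withinET -E.
  exact: df.
rewrite /has_derivative_within withinET -E => h.
have df : derivable f x v by apply/cvg_ex; exists d.
by split=> //; exact: cvg_lim h.
Qed.

Lemma hdw_line (A : set R) (f : V -> W) y v t d :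
  is_derive (t *: v + y) v f d ->
  has_derivative_within A (fun s => f (s *: v + y)) t d.
Proof.
move=> /is_derive_lineP /hdwP H; apply/hdwP => e e0.
have [r r0 Hr] := H _ e0; exists r => // s As st.
have := Hr (s - t) I; rewrite subr0 => /(_ st).
by rewrite scale0r add0r addrA -scalerDl subrK.
Qed.

Lemma differentiable_line (A : set R) (f : V -> W) y v t :
  differentiable f (t *: v + y) ->
  has_derivative_within A (fun s => f (s *: v + y)) t ('d f (t *: v + y) v).
Proof.
move=> df; apply: hdw_line; split; first exact: diff_derivable.
by rewrite deriveE.
Qed.

Lemma loclip_segment (f : V -> W) x r K : 
  (forall y, `|y - x| < r -> differentiable f y) ->
  (forall y v, `|y - x| < r -> `|'d f y v| <= K * `|v|) ->
  forall y z, `|y - x| < r -> `|z - x| < r -> `|f y - f z| <= K * `|y - z|.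
Proof.
move=> df bf y z yr zr.
have inb t : 0 <= t <= 1 -> `|t *: (y - z) + z - x| < r.
  move=> /andP[t0 t1].
  have -> : t *: (y - z) + z - x = t *: (y - x) + (1 - t) *: (z - x).
    rewrite [(1 - t) *: _]scalerBl scale1r [RHS]addrCA -scalerBr.
    have -> : y - x - (z - x) = y - z by rewrite opprB addrA subrK.
    by rewrite -addrA addrC.
  have [->|t0'] := eqVneq t 0.
    by rewrite scale0r add0r subr0 scale1r.
  apply: le_lt_trans (ler_normD _ _) _; rewrite !normrZ.
  rewrite (ger0_norm t0) (ger0_norm (_ : 0 <= 1 - t)) ?subr_ge0//.
  have tp : 0 < t by rewrite lt_neqAle eq_sym t0' t0.
  have h1 : t * `|y - x| < t * r by rewrite ltr_pM2l.
  have h2 : (1 - t) * `|z - x| <= (1 - t) * r.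
    by rewrite ler_wpM2l ?subr_ge0// ltW.
  lra.
have := @mean_value_abs R W 0 1 (K * `|y - z|)
  (fun s => f (s *: (y - z) + z)) (fun s => 'd f (s *: (y - z) + z) (y - z)).
move=> /(_ _ _ 1 0); rewrite scale1r subrK scale0r add0r subr0 normr1 mulr1.
apply; rewrite ?lexx ?ler01//.
- by move=> t t01; apply: differentiable_line; apply/df/inb.
- by move=> t t01; apply/bf/inb.
Qed.

End Lines.

Section MultiCalc.
Context {R : realType} {n : nat}.
Local Notation E := 'rV[R]_n.

Section W.
Context {W : normedModType R}.

Definition partials_map (d : 'I_n -> W) (v : E) : W := \sum_i v 0 i *: d i.

Lemma partials_map_linear d : linear (partials_map d).
Proof.
move=> a u v; rewrite /partials_map scaler_sumr -big_split; apply: eq_bigr => i _.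
by rewrite /= !mxE scalerDl scalerA.
Qed.
HB.instance Definition _ d := GRing.isLinear.Build R E W _ (partials_map d)
  (partials_map_linear d).

Lemma partials_map_continuous d : continuous (partials_map d).
Proof.
move=> x; apply: differentiable_continuous.
rewrite /partials_map.
have -> : (fun v : E => \sum_i v 0 i *: d i) =
    \sum_i (fun v : E => v 0 i *: d i).
  by apply/funext => v; rewrite fct_sumE.
apply: differentiable_sum => i; apply: differentiableZl.
exact: differentiable_coord.
Qed.

Lemma open_ball_norm (V : normedModType R) (O : set V) x : open O -> O x ->
  exists2 d, 0 < d & forall y, `|y - x| < d -> O y.
Proof.
move=> oO Ox; have /nbhs_ballP[d /= d0 Hd] := open_nbhs_nbhs (conj oO Ox).
by exists d => // y yx; apply: Hd; rewrite -ball_normE /ball_ /= distrC.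
Qed.

Lemma continuous_ball_norm (V V' : normedModType R) (f : V -> V') x :
  {for x, continuous f} -> forall e, 0 < e -> 
  exists2 d, 0 < d & forall y, `|y - x| < d -> `|f y - f x| < e.
Proof.
move=> cf e e0; have /cvgrPdist_lt/(_ _ e0)/nbhs_ballP[d /= d0 Hd] := cf.
exists d => // y yx; rewrite distrC; apply: Hd.
by rewrite -ball_normE /ball_ /= distrC.
Qed.

Lemma uniform_radius (P : 'I_n -> R -> Prop) :
  (forall i, exists2 d, 0 < d & P i d) ->
  (forall i d d', 0 < d' -> d' <= d -> P i d -> P i d') ->
  exists2 d, 0 < d & forall i, P i d.
Proof.
move=> H Pm; have : forall i, exists d, 0 < d /\ P i d.
  by move=> i; have [d ? ?] := H i; exists d.
move=> /choice[D HD].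
have m0 : 0 < \big[Num.min/1]_j D j.
  by apply/bigmin_gtP; split=> // j _; have [] := HD j.
exists (\big[Num.min/1]_j D j) => // i.
by apply: Pm (HD i).2 => //; exact: bigmin_le_cond.
Qed.

(** Going from [x] to a nearby [y] one coordinate at a time, each step is controlled
    by the mean value inequality and the continuity of one partial derivative. *)
Lemma C1_diff (O : set E) (f : E -> W) x : open O -> Ck_on 1 O f -> O x ->
  differentiable f x /\
  'd f x = partials_map (fun i => 'D_(basis_vec i) f x) :> (E -> W).
Proof.
move=> oO [_ Hf] Ox; apply: eps_diff; first exact: partials_map_continuous.
move=> e e0; pose e' := e / n.+1%:R.
have e'0 : 0 < e' by rewrite divr_gt0.
have [r r0 Hr] := open_ball_norm oO Ox.
have [d d0 Hd] : exists2 d, 0 < d & forall i y, `|y - x| < d ->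
    `|'D_(basis_vec i) f y - 'D_(basis_vec i) f x| <= e'.
  apply: uniform_radius.
    move=> i; have [_ [ci _]] := Hf i.
    have [d d0 Hd] := continuous_ball_norm (ci _ Ox) e'0.
    by exists d => // y /Hd /ltW.
  move=> i d d' _ d'd H y yd; apply: H; exact: lt_le_trans d'd.
exists (Num.min r d); first by rewrite lt_min r0.
move=> y; rewrite lt_min => /andP[yr yd].
(* the path from x to y along the edges of a box *)
pose p k : E := \row_j (if (j < k)%N then y 0 j else x 0 j).
have p0 : p 0%N = x by apply/rowP => j; rewrite !mxE.
have pn : p n = y by apply/rowP => j; rewrite !mxE ltn_ord.
have coordle (j : 'I_n) : `|y 0 j - x 0 j| <= `|y - x|.
  by have /(rV_norm_leP _ (normr_ge0 _))/(_ j) := lexx `|y - x|; rewrite !mxE.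
have pS (k : 'I_n) : p k.+1 = (y 0 k - x 0 k) *: basis_vec k + p k.
  apply/rowP => j; rewrite !mxE eqxx /= ltnS leq_eqVlt.
  have [->|jk] := eqVneq j k; first by rewrite eqxx ltnn mulr1 subrK.
  by rewrite (negbTE (jk : (j : nat) != k)) mulr0 add0r.
have inb (k : 'I_n) s : `|s| <= `|y 0 k - x 0 k| ->
    `|s *: basis_vec k + p k - x| <= `|y - x|.
  move=> sk; apply/rV_norm_leP => // j; rewrite !mxE eqxx /=.
  have [->|jk] := eqVneq j k.
    rewrite ltnn mulr1 addrK; apply: le_trans sk _; exact: coordle.
  rewrite mulr0 add0r; case: ifP => _; first exact: coordle.
  by rewrite subrr normr0.
have step (k : 'I_n) :
    `|f (p k.+1) - f (p k) - (y 0 k - x 0 k) *: 'D_(basis_vec k) f x|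
      <= e' * `|y - x|.
  set h := y 0 k - x 0 k; set D := 'D_(basis_vec k) f x.
  pose F s := f (s *: basis_vec k + p k) - s *: D.
  have -> : f (p k.+1) - f (p k) - h *: D = F h - F 0.
    by rewrite /F pS -/h !scale0r subr0 add0r addrAC.
  apply: le_trans (_ : e' * `|h - 0| <= _); last first.
    by rewrite subr0 ler_wpM2l// ?coordle// ltW.
  pose a := - `|h|; pose b := `|h|.
  apply: (@mean_value_abs R W a b e' F
    (fun s => 'D_(basis_vec k) f (s *: basis_vec k + p k) - D)).
  - move=> t; rewrite -ler_norml => th; rewrite /F.
    have tb := inb k t th.
    have [dk _] := Hf k.
    have := hdwD (@hdw_line _ _ _ `[a, b] f (p k) (basis_vec k) t
      _ (derivableP (dk _ (Hr _ (le_lt_trans tb yr)))))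
      (hdw_mul (hdw_id `[a, b] t) (hdw_cst `[a, b] (- D) t)).
    rewrite scaler0 addr0 scale1r.
    by congr (has_derivative_within _ _ _ _); apply/funext => q; rewrite scalerN.
  - move=> t; rewrite -ler_norml => th; apply: Hd.
    exact: le_lt_trans (inb k t th) yd.
  - by rewrite -ler_norml.
  - by rewrite -ler_norml normr0.
rewrite /partials_map.
have -> : f y - f x - \sum_i (y - x) 0 i *: 'D_(basis_vec i) f x =
   \sum_(k < n) (f (p k.+1) - f (p k) - (y 0 k - x 0 k) *: 'D_(basis_vec k) f x).
  rewrite [RHS]big_split /= sumrN; congr (_ - _); last first.
    by apply: eq_bigr => i _; rewrite !mxE.
  rewrite -(big_mkord xpredT (fun k => f (p k.+1) - f (p k))) telescope_sumr//.
  by rewrite p0 pn.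
apply: le_trans (ler_norm_sum _ _ _) _.
apply: le_trans (_ : \sum_(k < n) e' * `|y - x| <= _).
  by apply: ler_sum => k _; exact: step.
rewrite sumr_const card_ord -mulr_natl mulrA ler_wpM2r// /e' mulrCA.
rewrite -[leRHS]mulr1 ler_pM2l// ler_pdivrMr// mul1r ler_nat.
exact: leqnSn.
Qed.

Lemma C1_derive (O : set E) (f : E -> W) x v : open O -> Ck_on 1 O f -> O x ->
  'D_v f x = \sum_i v 0 i *: 'D_(basis_vec i) f x.
Proof. by move=> oO C1 Ox; have [df e] := C1_diff oO C1 Ox; rewrite deriveE// e. Qed.

Definition loclip (V V' : normedModType R) (f : V -> V') x :=
  exists r L, [/\ 0 < r, 0 <= L & forall y z, `|y - x| < r -> `|z - x| < r ->
    `|f y - f z| <= L * `|y - z|].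

Lemma C1_loclip (O : set E) (f : E -> W) x : open O -> Ck_on 1 O f -> O x ->
  loclip f x.
Proof.
move=> oO C1 Ox; have [_ Hf] := C1.
have [r r0 Hr] := open_ball_norm oO Ox.
pose M i := `|'D_(basis_vec i) f x| + 1.
have [d d0 Hd] : exists2 d, 0 < d & forall i y, `|y - x| < d ->
    `|'D_(basis_vec i) f y| <= M i.
  apply: uniform_radius.
    move=> i; have [_ [ci _]] := Hf i.
    have [d d0 Hd] := continuous_ball_norm (ci _ Ox) ltr01.
    exists d => // y /Hd h; rewrite /M -lerBlDl.
    by apply: le_trans (lerB_dist _ _) _; exact: ltW.
  move=> i d d' _ d'd H y yd; apply: H; exact: lt_le_trans d'd.
exists (Num.min r d), (\sum_i M i); split.
- by rewrite lt_min r0.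
- by apply: sumr_ge0 => i _; rewrite /M addr_ge0.
apply: loclip_segment.
  by move=> y; rewrite lt_min => /andP[yr _]; have [] := C1_diff oO C1 (Hr _ yr).
move=> y v; rewrite lt_min => /andP[yr yd].
have [_ ->] := C1_diff oO C1 (Hr _ yr).
rewrite mulr_suml; apply: le_trans (ler_norm_sum _ _ _) _; apply: ler_sum => i _.
rewrite normrZ mulrC; apply: ler_pM => //; first exact: Hd.
by have /(rV_norm_leP _ (normr_ge0 _))/(_ i) := lexx `|v|.
Qed.

(** Both mixed derivatives are limits of the same second difference divided by [s^2]:
    apply the mean value inequality in one direction, then in the other. *)
Lemma Schwarz_C2 (O : set E) (f : E -> W) x i j : open O -> Ck_on 2 O f -> O x ->
  'D_(basis_vec i) (fun y => 'D_(basis_vec j) f y) x =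
  'D_(basis_vec j) (fun y => 'D_(basis_vec i) f y) x.
Proof.
move=> oO C2 Ox.
have ne k : `|(basis_vec k : E)| <= 1.
  apply/rV_norm_leP => // l; rewrite !mxE; case: (_ && _); rewrite ?normr1//.
  by rewrite normr0.
(* second difference; its quotient by s^2 tends to both mixed derivatives *)
pose Del k l s := f (s *: basis_vec k + (s *: basis_vec l + x))
  - f (s *: basis_vec k + x) - f (s *: basis_vec l + x) + f x.
pose D2 k l := 'D_(basis_vec l) (fun y => 'D_(basis_vec k) f y) x.
have DelC k l s : Del k l s = Del l k s.
  by rewrite /Del (addrCA (s *: basis_vec l)); congr (_ + _); rewrite addrAC.
suff key k l e : 0 < e -> exists2 d, 0 < d & forall s, 0 < s < d ->
   `|Del k l s - (s * s) *: D2 k l| <= e * (s * s).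
  change (D2 j i = D2 i j).
  apply/eqP; rewrite -subr_eq0 -normr_eq0 eq_le normr_ge0 andbT.
  apply/ler_addgt0Pl => e e0; rewrite addr0.
  have e20 : 0 < e / 2 by rewrite divr_gt0.
  have [d1 d10 H1] := key i j _ e20; have [d2 d20 H2] := key j i _ e20.
  pose s := Num.min d1 d2 / 2.
  have m0 : 0 < Num.min d1 d2 by rewrite lt_min d10.
  have s0 : 0 < s by rewrite divr_gt0.
  have sm : s < Num.min d1 d2 by rewrite /s; lra.
  move: sm; rewrite lt_min => /andP[sd1 sd2].
  have /H1 h1 : 0 < s < d1 by rewrite s0.
  have /H2 h2 : 0 < s < d2 by rewrite s0.
  have ss : 0 < s * s by rewrite mulr_gt0.
  have tri (B P Q : W) (c : R) : `|B - P| <= c -> `|B - Q| <= c ->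
      `|Q - P| <= c + c.
    move=> BP BQ; have -> : Q - P = (B - P) - (B - Q).
      by rewrite opprB [RHS]addrC addrA subrK.
    by apply: le_trans (ler_normB _ _) _; exact: lerD.
  rewrite (DelC j i) in h2; have := tri _ _ _ _ h1 h2.
  rewrite -scalerBr normrZ gtr0_norm// -mulrDl -splitr mulrC.
  by rewrite ler_pM2r.
move=> e0.
have [r r0 Hr] := open_ball_norm oO Ox.
have [_ /(_ k)[dk C1k]] := C2.
have [_ /(_ l)[dl [cl _]]] := C1k.
have [d d0 Hd] := continuous_ball_norm (cl _ Ox) e0.
pose rd := Num.min r d.
have rd0 : 0 < rd by rewrite lt_min r0.
exists (rd / 2); first by rewrite divr_gt0.
move=> s /andP[s0 srd].
set D := D2 k l.
have inb a b : 0 <= a <= s -> 0 <= b <= s ->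
    `|a *: basis_vec k + (b *: basis_vec l + x) - x| < rd.
  move=> /andP[a0 as_] /andP[b0 bs]; rewrite addrA addrK.
  apply: le_lt_trans (ler_normD _ _) _; rewrite !normrZ !ger0_norm//.
  have := ler_wpM2l a0 (ne k); have := ler_wpM2l b0 (ne l); lra.
have inO a b : 0 <= a <= s -> 0 <= b <= s ->
    O (a *: basis_vec k + (b *: basis_vec l + x)).
  by move=> ha hb; apply: Hr; move: (inb _ _ ha hb); rewrite lt_min => /andP[].
have ss : 0 <= s <= s by rewrite lexx ltW.
have s00 : 0 <= (0 : R) <= s by rewrite lexx ltW.
pose F t := f (t *: basis_vec k + (s *: basis_vec l + x))
   - f (t *: basis_vec k + x) - t *: (s *: D).
have -> : Del k l s - (s * s) *: D = F s - F 0.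
  rewrite /F /Del !scale0r !add0r subr0 scalerA opprB !addrA.
  by rewrite [RHS](ACl (1*2*5*4*3)).
have -> : e * (s * s) = e * s * `|s - 0| by rewrite subr0 gtr0_norm// mulrA.
have zz t : f (t *: basis_vec k + x) = f (t *: basis_vec k + (0 *: basis_vec l + x)).
  by rewrite scale0r add0r.
apply: (@mean_value_abs R W 0 s (e * s) F
  (fun t => 'D_(basis_vec k) f (t *: basis_vec k + (s *: basis_vec l + x)) -
     'D_(basis_vec k) f (t *: basis_vec k + (0 *: basis_vec l + x)) - s *: D)) => //.
  move=> t ts; rewrite /F.
  have L1 := @hdw_line _ _ _ `[0, s] f (s *: basis_vec l + x) (basis_vec k) t
      _ (derivableP (dk _ (inO _ _ ts ss))).
  have L2 := @hdw_line _ _ _ `[0, s] f (0 *: basis_vec l + x) (basis_vec k) t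
      _ (derivableP (dk _ (inO _ _ ts s00))).
  have := hdwD (hdwD L1 (hdwZ (c := -1) L2))
     (hdw_mul (hdw_id `[0, s] t) (hdw_cst `[0, s] (- (s *: D)) t)).
  rewrite scaler0 addr0 scale1r scaleN1r.
  congr (has_derivative_within _ _ _ _); apply/funext => q.
  by rewrite scalerN scaleN1r -zz.
move=> t ts.
pose G b := 'D_(basis_vec k) f (b *: basis_vec l + (t *: basis_vec k + x)) - b *: D.
have -> : 'D_(basis_vec k) f (t *: basis_vec k + (s *: basis_vec l + x)) -
     'D_(basis_vec k) f (t *: basis_vec k + (0 *: basis_vec l + x)) - s *: D
   = G s - G 0.
  by rewrite /G !scale0r subr0 !add0r addrAC (addrCA (s *: basis_vec l)).
have -> : e * s = e * `|s - 0| by rewrite subr0 gtr0_norm.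
apply: (@mean_value_abs R W 0 s e G
  (fun b => 'D_(basis_vec l) (fun y => 'D_(basis_vec k) f y)
      (b *: basis_vec l + (t *: basis_vec k + x)) - D)) => //.
  move=> b bs; rewrite /G.
  have Ob : O (b *: basis_vec l + (t *: basis_vec k + x)).
    by rewrite addrCA; apply: inO.
  have L1 := @hdw_line _ _ _ `[0, s] (fun y => 'D_(basis_vec k) f y)
     (t *: basis_vec k + x) (basis_vec l) b _ (derivableP (dl _ Ob)).
  have := hdwD L1 (hdw_mul (hdw_id `[0, s] b) (hdw_cst `[0, s] (- D) b)).
  rewrite scaler0 addr0 scale1r.
  by congr (has_derivative_within _ _ _ _); apply/funext => q; rewrite scalerN.
move=> b bs; apply/ltW/Hd; rewrite addrCA.
by move: (inb _ _ ts bs); rewrite lt_min => /andP[].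
Qed.

End W.
End MultiCalc.

(** * Closure properties of smooth maps *)

Section Smooth.
Context {R : realType} {n : nat}.
Local Notation E := 'rV[R]_n.
Local Notation e_ i := (@basis_vec R n i).

Lemma is_derive_ext (W : normedModType R) (O : set E) (f g : E -> W) x v d :
  open O -> O x -> (forall y, O y -> f y = g y) ->
  is_derive x v f d -> is_derive x v g d.
Proof.
move=> oO Ox fg /is_derive_lineP h; apply/is_derive_lineP.
have [r r0 Hr] := open_ball_norm oO Ox.
have v1 : 0 < `|v| + 1 by rewrite ltr_wpDl.
apply: (hdw_local (d := r / (`|v| + 1))) h; first by rewrite divr_gt0.
  by rewrite scale0r add0r fg.
move=> s _; rewrite subr0 ltr_pdivlMr// => sr; split=> //; apply: fg.
apply: Hr; rewrite addrK normrZ; have := normr_ge0 s; lra.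
Qed.

Lemma is_derive_scale (W : normedModType R) (a : E -> R) (f : E -> W) x v a' f' :
  is_derive x v a a' -> is_derive x v f f' ->
  is_derive x v (fun y => a y *: f y) (a' *: f x + a x *: f').
Proof.
move=> /is_derive_lineP ha /is_derive_lineP hf; apply/is_derive_lineP.
by have := hdw_mul ha hf; rewrite scale0r add0r.
Qed.

Lemma is_derive_coord m (f : E -> 'rV[R]_m) x v f' j :
  is_derive x v f f' -> is_derive x v (fun y => f y 0 j) (f' 0 j).
Proof. by move=> /is_derive_lineP/hdw_rowP h; apply/is_derive_lineP. Qed.

Lemma continuous_ext (V W : normedModType R) (O : set V) (f g : V -> W) x :
  open O -> O x -> (forall y, O y -> f y = g y) ->
  {for x, continuous f} -> {for x, continuous g}.
Proof.
move=> oO Ox fg /continuous_ball_norm cf.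
have [r r0 Hr] := open_ball_norm oO Ox.
apply/cvgrPdist_lt => e e0; have [d d0 Hd] := cf _ e0.
apply/nbhs_ballP; exists (Num.min r d); first by rewrite /= lt_min r0.
move=> y; rewrite -ball_normE /ball_ /= distrC lt_min => /andP[yr yd].
by rewrite -!fg//; [rewrite distrC Hd | exact: Hr].
Qed.

Lemma Ck_ext (W : normedModType R) k (O : set E) (f g : E -> W) :
  open O -> (forall y, O y -> f y = g y) -> Ck_on k O f -> Ck_on k O g.
Proof.
move=> oO; elim: k f g => [|k IH] f g fg [cf Hf].
  by split=> // x Ox; apply: continuous_ext fg (cf _ Ox).
have C0g : Ck_on 0 O g.
  by split=> // x Ox; apply: continuous_ext fg (cf _ Ox).
split; first by case: C0g.
move=> i; have [df C] := Hf i.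
have D x : O x -> is_derive x (e_ i) g ('D_(e_ i) f x).
  by move=> Ox; apply: (is_derive_ext oO Ox fg); apply/derivableP/df.
split; first by move=> x /D [].
by apply: IH C => y /D [].
Qed.

Lemma CkS (W : normedModType R) k (O : set E) (f : E -> W) :
  Ck_on k.+1 O f -> Ck_on k O f.
Proof.
elim: k f => [|k IH] f [cf Hf]; first by split.
by split=> // i; have [df C] := Hf i; split=> //; exact: IH.
Qed.

Lemma Ck_le (W : normedModType R) k m (O : set E) (f : E -> W) : (k <= m)%N ->
  Ck_on m O f -> Ck_on k O f.
Proof.
move=> km; rewrite -(subnK km); elim: (m - k)%N => //= d IH C.
by apply: IH; exact: CkS C.
Qed.

Lemma Ck_continuous (W : normedModType R) k (O : set E) (f : E -> W) x :
  Ck_on k O f -> O x -> {for x, continuous f}.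
Proof. by case: k => [|k] [cf _] /cf. Qed.

Lemma Ck_partial (W : normedModType R) k (O : set E) (f : E -> W) i :
  Ck_on k.+1 O f -> Ck_on k O (fun x => 'D_(e_ i) f x).
Proof. by case=> _ /(_ i)[]. Qed.

Lemma Ck_is_derive (W : normedModType R) (O : set E) (f : E -> W) x v :
  open O -> Ck_on 1 O f -> O x -> is_derive x v f ('D_v f x).
Proof.
move=> oO C1 Ox; have [df _] := C1_diff oO C1 Ox.
by apply/derivableP/diff_derivable.
Qed.

(** Exhibiting the partial derivatives is how regularity is proved by induction on
    the order. *)
Lemma Ck_step (W : normedModType R) k (O : set E) (f : E -> W) (g : 'I_n -> E -> W) :
  open O -> (forall i x, O x -> is_derive x (e_ i) f (g i x)) ->
  (forall x, O x -> {for x, continuous f}) ->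
  (forall i, Ck_on k O (g i)) -> Ck_on k.+1 O f.
Proof.
move=> oO D cf Cg; split=> // i; split; first by move=> x /(D i)[].
by apply: Ck_ext (Cg i) => // x /(D i)[].
Qed.

Lemma Ck_cst (W : normedModType R) k (O : set E) (w : W) : open O ->
  Ck_on k O (fun=> w).
Proof.
move=> oO; elim: k w => [|k IH] w; first by split=> // x _; exact: cst_continuous.
apply: (Ck_step (g := fun _ _ => 0) oO).
- by move=> x Ox; exact: cst_continuous.
- by move=> i; exact: IH.
Qed.

Lemma CkD (W : normedModType R) k (O : set E) (f g : E -> W) : open O ->
  Ck_on k O f -> Ck_on k O g -> Ck_on k O (fun x => f x + g x).
Proof.
move=> oO; elim: k f g => [|k IH] f g Cf Cg.
  split=> // x Ox; exact: (continuousD (Ck_continuous Cf Ox) (Ck_continuous Cg Ox)).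
apply: (Ck_step (g := fun i x => 'D_(e_ i) f x + 'D_(e_ i) g x) oO).
- move=> i x Ox; apply: is_deriveD; apply: (Ck_is_derive _ oO) => //.
    exact: Ck_le Cf.
  exact: Ck_le Cg.
- move=> x Ox; exact: (continuousD (Ck_continuous Cf Ox) (Ck_continuous Cg Ox)).
- by move=> i; apply: IH; exact: Ck_partial.
Qed.

Lemma Ck_scale (W : normedModType R) k (O : set E) (a : E -> R) (f : E -> W) :
  open O -> Ck_on k O a -> Ck_on k O f -> Ck_on k O (fun x => a x *: f x).
Proof.
move=> oO; elim: k a f => [|k IH] a f Ca Cf.
  split=> // x Ox; exact: (continuousZ (Ck_continuous Ca Ox) (Ck_continuous Cf Ox)).
apply: (Ck_step (g := fun i x => 'D_(e_ i) a x *: f x + a x *: 'D_(e_ i) f x) oO).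
- move=> i x Ox; apply: is_derive_scale; apply: (Ck_is_derive _ oO) => //.
    exact: Ck_le Ca.
  exact: Ck_le Cf.
- move=> x Ox; exact: (continuousZ (Ck_continuous Ca Ox) (Ck_continuous Cf Ox)).
- move=> i; apply: CkD => //; apply: IH; by [exact: Ck_partial|exact: CkS].
Qed.

Lemma CkN (W : normedModType R) k (O : set E) (f : E -> W) : open O ->
  Ck_on k O f -> Ck_on k O (fun x => - f x).
Proof.
move=> oO Cf; apply: (Ck_ext (f := fun x => -1 *: f x)) => //.
  by move=> x _; rewrite scaleN1r.
by apply: Ck_scale => //; exact: Ck_cst.
Qed.

Lemma Ck_sum (W : normedModType R) k (O : set E) m (f : 'I_m -> E -> W) : open O ->
  (forall i, Ck_on k O (f i)) -> Ck_on k O (fun x => \sum_i f i x).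
Proof.
move=> oO; elim: m f => [|m IH] f Cf.
  apply: (Ck_ext (f := fun=> 0)) => //; last exact: Ck_cst.
  by move=> y _; rewrite big_ord0.
apply: (Ck_ext (f := fun x =>
   \sum_(i < m) f (widen_ord (leqnSn m) i) x + f ord_max x)) => //.
  by move=> y _; rewrite big_ord_recr.
by apply: CkD => //; apply: IH.
Qed.

Lemma Ck_coord k (O : set E) m (f : E -> 'rV[R]_m) j : open O ->
  Ck_on k O f -> Ck_on k O (fun x => f x 0 j).
Proof.
move=> oO; elim: k f => [|k IH] f Cf.
  split=> // x Ox; 
  exact: (@continuous_comp _ _ _ f (fun v : 'rV_m => v 0 j) x
    (Ck_continuous Cf Ox) (@coord_continuous _ _ _ 0 j (f x))).
apply: (Ck_step (g := fun i x => 'D_(e_ i) f x 0 j) oO).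
- move=> i x Ox; apply: is_derive_coord; apply: (Ck_is_derive _ oO) => //.
  exact: Ck_le Cf.
- move=> x Ox; 
  exact: (@continuous_comp _ _ _ f (fun v : 'rV_m => v 0 j) x
    (Ck_continuous Cf Ox) (@coord_continuous _ _ _ 0 j (f x))).
- by move=> i; apply: IH; exact: Ck_partial.
Qed.

Lemma sub_Ck (W : normedModType R) k (O O' : set E) (f : E -> W) : O' `<=` O ->
  Ck_on k O f -> Ck_on k O' f.
Proof.
move=> OO; elim: k f => [|k IH] f [cf H]; split=> //.
- by move=> x /OO /cf.
- by move=> x /OO /cf.
- by move=> i; have [d C] := H i; split=> [x /OO /d//|]; exact: IH.
Qed.

Lemma Ck_derive_along (W : normedModType R) k (O : set E) (X : E -> E) (f : E -> W) :
  open O -> Ck_on k O X -> Ck_on k.+1 O f ->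
  Ck_on k O (fun x => 'D_(X x) f x).
Proof.
move=> oO CX Cf.
apply: (Ck_ext (f := fun x => \sum_i X x 0 i *: 'D_(e_ i) f x)) => //.
  by move=> x Ox; rewrite (C1_derive _ oO _ Ox)//; exact: Ck_le Cf.
apply: Ck_sum => // i; apply: Ck_scale => //; first exact: Ck_coord.
exact: Ck_partial.
Qed.

(** This symmetry is what makes Lie brackets and cotangent lifts independent of the
    chart. *)
Lemma second_derivative_sym (W : normedModType R) (O : set E) (f : E -> W) x (a b : E) :
  open O -> Ck_on 2 O f -> O x ->
  \sum_i a 0 i *: 'D_b (fun y => 'D_(e_ i) f y) x =
  \sum_i b 0 i *: 'D_a (fun y => 'D_(e_ i) f y) x.
Proof.
move=> oO C2 Ox.
have H (c d : E) : \sum_i c 0 i *: 'D_d (fun y => 'D_(e_ i) f y) x =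
   \sum_i \sum_j (c 0 i * d 0 j) *: 'D_(e_ j) (fun y => 'D_(e_ i) f y) x.
  apply: eq_bigr => i _.
  rewrite (C1_derive _ oO (Ck_partial i C2) Ox) scaler_sumr.
  by apply: eq_bigr => j _; rewrite scalerA.
rewrite [LHS](H a b) [RHS](H b a) [LHS]exchange_big /=.
apply: eq_bigr => i _; apply: eq_bigr => j _.
by rewrite mulrC (Schwarz_C2 _ _ oO C2 Ox).
Qed.

Lemma diff_ext (V W : normedModType R) (O : set V) (f g : V -> W) x :
  open O -> O x -> (forall y, O y -> f y = g y) -> differentiable f x ->
  differentiable g x /\ 'd g x = 'd f x :> (V -> W).
Proof.
move=> oO Ox fg df; apply: eps_diff; first exact: diff_continuous.
move=> e e0; have [d d0 Hd] := diff_eps df e0.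
have [r r0 Hr] := open_ball_norm oO Ox.
exists (Num.min r d); first by rewrite lt_min r0.
by move=> y; rewrite lt_min => /andP[yr yd]; rewrite -!fg//; auto.
Qed.

End Smooth.

(** * Changes of charts and Lie brackets *)

(** Components of vectors pass from [c] to [c'] by [v |-> v *m tJ c c' q]; components
    of covectors pass from [c'] to [c] by [p |-> p *m (tJ c c' q)^T]. *)
HB.lock Definition tJ (R : realType) (n : nat) (M : manifold R n)
  (c c' : chart R M n) (q : M) : 'M[R]_n := jacobian (transition c c') (fwd c q).
Arguments tJ {R n M} c c' q.

Section Charts.
Context {R : realType} {n : nat} {M : manifold R n}.
Implicit Types (c : chart R M n) (q : M) (X Y : M -> 'rV[R]_n) (l : cotangent M).
Local Notation E := 'rV[R]_n.
Local Notation e_ i := (@basis_vec R n i).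

Definition overlap c c' : set E := fwd c @` (dom c `&` dom c').
Definition dotp (p v : E) : R := \sum_i p 0 i * v 0 i.
(** The fibre coordinates of a covector in the chart [c]. *)
Definition momentum c l : E := (ctg_coord c l).2.
Definition smooth_field X := smooth_field_on setT X.

Lemma bwdK c q : atlas c -> dom c q -> bwd c (fwd c q) = q.
Proof. by move=> /atlas_chart [_ _ H _ _]; exact: H. Qed.

Lemma open_codom c : atlas c -> open (fwd c @` dom c).
Proof. by move=> /atlas_chart []. Qed.

Lemma open_dom c : atlas c -> open (dom c).
Proof. by move=> /atlas_chart []. Qed.

Lemma open_overlap c c' : atlas c -> atlas c' -> open (overlap c c').
Proof.
move=> ac ac'; have [_ oc bK _ bc] := atlas_chart ac.
rewrite openE => x [q [qc qc'] qx]; rewrite /interior.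
have xc : codom_chart c x by exists q.
have nb1 : nbhs x (codom_chart c) by apply: open_nbhs_nbhs.
have qE : bwd c x = q by rewrite -qx bK.
have nb2 : nbhs x (bwd c @^-1` dom c').
  apply: (bc x xc); rewrite qE; apply: open_nbhs_nbhs; split=> //.
  exact: open_dom.
apply: filterS2 nb1 nb2 => y [r rc ry] /=; rewrite -ry bK// => rc'.
by exists r.
Qed.

Lemma transition_fwd c c' q : atlas c -> dom c q ->
  transition c c' (fwd c q) = fwd c' q.
Proof. by move=> ac qc; rewrite /transition /= bwdK. Qed.

Lemma transition_Ck k c c' : atlas c -> atlas c' ->
  Ck_on k (overlap c c') (transition c c').
Proof. by move=> ac ac'; exact: atlas_smooth. Qed.

Lemma in_overlap c c' q : dom c q -> dom c' q -> overlap c c' (fwd c q).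
Proof. by move=> qc qc'; exists q. Qed.

Lemma transition_diff c c' q : atlas c -> atlas c' -> dom c q -> dom c' q ->
  differentiable (transition c c') (fwd c q).
Proof.
move=> ac ac' qc qc'.
by have [] := C1_diff (open_overlap ac ac') (transition_Ck 1 ac ac')
  (in_overlap qc qc').
Qed.

Lemma tJE c c' q v : v *m tJ c c' q = 'd (transition c c') (fwd c q) v.
Proof. by rewrite tJ.unlock /jacobian mul_rV_lin1. Qed.

Lemma tJ_derive c c' q v : atlas c -> atlas c' -> dom c q -> dom c' q ->
  v *m tJ c c' q = 'D_v (transition c c') (fwd c q).
Proof.
by move=> ac ac' qc qc'; rewrite tJE deriveE//; exact: transition_diff.
Qed.

Lemma mulmx_inj_row (A B : 'M[R]_n) : (forall v : E, v *m A = v *m B) -> A = B.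
Proof. by move=> H; apply/row_matrixP => i; rewrite !rowE H. Qed.

Lemma tJ_comp c c' c'' q : atlas c -> atlas c' -> atlas c'' ->
  dom c q -> dom c' q -> dom c'' q ->
  tJ c c' q *m tJ c' c'' q = tJ c c'' q.
Proof.
move=> ac ac' ac'' qc qc' qc''; apply: mulmx_inj_row => v.
rewrite mulmxA.
rewrite (tJE c c' q v).
rewrite (tJE c' c'' q).
rewrite (tJE c c'' q v).
have d1 := transition_diff ac ac' qc qc'.
have d2 : differentiable (transition c' c'') (transition c c' (fwd c q)).
  by rewrite transition_fwd//; exact: transition_diff.
have d12 := differentiable_comp d1 d2.
have eT y : overlap c c' y ->
    (transition c' c'' \o transition c c') y = transition c c'' y.
  by move=> [r [rc rc'] <-] /=; rewrite !transition_fwd.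
have [_ /(congr1 (fun g => g v)) e] :=
  diff_ext (open_overlap ac ac') (in_overlap qc qc') eT d12.
have e2 : 'd (transition c' c'' \o transition c c') (fwd c q) v =
    'd (transition c' c'') (transition c c' (fwd c q))
      ('d (transition c c') (fwd c q) v).
  exact: (congr1 (fun g => g v) (diff_comp d1 d2)).
rewrite (_ : transition c c' (fwd c q) = fwd c' q) in e2; last exact: transition_fwd.
exact: esym (etrans e e2).
Qed.

Lemma tJ_id c q : atlas c -> dom c q -> tJ c c q = 1%:M.
Proof.
move=> ac qc; apply: mulmx_inj_row => v; rewrite mulmx1 (tJE c c q v).
have eT y : overlap c c y -> id y = transition c c y.
  by move=> [r [rc _] <-]; rewrite transition_fwd.
have [did eid] : differentiable id (fwd c q) /\ 'd id (fwd c q) v = v.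
  by split; [exact: ex_diff | rewrite diff_val].
have [_ /(congr1 (fun g => g v)) e] :=
  diff_ext (open_overlap ac ac) (in_overlap qc qc) eT did.
by rewrite [LHS]e.
Qed.

Lemma tJ_inv c c' q : atlas c -> atlas c' -> dom c q -> dom c' q ->
  tJ c c' q *m tJ c' c q = 1%:M.
Proof. by move=> ac ac' qc qc'; rewrite tJ_comp// tJ_id. Qed.

Lemma dotp_tr p v (J : 'M[R]_n) : dotp (p *m J^T) v = dotp p (v *m J).
Proof.
rewrite /dotp.
under eq_bigr => i _ do rewrite mxE big_distrl /=.
rewrite exchange_big /=; apply: eq_bigr => i _.
rewrite mxE big_distrr /=; apply: eq_bigr => j _.
by rewrite mxE -mulrA [X in _ * X]mulrC.
Qed.

Lemma dotp_Dl p p' v : dotp (p + p') v = dotp p v + dotp p' v.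
Proof. by rewrite /dotp -big_split; apply: eq_bigr => i _; rewrite /= !mxE mulrDl. Qed.
Lemma dotp_Zl a p v : dotp (a *: p) v = a * dotp p v.
Proof. by rewrite /dotp big_distrr; apply: eq_bigr => i _; rewrite /= !mxE mulrA. Qed.
Lemma dotp_Dr p v v' : dotp p (v + v') = dotp p v + dotp p v'.
Proof. by rewrite /dotp -big_split; apply: eq_bigr => i _; rewrite /= !mxE mulrDr. Qed.
Lemma dotp_Zr a p v : dotp p (a *: v) = a * dotp p v.
Proof. by rewrite /dotp big_distrr; apply: eq_bigr => i _; rewrite /= !mxE mulrCA. Qed.
Lemma dotp_Nr p v : dotp p (- v) = - dotp p v.
Proof. by rewrite -scaleN1r dotp_Zr mulN1r. Qed.
Lemma dotp_Nl p v : dotp (- p) v = - dotp p v.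
Proof. by rewrite -scaleN1r dotp_Zl mulN1r. Qed.
Lemma dotp0l v : dotp 0 v = 0.
Proof. by rewrite /dotp big1// => i _; rewrite mxE mul0r. Qed.
Lemma dotp_sumr m p (v : 'I_m -> E) : dotp p (\sum_i v i) = \sum_i dotp p (v i).
Proof.
rewrite /dotp; under eq_bigr => i _ do rewrite summxE big_distrr /=.
by rewrite exchange_big.
Qed.

Lemma hdw_dotp A (p v : R -> E) t p' v' :
  has_derivative_within A p t p' -> has_derivative_within A v t v' ->
  has_derivative_within A (fun s => dotp (p s) (v s)) t
    (dotp p' (v t) + dotp (p t) v').
Proof.
move=> /hdw_rowP hp /hdw_rowP hv; rewrite /dotp -big_split.
by apply: hdw_sum => i; apply: (@hdw_mul _ R^o).
Qed.

Lemma momentumE c l : momentum c l = l.2 *m (tJ c (chart_at l.1) l.1)^T.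
Proof. by rewrite tJ.unlock. Qed.

Lemma momentum_chart_at l : momentum (chart_at l.1) l = l.2.
Proof.
rewrite momentumE tJ_id ?trmx1 ?mulmx1//; first exact: atlas_chart_at.
exact: dom_chart_at.
Qed.

Lemma momentum_change c c' l : atlas c -> atlas c' -> dom c l.1 -> dom c' l.1 ->
  momentum c l = momentum c' l *m (tJ c c' l.1)^T.
Proof.
move=> ac ac' lc lc'; rewrite !momentumE -mulmxA -trmx_mul tJ_comp//.
  exact: atlas_chart_at.
exact: dom_chart_at.
Qed.

Lemma field_coordE c X q : atlas c -> dom c q ->
  field_coord c X (fwd c q) = X q *m tJ (chart_at q) c q.
Proof. by move=> ac qc; rewrite /field_coord /vec_coord bwdK// tJ.unlock. Qed.

Lemma field_coord_change c c' X q : atlas c -> atlas c' -> dom c q -> dom c' q ->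
  field_coord c' X (fwd c' q) = field_coord c X (fwd c q) *m tJ c c' q.
Proof.
move=> ac ac' qc qc'; rewrite !field_coordE// -mulmxA tJ_comp//.
  exact: atlas_chart_at.
exact: dom_chart_at.
Qed.

Lemma field_coord_at X q : field_coord (chart_at q) X (fwd (chart_at q) q) = X q.
Proof.
have ac := atlas_chart_at q; have qc := dom_chart_at q.
by rewrite field_coordE// tJ_id// mulmx1.
Qed.

Lemma hfunE X l : hfun X l = dotp l.2 (X l.1).
Proof. by []. Qed.

Lemma hfun_chart c X l : atlas c -> dom c l.1 ->
  hfun X l = dotp (momentum c l) (field_coord c X (fwd c l.1)).
Proof.
move=> ac lc; have ac' := atlas_chart_at l.1; have lc' := dom_chart_at l.1.
by rewrite hfunE momentumE dotp_tr field_coordE// -mulmxA tJ_inv// mulmx1.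
Qed.

Lemma smooth_field_Ck k c X : smooth_field X -> atlas c ->
  Ck_on k (fwd c @` dom c) (field_coord c X).
Proof. by move=> sX ac; have := sX c ac k; rewrite setTI. Qed.

Lemma in_codom c q : dom c q -> (fwd c @` dom c) (fwd c q).
Proof. by exists q. Qed.

(** Derivative of the transformation law of a field in the direction [v]. The term
    with second derivatives of the transition map is symmetric in [v] and the field. *)
Lemma derive_field_coord c c' X q v : atlas c -> atlas c' -> smooth_field X ->
  dom c q -> dom c' q ->
  'D_v (field_coord c X) (fwd c q) *m tJ c c' q +
   \sum_i field_coord c X (fwd c q) 0 i *:
     'D_v (fun x => 'D_(e_ i) (transition c c') x) (fwd c q) =
  'D_(v *m tJ c c' q) (field_coord c' X) (fwd c' q).
Proof.
move=> ac ac' sX qc qc'.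
have oO := open_overlap ac ac'.
have Ox := in_overlap qc qc'.
have OC : overlap c c' `<=` fwd c @` dom c by move=> _ [r [rc _] <-]; exists r.
have CX := sub_Ck OC (smooth_field_Ck 1 sX ac).
have CT := transition_Ck 2 ac ac'.
pose F (x : E) := \sum_i field_coord c X x 0 i *: 'D_(e_ i) (transition c c') x.
have D1 : is_derive (fwd c q) v F ('D_v (field_coord c X) (fwd c q) *m tJ c c' q +
   \sum_i field_coord c X (fwd c q) 0 i *:
     'D_v (fun x => 'D_(e_ i) (transition c c') x) (fwd c q)).
  have -> : 'D_v (field_coord c X) (fwd c q) *m tJ c c' q =
     \sum_i 'D_v (field_coord c X) (fwd c q) 0 i *:
        'D_(e_ i) (transition c c') (fwd c q).
    by rewrite tJ_derive// (C1_derive _ oO (CkS CT) Ox).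
  rewrite -big_split.
  apply/is_derive_lineP; apply: hdw_sum => i.
  have h1 := is_derive_coord i (Ck_is_derive v oO CX Ox).
  have h2 := Ck_is_derive v oO (Ck_partial i CT) Ox.
  by move/is_derive_lineP : (is_derive_scale h1 h2).
have D2 : is_derive (fwd c q) v (field_coord c' X \o transition c c')
    ('D_(v *m tJ c c' q) (field_coord c' X) (fwd c' q)).
  have [dX _] := C1_diff (open_codom ac') (smooth_field_Ck 1 sX ac') (in_codom qc').
  have dT := transition_diff ac ac' qc qc'.
  have dX' : differentiable (field_coord c' X) (transition c c' (fwd c q)).
    by rewrite transition_fwd.
  have dd := differentiable_comp dT dX'.
  split; first exact: diff_derivable.
  have e : 'd (field_coord c' X \o transition c c') (fwd c q) v =
      'd (field_coord c' X) (transition c c' (fwd c q))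
        ('d (transition c c') (fwd c q) v).
    exact: (congr1 (fun g => g v) (diff_comp dT dX')).
  rewrite (_ : transition c c' (fwd c q) = fwd c' q) in e; last exact: transition_fwd.
  have e3 : 'D_(v *m tJ c c' q) (field_coord c' X) (fwd c' q) =
      'd (field_coord c' X) (fwd c' q) ('d (transition c c') (fwd c q) v).
    by rewrite tJE; exact: deriveE.
  exact: etrans (deriveE v dd) (etrans e (esym e3)).
have D3 : is_derive (fwd c q) v F ('D_(v *m tJ c c' q) (field_coord c' X) (fwd c' q)).
  apply: (is_derive_ext oO Ox _ D2) => _ [r [rc rc'] <-] /=.
  rewrite transition_fwd// (field_coord_change _ ac ac')// tJ_derive//.
  by rewrite (C1_derive _ oO (CkS CT) (in_overlap rc rc')).
by rewrite -(@derive_val _ _ _ _ _ _ _ D1) (@derive_val _ _ _ _ _ _ _ D3).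
Qed.

(** The bracket is defined at each point in the preferred chart of that point. In a
    fixed chart the usual formula still holds, because the second derivatives of the
    transition map cancel; hence brackets are smooth and can be iterated. *)
Lemma field_coord_bracket c X Y q : atlas c -> smooth_field X -> smooth_field Y ->
  dom c q ->
  field_coord c (lie_bracket X Y) (fwd c q) =
  'D_(field_coord c X (fwd c q)) (field_coord c Y) (fwd c q) -
  'D_(field_coord c Y (fwd c q)) (field_coord c X) (fwd c q).
Proof.
move=> ac sX sY qc; have ac' := atlas_chart_at q; have qc' := dom_chart_at q.
rewrite field_coordE// /lie_bracket; set ch := chart_at q.
have oO := open_overlap ac' ac.
have Ox := in_overlap qc' qc.
rewrite mulmxBl !(field_coord_change _ ac' ac qc' qc) -/ch.
pose a := field_coord ch X (fwd ch q); pose b := field_coord ch Y (fwd ch q).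
have e1 := derive_field_coord a ac' ac sY qc' qc.
have e2 := derive_field_coord b ac' ac sX qc' qc.
have e3 := second_derivative_sym b a oO (transition_Ck 2 ac' ac) Ox.
have zE (u w s : E) : u - w = (u + s) - (w + s).
  by rewrite opprD addrACA subrr addr0.
have e1' := etrans (congr1 (fun S => _ + S) (esym e3)) e1.
exact: etrans (zE _ _ _) (congr2 (fun u w => u - w) e1' e2).
Qed.

Lemma lie_bracket_smooth X Y : smooth_field X -> smooth_field Y ->
  smooth_field (lie_bracket X Y).
Proof.
move=> sX sY c ac k; rewrite setTI.
have oC := open_codom ac.
have CX := smooth_field_Ck k.+1 sX ac; have CY := smooth_field_Ck k.+1 sY ac.
apply: (Ck_ext (f := fun x => 'D_(field_coord c X x) (field_coord c Y) x
   + - 'D_(field_coord c Y x) (field_coord c X) x)) => //.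
  by move=> _ [q qc <-]; rewrite field_coord_bracket.
apply: CkD => //; first by apply: Ck_derive_along => //; exact: CkS.
by apply: CkN => //; apply: Ck_derive_along => //; exact: CkS.
Qed.

Lemma field_coord_comb c X Y a b x :
  field_coord c (fun q => a *: X q + b *: Y q) x =
  a *: field_coord c X x + b *: field_coord c Y x.
Proof. by rewrite /field_coord /vec_coord mulmxDl !scalemxAl. Qed.

Lemma smooth_comb X Y a b : smooth_field X -> smooth_field Y ->
  smooth_field (fun q => a *: X q + b *: Y q).
Proof.
move=> sX sY c ac k; rewrite setTI; have oC := open_codom ac.
apply: (Ck_ext (f := fun x => a *: field_coord c X x + b *: field_coord c Y x)) => //.
  by move=> x _; rewrite field_coord_comb.
by apply: CkD => //; apply: Ck_scale => //; try exact: Ck_cst; exact: smooth_field_Ck.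
Qed.

Lemma derive_field_comb c X Y a b q v : atlas c -> smooth_field X -> smooth_field Y ->
  dom c q ->
  'D_v (field_coord c (fun q => a *: X q + b *: Y q)) (fwd c q) =
  a *: 'D_v (field_coord c X) (fwd c q) + b *: 'D_v (field_coord c Y) (fwd c q).
Proof.
move=> ac sX sY qc.
have oC := open_codom ac; have Cq := in_codom qc.
have -> : field_coord c (fun q => a *: X q + b *: Y q) =
    a *: field_coord c X + b *: field_coord c Y.
  by apply/funext => x; rewrite field_coord_comb.
have hX := is_deriveZ a (Ck_is_derive v oC (smooth_field_Ck 1 sX ac) Cq).
have hY := is_deriveZ b (Ck_is_derive v oC (smooth_field_Ck 1 sY ac) Cq).
exact: (@derive_val _ _ _ _ _ _ _ (is_deriveD hX hY)).
Qed.

Lemma lie_bracket_comb X1 X2 Y a b q : smooth_field X1 -> smooth_field X2 ->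
  smooth_field Y ->
  lie_bracket (fun q => a *: X1 q + b *: X2 q) Y q =
  a *: lie_bracket X1 Y q + b *: lie_bracket X2 Y q.
Proof.
move=> s1 s2 sY; rewrite /lie_bracket /=.
have ac := atlas_chart_at q; have qc := dom_chart_at q.
have oC := open_codom ac; have Cq := in_codom qc.
rewrite derive_field_comb// field_coord_comb.
have [dY dYE] := C1_diff oC (smooth_field_Ck 1 sY ac) Cq.
rewrite !(deriveE _ dY) linearD !linearZ /=.
by rewrite !scalerBr opprD addrACA.
Qed.

End Charts.

(** * Hamiltonian lifts *)

Section Lifts.
Context {R : realType} {n : nat} {M : manifold R n}.
Implicit Types (c : chart R M n) (q : M) (X Y : M -> 'rV[R]_n) (l : cotangent M)
  (lam : R -> cotangent M) (A : set R).
Local Notation E := 'rV[R]_n.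
Local Notation e_ i := (@basis_vec R n i).

(** The Hamiltonian vector field of [hfun X] in the canonical coordinates of [c]. *)
Definition lift_vec c X (x p : E) : E * E :=
  (field_coord c X x, - \row_j dotp p ('D_(e_ j) (field_coord c X) x)).

Definition lift_eq A c X lam t := has_derivative_within A (ctg_coord c \o lam) t
  (lift_vec c X (fwd c (lam t).1) (momentum c (lam t))).

Lemma lift_eqP A c X lam t : lift_eq A c X lam t <->
  has_derivative_within A (fun s => fwd c (lam s).1) t
     (field_coord c X (fwd c (lam t).1)) /\
  has_derivative_within A (fun s => momentum c (lam s)) t
     (- \row_j dotp (momentum c (lam t))
          ('D_(e_ j) (field_coord c X) (fwd c (lam t).1))).
Proof. exact: (hdw_pair A (fun s => fwd c (lam s).1)). Qed.

Lemma hfun_of_ctg_coord X c x p :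
  hfun X (of_ctg_coord c x p) = dotp p (field_coord c X x).
Proof. by rewrite hfunE /of_ctg_coord /= dotp_tr. Qed.

Lemma dotp_basis i v : dotp (e_ i) v = v 0 i.
Proof.
rewrite /dotp (bigD1 i)//= big1 ?addr0; first by rewrite mxE !eqxx mul1r.
by move=> j ji; rewrite mxE (negbTE ji) andbF mul0r.
Qed.

Lemma comb_coord (a b : R) (v w : E) i : (a *: v + b *: w) 0 i = a * v 0 i + b * w 0 i.
Proof. by rewrite !mxE. Qed.

Lemma is_derive_dotpl (V p v : E) : is_derive p v (dotp^~ V) (dotp v V).
Proof.
apply/is_derive_lineP.
have := hdw_dotp (hdwD (hdw_mul (hdw_id setT 0) (hdw_cst setT v 0))
  (hdw_cst setT p 0)) (hdw_cst setT V 0).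
rewrite scale1r scaler0 !addr0.
have -> : dotp (0 *: v + p) 0 = 0.
  by rewrite /dotp big1// => i _; rewrite [X in _ * X]mxE mulr0.
by rewrite addr0.
Qed.

Lemma is_derive_dotpr c X (p v : E) q : atlas c -> smooth_field X -> dom c q ->
  is_derive (fwd c q) v (fun x => dotp p (field_coord c X x))
    (dotp p ('D_v (field_coord c X) (fwd c q))).
Proof.
move=> ac sX qc; apply/is_derive_lineP.
have /is_derive_lineP h := Ck_is_derive v (open_codom ac) (smooth_field_Ck 1 sX ac)
  (in_codom qc).
by have := hdw_dotp (hdw_cst setT p 0) h; rewrite dotp0l add0r.
Qed.

Lemma is_derive_half_squares (f g : E -> R) x v df dg :
  is_derive x v f df -> is_derive x v g dg ->
  is_derive x v (fun y => 2^-1 * (f y ^+ 2 + g y ^+ 2)) (f x * df + g x * dg).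
Proof.
move=> /is_derive_lineP hf /is_derive_lineP hg; apply/is_derive_lineP.
have h := hdw_mul (hdw_cst setT (2^-1 : R) 0)
  (hdwD (@hdw_mul _ R^o _ _ _ _ _ _ hf hf) (@hdw_mul _ R^o _ _ _ _ _ _ hg hg)).
move: h; rewrite scale0r add0r scale0r add0r.
set V := (X in has_derivative_within _ _ _ X -> _).
have -> : V = f x * df + g x * dg by rewrite /V /GRing.scale /=; lra.
by apply: (hdw_local ltr01); [|move=> s _ _; split=> //]; rewrite !expr2.
Qed.

Lemma ctg_coord_at l : ctg_coord (chart_at l.1) l = (fwd (chart_at l.1) l.1, l.2).
Proof. by rewrite -[in RHS](momentum_chart_at l). Qed.

Lemma hamiltonian_fieldE h l : let c := chart_at l.1 in
  hamiltonian_field h l =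
  (\row_i 'D_(e_ i) (fun p => h (of_ctg_coord c (fwd c l.1) p)) l.2,
   - \row_i 'D_(e_ i) (fun x => h (of_ctg_coord c x l.2)) (fwd c l.1)).
Proof. by rewrite /hamiltonian_field; cbv zeta; rewrite ctg_coord_at. Qed.

Lemma hamiltonian_hfun X l : smooth_field X ->
  hamiltonian_field (hfun X) l =
  lift_vec (chart_at l.1) X (fwd (chart_at l.1) l.1) l.2.
Proof.
move=> sX; rewrite hamiltonian_fieldE.
have ac := atlas_chart_at l.1; have qc := dom_chart_at l.1.
congr (_, _); last congr (- _); apply/rowP => i; rewrite [LHS]mxE.
  have -> : (fun p' => hfun X (of_ctg_coord (chart_at l.1) (fwd (chart_at l.1) l.1) p'))
     = dotp^~ (field_coord (chart_at l.1) X (fwd (chart_at l.1) l.1)).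
    by apply/funext => p'; rewrite hfun_of_ctg_coord.
  rewrite -[RHS]dotp_basis; exact: (@derive_val _ _ _ _ _ _ _ (is_derive_dotpl _ _ _)).
have -> : (fun x' => hfun X (of_ctg_coord (chart_at l.1) x' l.2)) =
     fun x' => dotp l.2 (field_coord (chart_at l.1) X x').
  by apply/funext => x'; rewrite hfun_of_ctg_coord.
rewrite [RHS]mxE.
exact: (@derive_val _ _ _ _ _ _ _ (is_derive_dotpr _ _ ac sX qc)).
Qed.

(** Normal extremals thus satisfy the same equation, linear in the covector, as
    abnormal ones, with the momenta as control. *)
Lemma hamiltonian_sr X1 X2 l : smooth_field X1 -> smooth_field X2 ->
  hamiltonian_field (sr_hamiltonian X1 X2) l =
  hfun X1 l *: hamiltonian_field (hfun X1) l +
  hfun X2 l *: hamiltonian_field (hfun X2) l.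
Proof.
move=> s1 s2; rewrite !hamiltonian_hfun// hamiltonian_fieldE.
have ac := atlas_chart_at l.1; have qc := dom_chart_at l.1.
set ch := chart_at l.1.
have hE X : hfun X l = dotp l.2 (field_coord ch X (fwd ch l.1)).
  by rewrite hfunE field_coord_at.
congr (_, _).
  apply/rowP => i; rewrite [LHS]mxE [RHS]comb_coord.
  have -> : (fun p' => sr_hamiltonian X1 X2 (of_ctg_coord ch (fwd ch l.1) p')) =
    fun p' => 2^-1 * (dotp p' (field_coord ch X1 (fwd ch l.1)) ^+ 2 +
                      dotp p' (field_coord ch X2 (fwd ch l.1)) ^+ 2).
    by apply/funext => p'; rewrite /sr_hamiltonian !hfun_of_ctg_coord.
  apply: etrans (@derive_val _ _ _ _ _ _ _ (is_derive_half_squares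
    (is_derive_dotpl _ _ _) (is_derive_dotpl _ _ _))) _.
  congr (_ * _ + _ * _); first [exact: esym (hE _) | exact: dotp_basis].
rewrite -[RHS]/(hfun X1 l *: - (\row_j _) + hfun X2 l *: - (\row_j _)).
rewrite !scalerN -opprD; congr (- _); apply/rowP => i.
rewrite [LHS]mxE [RHS]comb_coord.
have -> : (fun x' => sr_hamiltonian X1 X2 (of_ctg_coord ch x' l.2)) =
    fun x' => 2^-1 * (dotp l.2 (field_coord ch X1 x') ^+ 2 +
                      dotp l.2 (field_coord ch X2 x') ^+ 2).
  by apply/funext => p'; rewrite /sr_hamiltonian !hfun_of_ctg_coord.
apply: etrans (@derive_val _ _ _ _ _ _ _ (is_derive_half_squares
    (is_derive_dotpr _ _ ac s1 qc) (is_derive_dotpr _ _ ac s2 qc))) _.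
by congr (_ * _ + _ * _); first [exact: esym (hE _) | rewrite [RHS]mxE].
Qed.

(** Freezing the control at one time turns [u1 X1 + u2 X2] into a single field, to
    which the statements on one field apply. *)
Definition frozen X1 X2 (u : R * R) : M -> 'rV[R]_n :=
  fun q => u.1 *: X1 q + u.2 *: X2 q.

Lemma frozen_smooth X1 X2 u : smooth_field X1 -> smooth_field X2 ->
  smooth_field (frozen X1 X2 u).
Proof. exact: smooth_comb. Qed.

Lemma lift_vec_frozen c X1 X2 u q p : atlas c -> smooth_field X1 -> smooth_field X2 ->
  dom c q -> lift_vec c (frozen X1 X2 u) (fwd c q) p =
  u.1 *: lift_vec c X1 (fwd c q) p + u.2 *: lift_vec c X2 (fwd c q) p.
Proof.
move=> ac s1 s2 qc; congr (_, _).
  by rewrite field_coord_comb.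
rewrite -[RHS]/(u.1 *: - (\row_j _) + u.2 *: - (\row_j _)).
rewrite !scalerN -opprD; congr (- _); apply/rowP => j.
rewrite [RHS]comb_coord [LHS]mxE.
apply: etrans (congr1 (dotp p) (derive_field_comb u.1 u.2 (e_ j) ac s1 s2 qc)) _.
apply: etrans (dotp_Dr _ _ _) _.
apply: etrans (congr2 +%R (dotp_Zr _ _ _) (dotp_Zr _ _ _)) _.
by congr (_ * _ + _ * _); rewrite [RHS]mxE.
Qed.

(** Normal, abnormal and regular lifts all satisfy this equation; they differ in how
    the control [u] depends on the lift. *)
Definition follows X1 X2 A (u : R -> R * R) lam t :=
  has_derivative_within A (ctg_coord (chart_at (lam t).1) \o lam) t
    ((u t).1 *: hamiltonian_field (hfun X1) (lam t) +
     (u t).2 *: hamiltonian_field (hfun X2) (lam t)).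

Lemma followsE X1 X2 A u lam t : smooth_field X1 -> smooth_field X2 ->
  follows X1 X2 A u lam t <->
  lift_eq A (chart_at (lam t).1) (frozen X1 X2 (u t)) lam t.
Proof.
move=> s1 s2; have ac := atlas_chart_at (lam t).1; have qc := dom_chart_at (lam t).1.
have e : lift_vec (chart_at (lam t).1) (frozen X1 X2 (u t))
    (fwd (chart_at (lam t).1) (lam t).1) (momentum (chart_at (lam t).1) (lam t)) =
  (u t).1 *: hamiltonian_field (hfun X1) (lam t) +
  (u t).2 *: hamiltonian_field (hfun X2) (lam t).
  rewrite momentum_chart_at (hamiltonian_hfun _ s1) (hamiltonian_hfun _ s2).
  exact: lift_vec_frozen.
by rewrite /lift_eq e.
Qed.

Lemma near_dom A (g : R -> M) t (O : set M) :
  g @ within A (nbhs t) --> g t -> open O -> O (g t) ->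
  exists2 d, 0 < d & forall s, A s -> `|s - t| < d -> O (g s).
Proof.
move=> cg oO Ot; have /cg : nbhs (g t) O by apply: open_nbhs_nbhs.
rewrite /nbhs /= /within /= => /nbhs_ballP[d /= d0 Hd]; exists d => // s As sd.
by apply: Hd => //; rewrite /ball /= distrC.
Qed.

(** Hamiltonian equations are invariant under changes of charts. It is needed because
    integral curves are specified at each time in the preferred chart of that time,
    while differential equations are solved in one chart.

    With [psi] the transition from [c'] to [c], the [j]-th fibre coordinate in [c'] is
    the pairing of [momentum c] with the [j]-th partial derivative of [psi];
    differentiating it produces second derivatives of [psi] which cancel, by symmetry,
    those in [derive_field_coord]. *)
Lemma lift_eq_change A c c' X lam t : smooth_field X -> atlas c -> atlas c' ->
  (fst \o lam) @ within A (nbhs t) --> (lam t).1 -> A t ->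
  dom c (lam t).1 -> dom c' (lam t).1 ->
  lift_eq A c X lam t -> lift_eq A c' X lam t.
Proof.
move=> sX ac ac' cb At qc qc'; set q := (lam t).1 in cb qc qc' *.
have oO : open (dom c `&` dom c') by apply: openI; exact: open_dom.
have [d d0 Hd] := near_dom cb oO (conj qc qc').
move=> /lift_eqP[hx hp]; rewrite -/q in hx hp.
have hy : has_derivative_within A (fun s => fwd c' (lam s).1) t
    (field_coord c' X (fwd c' q)).
  have := hdw_comp hx (transition_diff ac ac' qc qc').
  rewrite -/q -tJE -(field_coord_change _ ac ac' qc qc').
  apply: (hdw_local d0); first by rewrite /= transition_fwd.
  by move=> s As sd; have [sc sc'] := Hd s As sd; rewrite /= transition_fwd.
apply/lift_eqP; split; first exact: hy.
rewrite -/q.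
set p := momentum c (lam t) in hp *.
set x := fwd c q in hp *; set y := fwd c' q in hy *.
have oOv := open_overlap ac' ac; have Oy := in_overlap qc' qc.
have CT := transition_Ck 2 ac' ac.
apply/hdw_rowP => j.
pose DT j z := 'D_(e_ j) (transition c' c) z.
have momj s : dom c (lam s).1 -> dom c' (lam s).1 ->
    momentum c' (lam s) 0 j = dotp (momentum c (lam s)) (DT j (fwd c' (lam s).1)).
  move=> sc sc'; rewrite (momentum_change ac' ac)//.
  have -> : DT j (fwd c' (lam s).1) = e_ j *m tJ c' c (lam s).1.
    by rewrite (tJ_derive _ ac' ac).
  by rewrite -dotp_tr /dotp -[RHS]/(dotp _ _) -[LHS]dotp_basis /dotp;
     apply: eq_bigr => i _; rewrite mulrC.
have dDT : differentiable (DT j) y.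
  by have [] := C1_diff oOv (Ck_partial j CT) Oy.
have hDT := hdw_comp hy dDT.
have := hdw_dotp hp hDT.
set V := (dotp _ _ + dotp _ _).
suff -> : V = (- \row_k dotp (momentum c' (lam t)) ('D_(e_ k) (field_coord c' X) y)) 0 j.
  apply: (hdw_local d0); first by rewrite momj.
  by move=> s As sd; have [sc sc'] := Hd s As sd; rewrite momj.
have DTj : DT j y = e_ j *m tJ c' c q by rewrite (tJ_derive _ ac' ac).
pose B : E := \sum_i field_coord c' X y 0 i *:
  'D_(e_ j) (fun z => 'D_(e_ i) (transition c' c) z) y.
have K : 'D_(e_ j) (field_coord c' X) y *m tJ c' c q + B =
    'D_(e_ j *m tJ c' c q) (field_coord c X) x.
  exact: derive_field_coord.
have K1 : dotp p ('D_(e_ j) (field_coord c' X) y *m tJ c' c q) =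
    dotp p ('D_(e_ j *m tJ c' c q) (field_coord c X) x) - dotp p B.
  by apply: etrans (esym (addrK (dotp p B) _)) _; congr (_ - _);
    exact: etrans (esym (dotp_Dr _ _ _)) (congr1 (dotp p) K).
have T1 : dotp (- \row_k dotp p ('D_(e_ k) (field_coord c X) x)) (DT j y) =
    - dotp p ('D_(e_ j *m tJ c' c q) (field_coord c X) x).
  apply: etrans (dotp_Nl _ _) _; congr (- _).
  apply: etrans _ (esym (congr1 (dotp p) (C1_derive _ (open_codom ac)
    (smooth_field_Ck 1 sX ac) (in_codom qc)))).
  apply: etrans _ (esym (dotp_sumr _ _)); apply: eq_bigr => k _.
  rewrite -DTj; apply: etrans _ (esym (dotp_Zr _ _ _)).
  by rewrite [X in X * _]mxE mulrC.
(* symmetry of second derivatives enters here *)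
have T2 : dotp p ('d (DT j) y (field_coord c' X y)) = dotp p B.
  congr (dotp p _).
  have e := C1_derive (field_coord c' X y) oOv (Ck_partial j CT) Oy.
  apply: etrans (esym (deriveE _ dDT)) (etrans e _).
  apply: eq_bigr => i _.
  exact: (congr1 (GRing.scale _) (Schwarz_C2 i j oOv CT Oy)).
have K2 : (- \row_k dotp (momentum c' (lam t)) ('D_(e_ k) (field_coord c' X) y)) 0 j
    = - dotp p ('D_(e_ j) (field_coord c' X) y *m tJ c' c q).
  rewrite mxE; congr (- _); rewrite mxE (momentum_change ac' ac qc' qc).
  exact: dotp_tr.
apply: etrans (congr2 +%R T1 T2) (esym (etrans K2 _)).
by apply: etrans (congr1 -%R K1) _; rewrite opprB addrC.
Qed.

(** The Poisson bracket of [hfun X] and [hfun Y] is [hfun (lie_bracket X Y)]. *)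
Lemma hfun_lift_derivative A X Y lam t : smooth_field X -> smooth_field Y ->
  (fst \o lam) @ within A (nbhs t) --> (lam t).1 -> A t ->
  lift_eq A (chart_at (lam t).1) X lam t ->
  has_derivative_within A (hfun Y \o lam) t (hfun (lie_bracket X Y) (lam t)).
Proof.
move=> sX sY cb At; set q := (lam t).1 in cb *; set c := chart_at q.
have ac : atlas c by exact: atlas_chart_at.
have qc : dom c q by exact: dom_chart_at.
have [d d0 Hd] := near_dom cb (open_dom ac) qc.
move=> /lift_eqP[hx hp]; rewrite -/q -/c in hx hp.
set p := momentum c (lam t) in hp *; set x := fwd c q in hx hp *.
have [dY _] := C1_diff (open_codom ac) (smooth_field_Ck 1 sY ac) (in_codom qc).
have hY := hdw_comp hx dY.
have := hdw_dotp hp hY.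
set V := (dotp _ _ + dotp _ _).
suff -> : V = hfun (lie_bracket X Y) (lam t).
  apply: (hdw_local d0); first by rewrite /= -hfun_chart.
  by move=> s As sd; have sc := Hd s As sd; rewrite /= -hfun_chart.
rewrite /V (hfun_chart _ ac qc) field_coord_bracket// -/x -/p dotp_Dr dotp_Nr addrC.
congr (_ + _); first by rewrite deriveE.
rewrite (C1_derive _ (open_codom ac) (smooth_field_Ck 1 sX ac) (in_codom qc)) -/x.
rewrite dotp_sumr dotp_Nl; congr (- _); apply: eq_bigr => k _.
by rewrite !mxE dotp_Zr mulrC.
Qed.

End Lifts.

(** * Locally Lipschitz maps and uniqueness of flows *)

Section LocLip.
Context {R : realType}.

Section One.
Context {V W : normedModType R}.

Lemma loclip_bounded (f : V -> W) x : loclip f x ->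
  exists r K, [/\ 0 < r, 0 <= K & forall y, `|y - x| < r -> `|f y| <= K].
Proof.
move=> [r [L [r0 L0 H]]]; exists r, (`|f x| + L * r); split=> //.
  by rewrite addr_ge0// mulr_ge0// ltW.
move=> y yr; have := H y x yr; rewrite subrr normr0 => /(_ r0) h.
rewrite -[f y](subrK (f x)) addrC; apply: le_trans (ler_normD _ _) _.
by rewrite lerD2l; apply: le_trans h _; rewrite ler_wpM2l// ltW.
Qed.

Lemma loclip_cst (w : W) x : loclip (fun _ : V => w) x.
Proof.
by exists 1, 0; split=> // y z _ _; rewrite subrr normr0 mul0r.
Qed.

Lemma loclipD (f g : V -> W) x : loclip f x -> loclip g x ->
  loclip (fun y => f y + g y) x.
Proof.
move=> [r1 [L1 [r10 L10 H1]]] [r2 [L2 [r20 L20 H2]]].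
exists (Num.min r1 r2), (L1 + L2); split; rewrite ?lt_min ?r10 ?addr_ge0//.
move=> y z; rewrite !lt_min => /andP[y1 y2] /andP[z1 z2].
rewrite opprD addrACA; apply: le_trans (ler_normD _ _) _.
by rewrite mulrDl lerD// ?H1 ?H2.
Qed.

Lemma loclip_scale (a : V -> R) (f : V -> W) x : loclip a x -> loclip f x ->
  loclip (fun y => a y *: f y) x.
Proof.
move=> la lf.
have [r3 [Ka [r30 Ka0 Ha]]] : exists r K, [/\ 0 < r, 0 <= K &
    forall y, `|y - x| < r -> `|a y| <= K].
  case: la => [r [L [r0 L0 H]]]; exists r, (`|a x| + L * r); split=> //.
    by rewrite addr_ge0// mulr_ge0// ltW.
  move=> y yr; have := H y x yr; rewrite subrr normr0 => /(_ r0) h.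
  rewrite -[a y](subrK (a x)) addrC; apply: le_trans (ler_normD _ _) _.
  by rewrite lerD2l; apply: le_trans h _; rewrite ler_wpM2l// ltW.
have [r4 [Kf [r40 Kf0 Hf]]] := loclip_bounded lf.
move: la lf => [r1 [L1 [r10 L10 H1]]] [r2 [L2 [r20 L20 H2]]].
exists (Num.min (Num.min r1 r2) (Num.min r3 r4)), (Ka * L2 + Kf * L1).
split; first by rewrite !lt_min r10 r20 r30.
  by rewrite addr_ge0// mulr_ge0.
move=> y z; rewrite !lt_min => /andP[/andP[y1 y2] /andP[y3 y4]].
move=> /andP[/andP[z1 z2] /andP[z3 z4]].
have -> : a y *: f y - a z *: f z = a y *: (f y - f z) + (a y - a z) *: f z.
  by rewrite scalerBr scalerBl addrA subrK.
apply: le_trans (ler_normD _ _) _; rewrite !normrZ mulrDl; apply: lerD.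
  by rewrite -mulrA; apply: ler_pM => //; [exact: Ha|exact: H2].
by rewrite -mulrA [leRHS]mulrC; apply: ler_pM => //;
  [exact: H1|exact: Hf].
Qed.

Lemma loclip_sum m (f : 'I_m -> V -> W) x : (forall i, loclip (f i) x) ->
  loclip (fun y => \sum_i f i y) x.
Proof.
elim: m f => [|m IH] f H.
  have -> : (fun y => \sum_i f i y) = fun=> 0.
    by apply/funext => y; rewrite big_ord0.
  exact: loclip_cst.
have -> : (fun y => \sum_i f i y) =
    fun y => \sum_(i < m) f (widen_ord (leqnSn m) i) y + f ord_max y.
  by apply/funext => y; rewrite big_ord_recr.
by apply: loclipD => //; apply: IH.
Qed.

Lemma loclipN (f : V -> W) x : loclip f x -> loclip (fun y => - f y) x.
Proof.
move=> [r [L [r0 L0 H]]]; exists r, L; split=> // y z yr zr.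
by rewrite -opprD normrN; exact: H.
Qed.

Lemma loclip_real_comp (phi : R -> R) (f : V -> R) x : loclip f x ->
  loclip phi (f x) -> loclip (phi \o f) x.
Proof.
move=> [r1 [L1 [r10 L10 H1]]] [r2 [L2 [r20 L20 H2]]].
have L11 : 0 < L1 + 1 by rewrite ltr_wpDl.
exists (Num.min r1 (r2 / (L1 + 1))), (L2 * L1).
split; rewrite ?lt_min ?r10 ?divr_gt0 ?mulr_ge0//.
have inr y : `|y - x| < r1 -> `|y - x| < r2 / (L1 + 1) -> `|f y - f x| < r2.
  move=> y1 y2; apply: le_lt_trans (H1 _ _ y1 _) _; first by rewrite subrr normr0.
  by move: y2; rewrite ltr_pdivlMr// => h; have := normr_ge0 (y - x); lra.
move=> y z; rewrite !lt_min => /andP[y1 y2] /andP[z1 z2].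
apply: le_trans (H2 _ _ (inr _ y1 y2) (inr _ z1 z2)) _.
by rewrite -mulrA ler_wpM2l//; exact: H1.
Qed.

End One.

Lemma loclip_pair (V W1 W2 : normedModType R) (f : V -> W1) (g : V -> W2) x :
  loclip f x -> loclip g x -> loclip (fun y => (f y, g y)) x.
Proof.
move=> [r1 [L1 [r10 L10 H1]]] [r2 [L2 [r20 L20 H2]]].
exists (Num.min r1 r2), (L1 + L2); split; rewrite ?lt_min ?r10 ?addr_ge0//.
move=> y z; rewrite !lt_min => /andP[y1 y2] /andP[z1 z2].
have -> : `|(f y, g y) - (f z, g z)| = Num.max `|f y - f z| `|g y - g z| by [].
rewrite ge_max mulrDl; apply/andP; split.
  by apply: le_trans (H1 _ _ y1 z1) _; rewrite lerDl mulr_ge0.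
by apply: le_trans (H2 _ _ y2 z2) _; rewrite lerDr mulr_ge0.
Qed.

Lemma norm_fst (V W : normedModType R) (z z' : V * W) :
  `|z.1 - z'.1| <= `|z - z'|.
Proof.
have -> : `|z - z'| = Num.max `|z.1 - z'.1| `|z.2 - z'.2| by [].
by rewrite le_max lexx.
Qed.

Lemma norm_snd (V W : normedModType R) (z z' : V * W) :
  `|z.2 - z'.2| <= `|z - z'|.
Proof.
have -> : `|z - z'| = Num.max `|z.1 - z'.1| `|z.2 - z'.2| by [].
by rewrite le_max lexx orbT.
Qed.

Lemma loclip_fst (V W U : normedModType R) (f : V -> U) (z : V * W) :
  loclip f z.1 -> loclip (fun y : V * W => f y.1) z.
Proof.
move=> [r [L [r0 L0 H]]]; exists r, L; split=> // y y' yr yr'.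
apply: le_trans (H _ _ _ _) _.
- exact: le_lt_trans (norm_fst _ _) yr.
- exact: le_lt_trans (norm_fst _ _) yr'.
- by rewrite ler_wpM2l//; exact: norm_fst.
Qed.

Lemma loclip_snd_coord (V : normedModType R) m (z : V * 'rV[R]_m) j :
  loclip (fun y : V * 'rV[R]_m => y.2 0 j) z.
Proof.
exists 1, 1; split=> // y y' _ _; rewrite mul1r.
apply: le_trans (norm_snd y y').
have /(rV_norm_leP _ (normr_ge0 _))/(_ j) := lexx `|y.2 - y'.2|.
by rewrite !mxE.
Qed.

Lemma loclip_coord (V : normedModType R) m (f : V -> 'rV[R]_m) x j :
  loclip f x -> loclip (fun y => f y 0 j) x.
Proof.
move=> [r [L [r0 L0 H]]]; exists r, L; split=> // y z yr zr.
have h := H y z yr zr.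
have := h; have e0 : 0 <= L * `|y - z| by rewrite mulr_ge0.
by move=> /(rV_norm_leP _ e0)/(_ j); rewrite !mxE.
Qed.

Lemma loclip_row (V : normedModType R) m (f : 'I_m -> V -> R) x :
  (forall j, loclip (f j) x) -> loclip (fun y => \row_j f j y) x.
Proof.
move=> H.
have -> : (fun y => \row_j f j y) =
    fun y => \sum_j f j y *: (delta_mx 0 j : 'rV[R]_m).
  apply/funext => y; rewrite [LHS]row_sum_delta.
  by apply: eq_bigr => j _; rewrite mxE.
apply: loclip_sum => j; apply: loclip_scale => //; exact: loclip_cst.
Qed.

Lemma loclip_inv_sqrt (a : R) : 0 < a -> loclip (fun y => (Num.sqrt y)^-1) a.
Proof.
move=> a0; pose m := Num.sqrt (a / 2).
have m0 : 0 < m by rewrite sqrtr_gt0 divr_gt0.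
exists (a / 2), ((m * m)^-1 * (2 * m)^-1); split.
- by rewrite divr_gt0.
- by rewrite mulr_ge0// invr_ge0 mulr_ge0// ltW.
move=> y z; rewrite !ltr_norml => /andP[y1 _] /andP[z1 _].
have ym : m <= Num.sqrt y by rewrite ler_wsqrtr//; lra.
have zm : m <= Num.sqrt z by rewrite ler_wsqrtr//; lra.
have y0 : 0 < y by lra.
have z0 : 0 < z by lra.
have sy0 : 0 < Num.sqrt y by rewrite sqrtr_gt0.
have sz0 : 0 < Num.sqrt z by rewrite sqrtr_gt0.
have -> : (Num.sqrt y)^-1 - (Num.sqrt z)^-1 =
    (Num.sqrt y * Num.sqrt z)^-1 * (Num.sqrt y + Num.sqrt z)^-1 * (z - y).
  have h : z - y = (Num.sqrt z - Num.sqrt y) * (Num.sqrt y + Num.sqrt z).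
    rewrite -{1}(sqr_sqrtr (ltW z0)) -{1}(sqr_sqrtr (ltW y0)) subr_sqr.
    by rewrite [_ + Num.sqrt y]addrC.
  have s0 : Num.sqrt y + Num.sqrt z != 0 by rewrite gt_eqF// addr_gt0.
  rewrite h -[RHS]mulrA (mulrCA (_ + _)^-1) mulVf// mulr1 invfM mulrBr.
  rewrite divfK ?gt_eqF// [(Num.sqrt y)^-1 * _]mulrC divfK ?gt_eqF//.
rewrite normrM distrC ler_wpM2r// normrM !ger0_norm ?invr_ge0 ?mulr_ge0 ?addr_ge0 ?sqrtr_ge0//.
apply: ler_pM; rewrite ?invr_ge0 ?mulr_ge0 ?addr_ge0 ?sqrtr_ge0//.
  by rewrite lef_pV2 ?posrE ?mulr_gt0//; apply: ler_pM => //; exact: ltW.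
have h1 : 0 < 2 * m by rewrite mulr_gt0.
have h2 : 0 < Num.sqrt y + Num.sqrt z by rewrite addr_gt0.
rewrite lef_pV2 ?posrE//; lra.
Qed.

Lemma flow_unique (V : normedModType R) (F : V -> V) (a b : R) (z1 z2 : R -> V) :
  a < b -> loclip F (z1 a) -> z1 a = z2 a ->
  (forall t, a <= t <= b -> has_derivative_within `[a, b] z1 t (F (z1 t))) ->
  (forall t, a <= t <= b -> has_derivative_within `[a, b] z2 t (F (z2 t))) ->
  exists2 d, 0 < d & forall t, a <= t <= b -> t < a + d -> z1 t = z2 t.
Proof.
move=> ab [r [L [r0 L0 HL]]] z12 d1 d2.
have aab : a <= a <= b by rewrite lexx ltW.
have /within_cvgP/(_ _ r0)[e1 e10 H1] := hdw_cvg (d1 _ aab).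
have /within_cvgP/(_ _ r0)[e2 e20 H2] := hdw_cvg (d2 _ aab).
have L1 : 0 < 2 * (L + 1) by rewrite mulr_gt0// ltr_wpDl.
(* both curves stay in the ball where F is Lipschitz, and L * d <= 1/2 *)
pose d := Num.min (Num.min e1 e2) (2 * (L + 1))^-1.
have d0 : 0 < d by rewrite !lt_min e10 e20 invr_gt0.
have dE1 : d <= e1 by rewrite !ge_min lexx.
have dE2 : d <= e2 by rewrite !ge_min lexx orbT.
have dL : L * d <= 2^-1.
  have : d <= (2 * (L + 1))^-1 by rewrite ge_min lexx orbT.
  rewrite -[leRHS]mul1r ler_pdivlMr// => h.
  have : 0 <= d by exact: ltW.
  lra.
pose b' := Num.min b (a + d / 2).
have b'b : b' <= b by rewrite ge_min lexx.
have ab' : a <= b' by rewrite le_min ltW//=; lra.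
have b'd : b' <= a + d / 2 by rewrite ge_min lexx orbT.
have inab t : a <= t <= b' -> a <= t <= b.
  by move=> /andP[-> /le_trans]; apply.
have w0 : forall t, a <= t <= b' -> z1 t - z2 t = 0.
  apply: (@gronwall_local R V a b' L a (fun t => z1 t - z2 t)
     (fun t => F (z1 t) - F (z2 t))) => //.
  - by apply: le_trans dL; rewrite ler_wpM2l//; lra.
  - move=> t tab'; have tab := inab t tab'.
    have := hdwD (hdw_sub (subitv (lexx a) b'b) (d1 t tab))
      (hdwZ (c := -1) (hdw_sub (subitv (lexx a) b'b) (d2 t tab))).
    rewrite scaleN1r; apply: (hdw_local ltr01); first by rewrite scaleN1r.
    by move=> s ? _; rewrite scaleN1r; split.
  - move=> t tab'; have tab := inab t tab'.
    have td : `|t - a| < d.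
      by case/andP: tab' => at_ tb; rewrite ger0_norm ?subr_ge0//; lra.
    have tI : `[a, b]%classic t by rewrite /= in_itv.
    apply: HL; first by apply: H1 => //; exact: lt_le_trans dE1.
    by rewrite z12; apply: H2 => //; exact: lt_le_trans dE2.
  - by rewrite lexx.
  - by rewrite z12 subrr.
exists (d / 2); first by rewrite divr_gt0.
move=> t /andP[at_ tb] td; apply/eqP; rewrite -subr_eq0; apply/eqP/w0.
by rewrite at_ le_min tb ltW.
Qed.

End LocLip.

(** * Uniqueness of lifts beyond a common point *)

Section Unique.
Context {R : realType} {n : nat} {M : manifold R n}.
Implicit Types (c : chart R M n) (q : M) (X Y : M -> 'rV[R]_n) (l : cotangent M)
  (lam : R -> cotangent M) (A : set R).
Local Notation E := 'rV[R]_n.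
Local Notation e_ i := (@basis_vec R n i).
Local Notation mu := (@lebesgue_measure R).

Lemma loclip_field c X q : atlas c -> smooth_field X -> dom c q ->
  loclip (field_coord c X) (fwd c q).
Proof.
move=> ac sX qc.
exact: C1_loclip (open_codom ac) (smooth_field_Ck 1 sX ac) (in_codom qc).
Qed.

Lemma loclip_dotp (f : E -> E) (z : E * E) : loclip f z.1 ->
  loclip (fun y : E * E => dotp y.2 (f y.1)) z.
Proof.
move=> lf; rewrite /dotp; apply: loclip_sum => i.
apply: (@loclip_scale _ _ R^o); first exact: loclip_snd_coord.
exact: (loclip_coord i (loclip_fst lf)).
Qed.

Definition hfun_coord c Y (z : E * E) : R := dotp z.2 (field_coord c Y z.1).

Lemma loclip_hfun_coord c Y (z : E * E) q : atlas c -> smooth_field Y -> dom c q ->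
  z.1 = fwd c q -> loclip (hfun_coord c Y) z.
Proof. by move=> ac sY qc zq; apply: loclip_dotp; rewrite zq; exact: loclip_field. Qed.

Lemma hfun_coordE c Y l : atlas c -> dom c l.1 ->
  hfun Y l = hfun_coord c Y (ctg_coord c l).
Proof. by move=> ac lc; rewrite (hfun_chart _ ac lc). Qed.

Lemma loclip_lift_vec c X (z : E * E) q : atlas c -> smooth_field X -> dom c q ->
  z.1 = fwd c q -> loclip (fun y => lift_vec c X y.1 y.2) z.
Proof.
move=> ac sX qc zq; apply: loclip_pair.
  by apply: loclip_fst; rewrite zq; exact: loclip_field.
apply: loclipN; apply: loclip_row => j.
apply: (@loclip_dotp (fun x => 'D_(e_ j) (field_coord c X) x)); rewrite zq.
exact: C1_loclip (open_codom ac) (Ck_partial j (smooth_field_Ck 2 sX ac)) (in_codom qc).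
Qed.

Lemma loclip_cvg (V W : normedModType R) (F : V -> W) (z : R -> V) A t :
  loclip F (z t) -> z @ within A (nbhs t) --> z t ->
  (F \o z) @ within A (nbhs t) --> F (z t).
Proof.
move=> [r [L [r0 L0 H]]] /within_cvgP cz; apply/within_cvgP => e e0.
have L1 : 0 < L + 1 by rewrite ltr_wpDl.
have m0 : 0 < Num.min r (e / (L + 1)) by rewrite lt_min r0 divr_gt0.
have [d d0 Hd] := cz _ m0; exists d => // s As sd.
have := Hd s As sd; rewrite lt_min ltr_pdivlMr// => /andP[zr ze].
apply: le_lt_trans (H _ _ zr _) _; first by rewrite subrr normr0.
by have := normr_ge0 (z s - z t); lra.
Qed.

Lemma ctg_inj c l l' : atlas c -> dom c l.1 -> l.1 = l'.1 ->
  momentum c l = momentum c l' -> l = l'.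
Proof.
case: l l' => [q p] [q' p'] /= ac qc qq' mm; subst q'; congr (_, _).
have ac' := atlas_chart_at q; have qc' := dom_chart_at q.
have := momentum_chart_at (q, p); rewrite /= (momentum_change ac' ac)//= mm => <-.
by have := momentum_chart_at (q, p'); rewrite /= (momentum_change ac' ac).
Qed.

Definition base_cvg A lam t := (fst \o lam) @ within A (nbhs t) --> (lam t).1.

Lemma base_cvg_sub A B lam t : B `<=` A -> base_cvg A lam t -> base_cvg B lam t.
Proof. exact: cvg_within_sub. Qed.

Lemma base_cvgP (a b : R) lam : {within `[a, b], continuous (fst \o lam)} <->
  forall t, a <= t <= b -> base_cvg `[a, b] lam t.
Proof. exact: (@within_itv_continuousP R M a b (fst \o lam)). Qed.

Variables (X1 X2 : M -> 'rV[R]_n).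
Hypotheses (s1 : smooth_field X1) (s2 : smooth_field X2).

Lemma follows_in_chart A u lam t c : atlas c -> dom c (lam t).1 -> A t ->
  base_cvg A lam t -> follows X1 X2 A u lam t ->
  has_derivative_within A (ctg_coord c \o lam) t
   ((u t).1 *: lift_vec c X1 (ctg_coord c (lam t)).1 (ctg_coord c (lam t)).2 +
    (u t).2 *: lift_vec c X2 (ctg_coord c (lam t)).1 (ctg_coord c (lam t)).2).
Proof.
move=> ac tc At bt /(followsE A u lam t s1 s2) h.
have sF := frozen_smooth (u t) s1 s2.
have := lift_eq_change sF (atlas_chart_at _) ac bt At (dom_chart_at _) tc h.
by rewrite /lift_eq (lift_vec_frozen _ _ ac s1 s2 tc).
Qed.

Lemma in_chart_follows A u lam t c : atlas c -> dom c (lam t).1 -> A t ->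
  base_cvg A lam t -> 
  has_derivative_within A (ctg_coord c \o lam) t
   ((u t).1 *: lift_vec c X1 (ctg_coord c (lam t)).1 (ctg_coord c (lam t)).2 +
    (u t).2 *: lift_vec c X2 (ctg_coord c (lam t)).1 (ctg_coord c (lam t)).2) ->
  follows X1 X2 A u lam t.
Proof.
move=> ac tc At bt h.
have sF := frozen_smooth (u t) s1 s2.
apply/(followsE A u lam t s1 s2).
apply: (lift_eq_change sF ac (atlas_chart_at _) bt At tc (dom_chart_at _)).
by rewrite /lift_eq (lift_vec_frozen _ _ ac s1 s2 tc).
Qed.

Lemma follows_sub A B u lam t : B `<=` A ->
  follows X1 X2 A u lam t -> follows X1 X2 B u lam t.
Proof. exact: hdw_sub. Qed.

Lemma follows_hfun A u lam t Y : smooth_field Y -> A t -> base_cvg A lam t ->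
  follows X1 X2 A u lam t ->
  has_derivative_within A (hfun Y \o lam) t
    ((u t).1 * hfun (lie_bracket X1 Y) (lam t) +
     (u t).2 * hfun (lie_bracket X2 Y) (lam t)).
Proof.
move=> sY At bt /(followsE A u lam t s1 s2) h.
have := hfun_lift_derivative (frozen_smooth (u t) s1 s2) sY bt At h.
have <- : hfun (lie_bracket (frozen X1 X2 (u t)) Y) (lam t) =
    (u t).1 * hfun (lie_bracket X1 Y) (lam t) +
    (u t).2 * hfun (lie_bracket X2 Y) (lam t).
  apply: etrans (congr1 (dotp (lam t).2)
    (lie_bracket_comb (u t).1 (u t).2 (lam t).1 s1 s2 sY)) _.
  apply: etrans (dotp_Dr _ _ _) _.
  exact: (congr2 +%R (dotp_Zr _ _ _) (dotp_Zr _ _ _)).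
by [].
Qed.

Lemma follows_velocity A u lam t : follows X1 X2 A u lam t ->
  has_derivative_within A (fun s => fwd (chart_at (lam t).1) (lam s).1) t
    ((u t).1 *: X1 (lam t).1 + (u t).2 *: X2 (lam t).1).
Proof.
move=> /(followsE A u lam t s1 s2) /lift_eqP[+ _].
by rewrite field_coord_at.
Qed.

(** When the controls are the same locally Lipschitz functions of the lifts, both lifts
    solve one autonomous equation in a chart around their common value. The normal
    and the regular extremals are covered by two choices of these functions. *)
Lemma lift_unique_forward (a b e : R) lam1 lam2 u1 u2 (U1 U2 : E * E -> R) :
  a < b -> 0 < e ->
  (forall t, a <= t <= b -> base_cvg `[a, b] lam1 t) ->
  (forall t, a <= t <= b -> base_cvg `[a, b] lam2 t) ->
  (forall t, a <= t <= b -> follows X1 X2 `[a, b] u1 lam1 t) ->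
  (forall t, a <= t <= b -> follows X1 X2 `[a, b] u2 lam2 t) ->
  lam1 a = lam2 a ->
  loclip U1 (ctg_coord (chart_at (lam1 a).1) (lam1 a)) ->
  loclip U2 (ctg_coord (chart_at (lam1 a).1) (lam1 a)) ->
  (forall t, a <= t <= b -> t < a + e -> dom (chart_at (lam1 a).1) (lam1 t).1 ->
    let z := ctg_coord (chart_at (lam1 a).1) (lam1 t) in u1 t = (U1 z, U2 z)) ->
  (forall t, a <= t <= b -> t < a + e -> dom (chart_at (lam1 a).1) (lam2 t).1 ->
    let z := ctg_coord (chart_at (lam1 a).1) (lam2 t) in u2 t = (U1 z, U2 z)) ->
  exists2 d, 0 < d & forall t, a <= t <= b -> t < a + d -> (lam1 t).1 = (lam2 t).1.
Proof.
move=> ab e0 b1 b2 f1 f2 l12 lU1 lU2 c1 c2.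
set c := chart_at (lam1 a).1 in lU1 lU2 c1 c2.
have ac : atlas c by exact: atlas_chart_at.
have qc : dom c (lam1 a).1 by exact: dom_chart_at.
have aab : a <= a <= b by rewrite lexx ltW.
have qc2 : dom c (lam2 a).1 by rewrite -l12.
have [e1 e10 H1] := near_dom (b1 a aab) (open_dom ac) qc.
have [e2 e20 H2] := near_dom (b2 a aab) (open_dom ac) qc2.
pose d := Num.min e (Num.min e1 e2).
have d0 : 0 < d by rewrite !lt_min e0 e10.
have de : d <= e by rewrite !ge_min lexx.
have de1 : d <= e1 by rewrite !ge_min lexx orbT.
have de2 : d <= e2 by rewrite !ge_min lexx !orbT.
pose b' := Num.min b (a + d / 2).
have b'b : b' <= b by rewrite ge_min lexx.
have d20 : 0 < d / 2 by rewrite divr_gt0.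
have ab' : a < b' by rewrite lt_min ab ltrDl.
have b'd : b' < a + d.
  by rewrite gt_min; apply/orP; right; rewrite ltrD2l; lra.
have inab t : a <= t <= b' -> a <= t <= b.
  by move=> /andP[-> /le_trans]; apply.
have inI t : a <= t <= b' -> `[a, b]%classic t.
  by move=> /inab tab; rewrite /= in_itv.
have td t : a <= t <= b' -> `|t - a| < d.
  move=> /andP[at_ tb]; rewrite ger0_norm ?subr_ge0// ltrBlDl.
  exact: le_lt_trans tb b'd.
have D1 t : a <= t <= b' -> dom c (lam1 t).1.
  by move=> tab'; apply: H1 (inI t tab') (lt_le_trans (td t tab') de1).
have D2 t : a <= t <= b' -> dom c (lam2 t).1.
  by move=> tab'; apply: H2 (inI t tab') (lt_le_trans (td t tab') de2).
have te t : a <= t <= b' -> t < a + e.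
  move=> /andP[_ tb]; apply: le_lt_trans tb _; apply: lt_le_trans b'd _.
  by rewrite lerD2l.
pose F (z : E * E) := U1 z *: lift_vec c X1 z.1 z.2 + U2 z *: lift_vec c X2 z.1 z.2.
have lF : loclip F (ctg_coord c (lam1 a)).
  apply: loclipD; apply: loclip_scale => //; exact: (loclip_lift_vec ac _ qc).
have G1 t : a <= t <= b' ->
    has_derivative_within `[a, b'] (ctg_coord c \o lam1) t (F ((ctg_coord c \o lam1) t)).
  move=> tab'; have := follows_in_chart ac (D1 t tab') (inI t tab')
      (b1 t (inab t tab')) (f1 t (inab t tab')).
  rewrite (c1 t (inab t tab') (te t tab') (D1 t tab')).
  exact: hdw_sub (subitv (lexx a) b'b).
have G2 t : a <= t <= b' ->
    has_derivative_within `[a, b'] (ctg_coord c \o lam2) t (F ((ctg_coord c \o lam2) t)).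
  move=> tab'; have := follows_in_chart ac (D2 t tab') (inI t tab')
      (b2 t (inab t tab')) (f2 t (inab t tab')).
  rewrite (c2 t (inab t tab') (te t tab') (D2 t tab')).
  exact: hdw_sub (subitv (lexx a) b'b).
have [d' d'0 Hd'] := flow_unique ab' lF (congr1 (ctg_coord c) l12) G1 G2.
exists (Num.min d' (d / 2)); first by rewrite lt_min d'0.
move=> t /andP[at_ tb]; rewrite -ltrBlDl lt_min !ltrBlDl => /andP[t1 t2].
have tab' : a <= t <= b' by rewrite at_ le_min tb ltW.
have /(congr1 (fun z => bwd c z.1)) := Hd' t tab' t1.
by rewrite /= (bwdK ac (D1 t tab')) (bwdK ac (D2 t tab')).
Qed.

End Unique.

(** * Uniqueness of lifts over a given curve *)

Section Unique.
Context {R : realType} {n : nat} {M : manifold R n}.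
Implicit Types (c : chart R M n) (q : M) (X Y : M -> 'rV[R]_n) (l : cotangent M)
  (lam : R -> cotangent M) (A : set R).
Local Notation E := 'rV[R]_n.
Local Notation e_ i := (@basis_vec R n i).
Local Notation mu := (@lebesgue_measure R).

Lemma dotp_le (p v : E) : `|dotp p v| <= n%:R * (`|p| * `|v|).
Proof.
have co (w : E) i : `|w 0 i| <= `|w|.
  by have /(rV_norm_leP _ (normr_ge0 _))/(_ i) := lexx `|w|.
apply: le_trans (ler_norm_sum _ _ _) _.
apply: le_trans (_ : \sum_(i < n) `|p| * `|v| <= _).
  by apply: ler_sum => i _; rewrite normrM; apply: ler_pM.
by rewrite sumr_const card_ord mulr_natl.
Qed.

Variables (X1 X2 : M -> 'rV[R]_n).
Hypotheses (s1 : smooth_field X1) (s2 : smooth_field X2).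

Lemma bounded_coefficients (a b t0 : R) lam u c : atlas c -> dom c (lam t0).1 ->
  a <= t0 <= b -> base_cvg `[a, b] lam t0 ->
  (fun s => fwd c (lam s).1) @ within `[a, b] (nbhs t0) --> fwd c (lam t0).1 ->
  (fun s => (u s).1) @ within `[a, b] (nbhs t0) --> (u t0 : R * R).1 ->
  (fun s => (u s).2) @ within `[a, b] (nbhs t0) --> (u t0).2 ->
  exists K d, [/\ 0 <= K, 0 < d & forall t, a <= t <= b -> `|t - t0| < d ->
    dom c (lam t).1 /\ forall j,
    `|'D_(e_ j) (field_coord c (frozen X1 X2 (u t))) (fwd c (lam t).1)| <= K].
Proof.
move=> ac qc t0ab bt /within_cvgP cx /within_cvgP cu1 /within_cvgP cu2.
have [r1 r10 H1] := near_dom bt (open_dom ac) qc.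
have bX X : smooth_field X -> exists r K, [/\ 0 < r, 0 <= K &
    forall j y, `|y - fwd c (lam t0).1| < r ->
     `|'D_(e_ j) (field_coord c X) y| <= K].
  move=> sX.
  pose m (j : 'I_n) := `|'D_(e_ j) (field_coord c X) (fwd c (lam t0).1)| + 1.
  have [d d0 Hd] : exists2 d, 0 < d & forall i y, `|y - fwd c (lam t0).1| < d ->
      `|'D_(e_ i) (field_coord c X) y| <= m i.
    apply: uniform_radius.
      move=> i; have Ci := Ck_partial i (smooth_field_Ck 2 sX ac).
      have [d d0 Hd] := continuous_ball_norm (Ck_continuous Ci (in_codom qc)) ltr01.
      exists d => // y /Hd h; rewrite /m -lerBlDl.
      by apply: le_trans (lerB_dist _ _) _; exact: ltW.
    move=> i d d' _ d'd H y yd; apply: H; exact: lt_le_trans d'd.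
  exists d, (\sum_j m j); split=> //.
    by apply: sumr_ge0 => j _; rewrite addr_ge0.
  move=> j y yd; apply: le_trans (Hd j y yd) _.
  by rewrite (bigD1 j)//= lerDl; apply: sumr_ge0 => i _; rewrite addr_ge0.
have [ra [Ka [ra0 Ka0 Ha]]] := bX _ s1.
have [rb [Kb [rb0 Kb0 Hb]]] := bX _ s2.
have rab0 : 0 < Num.min ra rb by rewrite lt_min ra0.
have [r2 r20 H2] := cx _ rab0.
have [r3 r30 H3] := cu1 _ ltr01.
have [r4 r40 H4] := cu2 _ ltr01.
exists ((`|(u t0).1| + 1) * Ka + (`|(u t0).2| + 1) * Kb).
exists (Num.min (Num.min r1 r2) (Num.min r3 r4)); split.
- by rewrite addr_ge0// mulr_ge0// addr_ge0.
- by rewrite !lt_min r10 r20 r30.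
move=> t tab; rewrite !lt_min => /andP[/andP[t1 t2] /andP[t3 t4]].
have tI : `[a, b]%classic t by rewrite /= in_itv.
have tc := H1 t tI t1; split=> // j.
have := H2 t tI t2; rewrite lt_min => /andP[xa xb].
have e := derive_field_comb (u t).1 (u t).2 (e_ j) ac s1 s2 tc.
have -> : `|'D_(e_ j) (field_coord c (frozen X1 X2 (u t))) (fwd c (lam t).1)| =
  `|(u t).1 *: 'D_(e_ j) (field_coord c X1) (fwd c (lam t).1) +
    (u t).2 *: 'D_(e_ j) (field_coord c X2) (fwd c (lam t).1)|.
  exact: (congr1 (fun z : E => `|z|) e).
apply: le_trans (ler_normD _ _) _.
apply: lerD; rewrite [leLHS]normrZ; apply: ler_pM => //.
- rewrite -lerBlDl; apply: le_trans (lerB_dist _ _) _; exact: ltW (H3 t tI t3).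
- exact: Ha.
- rewrite -lerBlDl; apply: le_trans (lerB_dist _ _) _; exact: ltW (H4 t tI t4).
- exact: Hb.
Qed.

(** Over a fixed curve the lift equation is linear in the covector, with continuous
    coefficients, so the difference of two lifts vanishes everywhere or nowhere. *)
Lemma lift_linear_unique (a b : R) lam1 lam2 u :
  (forall t, a <= t <= b -> base_cvg `[a, b] lam1 t) ->
  (forall t, a <= t <= b -> (lam1 t).1 = (lam2 t).1) ->
  (forall t, a <= t <= b -> follows X1 X2 `[a, b] u lam1 t) ->
  (forall t, a <= t <= b -> follows X1 X2 `[a, b] u lam2 t) ->
  (forall t, a <= t <= b ->
     (fun s => (u s).1) @ within `[a, b] (nbhs t) --> (u t).1) ->
  (forall t, a <= t <= b ->
     (fun s => (u s).2) @ within `[a, b] (nbhs t) --> (u t).2) ->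
  forall s r, a <= s <= b -> a <= r <= b -> lam1 s = lam2 s -> lam1 r = lam2 r.
Proof.
move=> b1 b12 f1 f2 cu1 cu2.
suff Loc t : a <= t <= b -> exists2 d, 0 < d &
    forall s r, a <= s <= b -> a <= r <= b ->
      `|s - t| < d -> `|r - t| < d -> lam1 s = lam2 s -> lam1 r = lam2 r.
  have H s r : s <= r -> a <= s <= b -> a <= r <= b ->
      lam1 s = lam2 s <-> lam1 r = lam2 r.
    move=> sr /andP[as_ sb] /andP[ar rb].
    apply: (@interval_propagate R s r (fun t => lam1 t = lam2 t)) => // t /andP[st tr].
    have [|d d0 Hd] := Loc t; first by rewrite (le_trans as_ st) (le_trans tr rb).
    exists d => // x y /andP[sx xr] /andP[sy yr]; apply: Hd.
      by rewrite (le_trans as_ sx) (le_trans xr rb).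
    by rewrite (le_trans as_ sy) (le_trans yr rb).
  move=> s r sab rab; have [sr|/ltW rs] := leP s r.
    by have [] := H s r sr sab rab.
  by have [] := H r s rs rab sab.
move=> tab; set c := chart_at (lam1 t).1.
have ac : atlas c by exact: atlas_chart_at.
have qc : dom c (lam1 t).1 by exact: dom_chart_at.
have inI s : a <= s <= b -> `[a, b]%classic s by rewrite /= in_itv.
have b2 s : a <= s <= b -> base_cvg `[a, b] lam2 s.
  move=> sab; have := b1 s sab; rewrite /base_cvg -(b12 s sab).
  apply: cvg_trans; apply: near_eq_cvg; rewrite near_withinE; near=> y => yab.
  by rewrite /= b12//; move: yab; rewrite /= in_itv.
have cx : (fun s => fwd c (lam1 s).1) @ within `[a, b] (nbhs t) --> fwd c (lam1 t).1.
  have [hx _] := (lift_eqP _ _ _ _ _).1 ((followsE _ _ _ _ s1 s2).1 (f1 t tab)).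
  exact: hdw_cvg hx.
have [K [d [K0 d0 HK]]] := bounded_coefficients ac qc tab (b1 t tab) cx
  (cu1 t tab) (cu2 t tab).
pose L := n%:R * K.
have L0 : 0 <= L by rewrite mulr_ge0.
(* [a', b'] below has length at most e, and L * e <= 1/2 *)
pose e := Num.min d (4 * (L + 1))^-1.
have L1 : 0 < 4 * (L + 1) by rewrite mulr_gt0// ltr_wpDl.
have e0 : 0 < e by rewrite lt_min d0 invr_gt0.
exists (e / 2); first by rewrite divr_gt0.
move=> s r sab rab st rt l12.
pose a' := Num.max a (t - e / 2); pose b' := Num.min b (t + e / 2).
have a'a : a <= a' by rewrite le_max lexx.
have b'b : b' <= b by rewrite ge_min lexx.
have ta' : t - e / 2 <= a' by rewrite le_max lexx orbT.
have tb' : b' <= t + e / 2 by rewrite ge_min lexx orbT.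
have inab x : a' <= x <= b' -> a <= x <= b.
  by move=> /andP[ax xb]; rewrite (le_trans a'a ax) (le_trans xb b'b).
have inn x : a <= x <= b -> `|x - t| < e / 2 -> a' <= x <= b'.
  move=> /andP[ax xb]; rewrite ltr_norml => /andP[h1 h2].
  by rewrite ge_max ax le_min xb /=; apply/andP; split; lra.
have ind x : a' <= x <= b' -> `|x - t| < d.
  move=> /andP[ax xb]; apply: lt_le_trans (_ : e <= d); last by rewrite ge_min lexx.
  by rewrite ltr_norml; apply/andP; split; lra.
have dc x : a' <= x <= b' -> dom c (lam1 x).1.
  by move=> xab'; have [] := HK x (inab x xab') (ind x xab').
have dc2 x : a' <= x <= b' -> dom c (lam2 x).1.
  by move=> xab'; rewrite -b12 ?inab//; exact: dc.
pose w x := momentum c (lam1 x) - momentum c (lam2 x).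
pose G x j := 'D_(e_ j) (field_coord c (frozen X1 X2 (u x))) (fwd c (lam1 x).1).
pose w' x : E := - \row_j dotp (w x) (G x j).
have dw x : a' <= x <= b' -> has_derivative_within `[a', b'] w x (w' x).
  move=> xab'; have xab := inab x xab'.
  have sF := frozen_smooth (u x) s1 s2.
  have h1 := (followsE _ _ _ _ s1 s2).1 (f1 x xab).
  have h2 := (followsE _ _ _ _ s1 s2).1 (f2 x xab).
  have /lift_eqP[_ g1] := lift_eq_change sF (atlas_chart_at _) ac (b1 x xab)
    (inI x xab) (dom_chart_at _) (dc x xab') h1.
  have /lift_eqP[_ g2] := lift_eq_change sF (atlas_chart_at _) ac (b2 x xab)
    (inI x xab) (dom_chart_at _) (dc2 x xab') h2.
  rewrite -(b12 x xab) in g2.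
  have := hdwD (hdw_sub (subitv a'a b'b) g1)
     (hdwZ (c := -1) (hdw_sub (subitv a'a b'b) g2)).
  have -> : w' x = - (\row_j dotp (momentum c (lam1 x)) (G x j)) +
     -1 *: - (\row_j dotp (momentum c (lam2 x)) (G x j)).
    rewrite scaleN1r -opprD; congr (- _); apply/rowP => j.
    rewrite [LHS]mxE [RHS]mxE [X in X + _]mxE [X in _ + X]mxE [X in - X]mxE.
    by rewrite /w dotp_Dl dotp_Nl.
  apply: (hdw_local ltr01); first by rewrite scaleN1r.
  by move=> y ? _; rewrite scaleN1r; split.
have bw x : a' <= x <= b' -> `|w' x| <= L * `|w x|.
  move=> xab'; rewrite /w' normrN; apply/rV_norm_leP; first by rewrite mulr_ge0.
  move=> j; rewrite mxE; apply: le_trans (dotp_le _ _) _.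
  rewrite /L -mulrA ler_wpM2l// mulrC ler_wpM2r//.
  by have [_] := HK x (inab x xab') (ind x xab'); exact.
have Le : L * (b' - a') <= 2^-1.
  have h1 : b' - a' <= e by lra.
  apply: le_trans (ler_wpM2l L0 h1) _.
  have : e <= (4 * (L + 1))^-1 by rewrite ge_min lexx orbT.
  rewrite -[leRHS]mul1r ler_pdivlMr// => h2.
  have h3 : 0 <= e by exact: ltW.
  lra.
have sab' := inn s sab st; have rab' := inn r rab rt.
have ws : w s = 0 by rewrite /w l12 subrr.
have wr := gronwall_local L0 Le dw bw sab' ws rab'.
apply: (ctg_inj ac (dc r rab') (b12 r rab)).
by apply/eqP; rewrite -subr_eq0; apply/eqP.
Unshelve. all: by end_near. Qed.

End Unique.

(** * Abnormal lifts along continuous controls *)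

Section Abnormal.
Context {R : realType} {n : nat} {M : manifold R n}.
Implicit Types (c : chart R M n) (q : M) (X Y : M -> 'rV[R]_n) (l : cotangent M)
  (lam : R -> cotangent M) (A : set R) (gamma : R -> M).
Local Notation E := 'rV[R]_n.
Local Notation e_ i := (@basis_vec R n i).
Local Notation mu := (@lebesgue_measure R).

Lemma ac_cvg (W : normedModType R) (a b t : R) (f : R -> W) :
  abs_continuous a b f -> a <= t <= b -> f @ within `[a, b] (nbhs t) --> f t.
Proof.
move=> acf /andP[at_ tb]; apply/within_cvgP => e e0.
have [d d0 Hd] := acf e e0; exists d => // s; rewrite /= in_itv /= => /andP[as_ sb] st.
have [st'|ts'] := leP s t.
  have := Hd 1%N (fun=> (s, t)).
  rewrite !big_ord1 /= distrC; apply.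
  - by move=> _; split.
  - by move=> i j _ _ _; rewrite !ord1.
  - by rewrite distrC ger0_norm ?subr_ge0// in st.
have := Hd 1%N (fun=> (t, s)).
rewrite !big_ord1 /=; apply.
- by move=> _; split=> //; exact: ltW.
- by move=> i j _ _ _; rewrite !ord1.
- by rewrite ger0_norm ?subr_ge0// ltW in st.
Qed.

Definition independent X1 X2 := forall q (a b a' b' : R),
  a *: X1 q + b *: X2 q = a' *: X1 q + b' *: X2 q -> a = a' /\ b = b'.

Definition control_cvg A (u : R -> R * R) t :=
  (fun s => (u s).1) @ within A (nbhs t) --> (u t).1 /\
  (fun s => (u s).2) @ within A (nbhs t) --> (u t).2.

Variables (X1 X2 : M -> 'rV[R]_n).
Hypotheses (s1 : smooth_field X1) (s2 : smooth_field X2).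

(** The velocity of the base curve determines the control, since the frame is
    linearly independent. *)
Lemma control_unique (a b t : R) lam1 lam2 u1 u2 :
  independent X1 X2 -> a < b -> a <= t <= b ->
  (forall s, a <= s <= b -> (lam1 s).1 = (lam2 s).1) ->
  follows X1 X2 `[a, b] u1 lam1 t -> follows X1 X2 `[a, b] u2 lam2 t ->
  u1 t = u2 t.
Proof.
move=> ind ab tab b12 /(follows_velocity s1 s2) h1 /(follows_velocity s1 s2) h2.
have h2' : has_derivative_within `[a, b]
    (fun s => fwd (chart_at (lam1 t).1) (lam1 s).1) t
    ((u2 t).1 *: X1 (lam1 t).1 + (u2 t).2 *: X2 (lam1 t).1).
  rewrite (b12 t tab); apply: (hdw_local ltr01) h2; first by rewrite b12.
  by move=> s; rewrite /= in_itv /= => sab _; rewrite b12.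
have [] := ind _ _ _ _ _ (hdw_unique (non_isolated_itv ab tab) h1 h2').
by case: (u1 t) (u2 t) => [? ?] [? ?] /= -> ->.
Qed.

(** The lift equation read in the chart [c]. *)
Definition rhs c (u : R -> R * R) lam t : E * E :=
  (u t).1 *: lift_vec c X1 (ctg_coord c (lam t)).1 (ctg_coord c (lam t)).2 +
  (u t).2 *: lift_vec c X2 (ctg_coord c (lam t)).1 (ctg_coord c (lam t)).2.

Lemma rhs_cvg A c u lam t : atlas c -> dom c (lam t).1 -> control_cvg A u t ->
  (ctg_coord c \o lam) @ within A (nbhs t) --> ctg_coord c (lam t) ->
  rhs c u lam @ within A (nbhs t) --> rhs c u lam t.
Proof.
move=> ac tc [c1 c2] cz.
have h X : smooth_field X ->
    (fun s => lift_vec c X (ctg_coord c (lam s)).1 (ctg_coord c (lam s)).2)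
      @ within A (nbhs t) -->
    lift_vec c X (ctg_coord c (lam t)).1 (ctg_coord c (lam t)).2.
  move=> sX; have lF := loclip_lift_vec (z := ctg_coord c (lam t)) ac sX tc erefl.
  have := loclip_cvg (F := fun z => lift_vec c X z.1 z.2)
     (z := ctg_coord c \o lam) (A := A) (t := t) lF cz.
  exact.
exact: (cvgD (cvgZ c1 (h X1 s1)) (cvgZ c2 (h X2 s2))).
Qed.

(** The control [v] of an abnormal lift is only square integrable, but the velocity of
    the base curve forces [v = u] almost everywhere; the right-hand side of the lift
    equation is then continuous, and the lift is differentiable everywhere. *)
Lemma ac_lift_follows (a b : R) lam u v :
  independent X1 X2 -> a < b -> ac_ctg_curve a b lam ->
  (forall t, a <= t <= b -> control_cvg `[a, b] u t) ->
  {ae mu, forall t, t \in `[a, b] -> follows X1 X2 `[a, b] v lam t} ->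
  (forall t, a <= t <= b -> has_derivative_within `[a, b]
     (fun s => fwd (chart_at (lam t).1) (lam s).1) t
     ((u t).1 *: X1 (lam t).1 + (u t).2 *: X2 (lam t).1)) ->
  forall t, a <= t <= b -> follows X1 X2 `[a, b] u lam t.
Proof.
move=> ind ab [/base_cvgP cb acl] cu fv vel t0 t0ab.
set c := chart_at (lam t0).1.
have ac : atlas c by exact: atlas_chart_at.
have qc : dom c (lam t0).1 by exact: dom_chart_at.
have [d d0 Hd] := near_dom (cb t0 t0ab) (open_dom ac) qc.
pose a' := Num.max a (t0 - d / 2); pose b' := Num.min b (t0 + d / 2).
have d20 : 0 < d / 2 by rewrite divr_gt0.
have a'a : a <= a' by rewrite le_max lexx.
have b'b : b' <= b by rewrite ge_min lexx.
have ta' : t0 - d / 2 <= a' by rewrite le_max lexx orbT.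
have tb' : b' <= t0 + d / 2 by rewrite ge_min lexx orbT.
have inn x : a <= x <= b -> `|x - t0| < d / 2 -> a' <= x <= b'.
  move=> /andP[ax xb]; rewrite ltr_norml => /andP[h1 h2].
  by rewrite ge_max ax le_min xb /=; apply/andP; split; lra.
have t0ab' : a' <= t0 <= b' by apply: inn => //; rewrite subrr normr0.
have ab' : a' < b'.
  rewrite gt_max !lt_min ab /=; case/andP: t0ab => at0 t0b.
  by apply/andP; split; [|apply/andP; split]; lra.
have inab x : a' <= x <= b' -> a <= x <= b.
  by move=> /andP[ax xb]; rewrite (le_trans a'a ax) (le_trans xb b'b).
have inI x : a <= x <= b -> `[a, b]%classic x by rewrite /= in_itv.
have dc x : a' <= x <= b' -> dom c (lam x).1.
  move=> xab'; apply: Hd; first exact/inI/inab.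
  by case/andP: xab' => h1 h2; rewrite ltr_norml; apply/andP; split; lra.
have acz : abs_continuous a' b' (ctg_coord c \o lam) by exact: acl.
apply: (in_chart_follows s1 s2 ac qc (inI _ t0ab) (cb t0 t0ab)).
have cz := ac_cvg acz t0ab'.
have cr : rhs c u lam @ within `[a', b'] (nbhs t0) --> rhs c u lam t0.
  have [c1 c2] := cu t0 t0ab.
  by apply: rhs_cvg => //; split; apply: (cvg_within_sub (subitv a'a b'b)).
have aez : {ae mu, forall t, t \in `[a', b'] ->
    has_derivative_within `[a', b'] (ctg_coord c \o lam) t (rhs c u lam t)}.
  apply: ae_impl fv => t ft tab'; have tab : a <= t <= b.
    by apply: inab; move: tab'; rewrite in_itv.
  have {ft} ft : follows X1 X2 `[a, b] v lam t by apply: ft; rewrite in_itv.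
  have uv : v t = u t.
    have [] := ind _ _ _ _ _ (hdw_unique (non_isolated_itv ab tab)
      (follows_velocity s1 s2 ft) (vel t tab)).
    by case: (u t) (v t) => [? ?] [? ?] /= -> ->.
  have tc : dom c (lam t).1 by apply: dc; move: tab'; rewrite in_itv.
  have := follows_in_chart s1 s2 ac tc (inI t tab) (cb t tab) ft.
  by rewrite uv; exact: hdw_sub (subitv a'a b'b).
have h := ac_derivative_continuous acz aez t0ab' cr.
apply: (hdw_local d20 erefl _ h) => s; rewrite /= in_itv /= => sab sd; split=> //.
by rewrite in_itv /=; exact: inn.
Qed.

Lemma follows_ac (b : R) lam u :
  (forall t, 0 <= t <= b -> base_cvg `[0, b] lam t) ->
  (forall t, 0 <= t <= b -> control_cvg `[0, b] u t) ->
  (forall t, 0 <= t <= b -> follows X1 X2 `[0, b] u lam t) ->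
  ac_ctg_curve 0 b lam.
Proof.
move=> cb cu fo; split; first exact/base_cvgP.
move=> c s t ac s0 st tb dc.
have inb r : s <= r <= t -> 0 <= r <= b.
  by move=> /andP[sr rt]; rewrite (le_trans s0 sr) (le_trans rt tb).
have h r : s <= r <= t ->
    has_derivative_within `[s, t] (ctg_coord c \o lam) r (rhs c u lam r).
  move=> rst; have rb := inb r rst.
  have rI : `[0, b]%classic r by rewrite /= in_itv.
  apply: (hdw_sub (subitv s0 tb)).
  exact (follows_in_chart s1 s2 ac (dc r rst) rI (cb r rb) (fo r rb)).
have cn : {within `[s, t], continuous (fun r => `|rhs c u lam r|)}.
  apply/within_itv_continuousP => r rst; apply: cvg_norm; apply: rhs_cvg => //.
  - exact: dc.
  - have [c1 c2] := cu r (inb r rst).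
    by split; apply: (cvg_within_sub (subitv s0 tb)).
  - exact: hdw_cvg (h r rst).
have [m mst Hm] := EVT_max (ltW st) cn.
apply: (@lipschitz_ac R _ s t `|rhs c u lam m|) => //.
by move=> x y xst yst; apply: (mean_value_abs h).
Qed.

(** A lift with continuous control is Lipschitz in charts, which provides the
    absolute continuity and integrability required of abnormal lifts. *)
Lemma follows_abnormal_lift (b : R) gamma lam u : 0 < b ->
  (forall t, 0 <= t <= b -> base_cvg `[0, b] lam t) ->
  (forall t, 0 <= t <= b -> control_cvg `[0, b] u t) ->
  (forall t, 0 <= t <= b -> follows X1 X2 `[0, b] u lam t) ->
  is_lift 0 b gamma lam ->
  (forall t, 0 <= t <= b ->
     [/\ (lam t).2 != 0, hfun X1 (lam t) = 0 & hfun X2 (lam t) = 0]) ->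
  abnormal_lift X1 X2 b gamma lam.
Proof.
move=> b0 cb cu fo il hl.
have acl := follows_ac cb cu fo.
have tI t : t \in `[0, b] -> 0 <= t <= b by rewrite in_itv.
exists u; last first.
  by split=> //; apply: aeW => t /tI; exact: fo.
split.
- split.
    apply/within_itv_continuousP => t tb.
    have := cb t tb; rewrite /base_cvg (il t tb); apply: cvg_trans.
    apply: near_eq_cvg; rewrite near_withinE; near=> y => yb.
    by rewrite /= il//; move: yb; rewrite /= in_itv.
  move=> c s t ac s0 st tb dc.
  have inb r : s <= r <= t -> 0 <= r <= b.
    by move=> /andP[sr rt]; rewrite (le_trans s0 sr) (le_trans rt tb).
  have [_ H] := acl.
  have acz : abs_continuous s t (ctg_coord c \o lam).
    by apply: H => // r rst; rewrite il ?inb//; exact: dc.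
  move=> e e0; have [d d0 Hd] := acz e e0; exists d => // N I HI tI' lI.
  apply: le_lt_trans (Hd N I HI tI' lI); apply: ler_sum => i _.
  have [h1 h2 h3] := HI i.
  have r1 : s <= (I i).1 <= t by rewrite h1 (le_trans h2 h3).
  have r2 : s <= (I i).2 <= t by rewrite h3 (le_trans h1 h2).
  rewrite /= -(il _ (inb _ r1)) -(il _ (inb _ r2)).
  exact: (norm_fst (ctg_coord c (lam (I i).2)) (ctg_coord c (lam (I i).1))).
- have c1 : {within `[0, b], continuous (fun t => (u t).1)}.
    by apply/within_itv_continuousP => t tb; have [] := cu t tb.
  have c2 : {within `[0, b], continuous (fun t => (u t).2)}.
    by apply/within_itv_continuousP => t tb; have [] := cu t tb.
  split.
  + by apply: subspace_continuous_measurable_fun => //; exact: measurable_itv.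
  + by apply: subspace_continuous_measurable_fun => //; exact: measurable_itv.
  + apply: continuous_compact_integrable; first exact: segment_compact.
    have -> : (fun t => speed u t ^+ 2) =
        (fun t => (u t).1 * (u t).1 + (u t).2 * (u t).2).
      apply/funext => t; rewrite /speed sqr_sqrtr ?expr2//.
      by rewrite addr_ge0// -?expr2 sqr_ge0.
    apply/within_itv_continuousP => t tb; have [h1 h2] := cu t tb.
    by apply: cvgD; apply: cvgM.
- apply: aeW => t /tI tb; have := follows_velocity s1 s2 (fo t tb).
  rewrite (il t tb); apply: (hdw_local ltr01); first by rewrite /= il.
  move=> s; rewrite /= in_itv /= => sb _; split=> //.
  by rewrite il.
Unshelve. all: by end_near. Qed.

End Abnormal.

(** * Normal, annihilating and regular lifts *)

Section Final.
Context {R : realType} {n : nat} {M : manifold R n}.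
Implicit Types (c : chart R M n) (q : M) (X Y : M -> 'rV[R]_n) (l : cotangent M)
  (lam : R -> cotangent M) (A : set R) (gamma : R -> M).
Local Notation E := 'rV[R]_n.
Local Notation e_ i := (@basis_vec R n i).

Lemma lie_bracketC X Y q : lie_bracket X Y q = - lie_bracket Y X q.
Proof. by rewrite /lie_bracket opprB. Qed.

Lemma lie_bracketxx X q : lie_bracket X X q = 0.
Proof. by rewrite /lie_bracket subrr. Qed.

Variables (X1 X2 : M -> 'rV[R]_n).
Hypotheses (s1 : smooth_field X1) (s2 : smooth_field X2) (ind : independent X1 X2).

Local Notation X12 := (lie_bracket X1 X2).
Local Notation X112 := (lie_bracket X1 X12).
Local Notation X212 := (lie_bracket X2 X12).

Let s12 : smooth_field X12. Proof. exact: lie_bracket_smooth. Qed.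
Let s112 : smooth_field X112. Proof. exact: lie_bracket_smooth. Qed.
Let s212 : smooth_field X212. Proof. exact: lie_bracket_smooth. Qed.

(** Fibrewise linear combination; meaningful when both lifts have the same base. *)
Definition lift_comb (a b : R) lam1 lam2 : R -> cotangent M :=
  fun t => ((lam1 t).1, a *: (lam1 t).2 + b *: (lam2 t).2).

Lemma hfun_comb a b lam1 lam2 Y t : (lam1 t).1 = (lam2 t).1 ->
  hfun Y (lift_comb a b lam1 lam2 t) = a * hfun Y (lam1 t) + b * hfun Y (lam2 t).
Proof. by move=> e; rewrite !hfunE /lift_comb /= dotp_Dl !dotp_Zl e. Qed.

(** Lifts of the same curve with the same control are closed under fibrewise linear
    combinations, which is how normal and abnormal lifts are compared. *)
Definition lifts b gamma u lam :=
  [/\ forall t, 0 <= t <= b -> (lam t).1 = gamma t,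
      forall t, 0 <= t <= b -> base_cvg `[0, b] lam t &
      forall t, 0 <= t <= b -> follows X1 X2 `[0, b] u lam t].

Lemma lifts_comb b gamma u lam1 lam2 a1 a2 :
  lifts b gamma u lam1 -> lifts b gamma u lam2 ->
  lifts b gamma u (lift_comb a1 a2 lam1 lam2).
Proof.
move=> [g1 b1 f1] [g2 b2 f2]; split=> t tb; [exact: g1|exact: b1|].
have g12 s : 0 <= s <= b -> (lam1 s).1 = (lam2 s).1 by move=> sb; rewrite g1// g2.
have [x1 p1] := (lift_eqP _ _ _ _ _).1 ((followsE _ _ _ _ s1 s2).1 (f1 t tb)).
have [x2 p2] := (lift_eqP _ _ _ _ _).1 ((followsE _ _ _ _ s1 s2).1 (f2 t tb)).
apply/(followsE _ _ _ _ s1 s2)/lift_eqP; split; first exact: x1.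
rewrite -(g12 t tb) in p2.
set c := chart_at (lam1 t).1 in p1 p2 *.
have mE s : 0 <= s <= b -> momentum c (lift_comb a1 a2 lam1 lam2 s) =
    a1 *: momentum c (lam1 s) + a2 *: momentum c (lam2 s).
  by move=> sb; rewrite !momentumE /lift_comb /= mulmxDl -!scalemxAl (g12 s sb).
have h := hdwD (hdwZ (c := a1) p1) (hdwZ (c := a2) p2).
set F := fun j => 'D_(e_ j) (field_coord c (frozen X1 X2 (u t))) (fwd c (lam1 t).1).
have -> : - \row_j dotp (momentum c (lift_comb a1 a2 lam1 lam2 t)) (F j) =
   a1 *: - (\row_j dotp (momentum c (lam1 t)) (F j)) +
   a2 *: - (\row_j dotp (momentum c (lam2 t)) (F j)).
  rewrite (mE t tb) !scalerN -opprD; congr (- _); apply/rowP => j.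
  rewrite [RHS]comb_coord [LHS]mxE [X in _ = _ * X + _]mxE [X in _ = _ + _ * X]mxE.
  apply: etrans (dotp_Dl _ _ _) _.
  exact: (congr2 +%R (dotp_Zl _ _ _) (dotp_Zl _ _ _)).
apply: (hdw_local ltr01 _ _ h); first by rewrite mE.
by move=> s sb _; split=> //; rewrite mE//; move: sb; rewrite /= in_itv.
Qed.

Lemma lifts_sub b b' gamma u lam : b' <= b -> lifts b gamma u lam ->
  lifts b' gamma u lam.
Proof.
move=> bb [g cb f].
have inb t : 0 <= t <= b' -> 0 <= t <= b by move=> /andP[-> /le_trans]; apply.
split=> t tb.
- by apply: g; exact: inb.
- exact: base_cvg_sub (subitv (lexx 0) bb) (cb t (inb t tb)).
- exact: follows_sub (subitv (lexx 0) bb) (f t (inb t tb)).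
Qed.

Lemma lifts_ext b gamma u u' lam : (forall t, 0 <= t <= b -> u t = u' t) ->
  lifts b gamma u lam -> lifts b gamma u' lam.
Proof.
move=> e [g cb f]; split; [exact: g|exact: cb|].
by move=> t tb; rewrite /follows -(e t tb); exact: (f t tb).
Qed.

Lemma lifts_base b gamma gamma' u lam : (forall t, 0 <= t <= b -> gamma t = gamma' t) ->
  lifts b gamma u lam -> lifts b gamma' u lam.
Proof. by move=> e [g cb f]; split=> t tb; [rewrite g// e|exact: cb|exact: f]. Qed.

Lemma lifts_control b gamma u1 u2 lam1 lam2 : 0 < b ->
  lifts b gamma u1 lam1 -> lifts b gamma u2 lam2 ->
  forall t, 0 <= t <= b -> u1 t = u2 t.
Proof.
move=> b0 [g1 cb1 f1] [g2 cb2 f2] t tb.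
apply: (control_unique s1 s2 ind b0 tb _ (f1 t tb) (f2 t tb)) => s sb.
by rewrite g1// g2.
Qed.

Lemma lifts_hfun_derivative b gamma u lam Y t : smooth_field Y -> 0 <= t <= b ->
  lifts b gamma u lam ->
  has_derivative_within `[0, b] (hfun Y \o lam) t
    ((u t).1 * hfun (lie_bracket X1 Y) (lam t) +
     (u t).2 * hfun (lie_bracket X2 Y) (lam t)).
Proof.
move=> sY tb [g cb f]; have tI : `[0, b]%classic t by rewrite /= in_itv.
exact: (follows_hfun s1 s2 sY tI (cb t tb) (f t tb)).
Qed.

Lemma lifts_hfun_cvg b gamma u lam Y t : smooth_field Y -> 0 <= t <= b ->
  lifts b gamma u lam ->
  (hfun Y \o lam) @ within `[0, b] (nbhs t) --> hfun Y (lam t).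
Proof. by move=> sY tb L; exact: hdw_cvg (lifts_hfun_derivative sY tb L). Qed.

Definition momenta lam : R -> R * R := fun t => (hfun X1 (lam t), hfun X2 (lam t)).

Lemma momenta_cvg b gamma u lam t : 0 <= t <= b -> lifts b gamma u lam ->
  control_cvg `[0, b] (momenta lam) t.
Proof.
by move=> tb L; split; [exact: lifts_hfun_cvg s1 tb L|exact: lifts_hfun_cvg s2 tb L].
Qed.

Lemma normal_lifts b gamma lam : normal_lift X1 X2 b gamma lam ->
  lifts b gamma (momenta lam) lam.
Proof.
move=> [g [/base_cvgP cb f]]; split; [exact: g|exact: cb|move=> t tb].
by have := f t tb; rewrite (hamiltonian_sr _ s1 s2).
Qed.

Lemma lifts_unique b gamma u lam1 lam2 :
  (forall t, 0 <= t <= b -> control_cvg `[0, b] u t) ->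
  lifts b gamma u lam1 -> lifts b gamma u lam2 ->
  forall s r, 0 <= s <= b -> 0 <= r <= b -> lam1 s = lam2 s -> lam1 r = lam2 r.
Proof.
move=> cu [g1 cb1 f1] [g2 cb2 f2].
apply: (lift_linear_unique s1 s2 cb1 _ f1 f2) => t tb.
- by rewrite g1// g2.
- by have [] := cu t tb.
- by have [] := cu t tb.
Qed.

(** Together with [lifts], the condition satisfied by abnormal lifts and by the zero
    lift. *)
Definition annihilates b lam := forall t, 0 <= t <= b ->
  hfun X1 (lam t) = 0 /\ hfun X2 (lam t) = 0.

Lemma abnormal_of_lifts b gamma u lam : 0 < b ->
  (forall t, 0 <= t <= b -> control_cvg `[0, b] u t) ->
  lifts b gamma u lam -> annihilates b lam ->
  (forall t, 0 <= t <= b -> (lam t).2 != 0) -> abnormal_lift X1 X2 b gamma lam.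
Proof.
move=> b0 cu [g cb f] an nz; apply: (follows_abnormal_lift s1 s2 b0 cb cu f) => //.
by move=> t tb; have [] := an t tb; split=> //; exact: nz.
Qed.

Lemma lifts_of_abnormal b gamma u lam xi : 0 < b ->
  (forall t, 0 <= t <= b -> control_cvg `[0, b] u t) ->
  lifts b gamma u lam -> abnormal_lift X1 X2 b gamma xi ->
  lifts b gamma u xi /\ annihilates b xi.
Proof.
move=> b0 cu [g cb f] [v _ [acx gx hx fx]]; split; last first.
  by move=> t /hx[].
have [/base_cvgP cx _] := acx.
split; [exact: gx|exact: cx|].
apply: (ac_lift_follows s1 s2 ind b0 acx cu fx) => t tb.
have := follows_velocity s1 s2 (f t tb); rewrite (g t tb) (gx t tb).
apply: (hdw_local ltr01); first by rewrite g// gx.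
by move=> s; rewrite /= in_itv /= => sb _; split=> //; rewrite g// gx.
Qed.

(** A lift that vanishes at one time vanishes identically, by linear uniqueness; its
    initial covector is then the zero element of the space. *)
Lemma covector_of_lifts b gamma u xi : 0 < b ->
  (forall t, 0 <= t <= b -> control_cvg `[0, b] u t) ->
  lifts b gamma u xi -> annihilates b xi ->
  abnormal_covectors X1 X2 gamma b (xi 0).2.
Proof.
move=> b0 cu Lx ax.
have z0 : 0 <= (0 : R) <= b by rewrite lexx ltW.
have [[t tb xt0]|nz] := pselect (exists2 t, 0 <= t <= b & (xi t).2 = 0).
  left; pose z := lift_comb 0 0 xi xi.
  have Lz : lifts b gamma u z by exact: lifts_comb.
  have -> : xi 0 = z 0.
    apply: (lifts_unique cu Lx Lz tb z0).
    rewrite /z /lift_comb xt0 scaler0 addr0 -xt0.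
    by case: (xi t).
  by rewrite /z /lift_comb /= !scale0r addr0.
right; exists xi.
  apply: (abnormal_of_lifts b0 cu Lx ax) => t tb; apply/eqP => h.
  by apply: nz; exists t.
by have [g _ _] := Lx; rewrite -(g 0 z0); case: (xi 0).
Qed.

Lemma lifts_of_covector b gamma u lam v : 0 < b ->
  (forall t, 0 <= t <= b -> control_cvg `[0, b] u t) ->
  lifts b gamma u lam -> abnormal_covectors X1 X2 gamma b v ->
  exists2 xi, lifts b gamma u xi /\ annihilates b xi & xi 0 = (gamma 0, v).
Proof.
move=> b0 cu L [->|[xi ax xi0]]; last first.
  by exists xi; [exact: (lifts_of_abnormal b0 cu L ax)|exact: xi0].
exists (lift_comb 0 0 lam lam); first split.
- exact: lifts_comb.
- by move=> t tb; rewrite !hfun_comb// !mul0r addr0.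
- have [g _ _] := L; rewrite /lift_comb !scale0r addr0 g//.
  by rewrite lexx ltW.
Qed.

Lemma lifts_unique_forward tau b gamma gammab u ub lam lamb e (U1 U2 : E * E -> R) :
  0 < tau -> tau < b -> 0 < e ->
  lifts b gamma u lam -> lifts b gammab ub lamb -> lam tau = lamb tau ->
  loclip U1 (ctg_coord (chart_at (lam tau).1) (lam tau)) ->
  loclip U2 (ctg_coord (chart_at (lam tau).1) (lam tau)) ->
  (forall t, tau <= t <= b -> t < tau + e -> dom (chart_at (lam tau).1) (lam t).1 ->
    let z := ctg_coord (chart_at (lam tau).1) (lam t) in u t = (U1 z, U2 z)) ->
  (forall t, tau <= t <= b -> t < tau + e -> dom (chart_at (lam tau).1) (lamb t).1 ->
    let z := ctg_coord (chart_at (lam tau).1) (lamb t) in ub t = (U1 z, U2 z)) ->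
  exists2 d, 0 < d & forall t, tau <= t <= b -> t < tau + d -> gamma t = gammab t.
Proof.
move=> tau0 taub e0 [g cb f] [gb cbb fb] ll l1 l2 c1 c2.
have inb t : tau <= t <= b -> 0 <= t <= b.
  by move=> /andP[h ->]; rewrite (le_trans (ltW tau0) h).
have sb : `[tau, b] `<=` `[0, b] by apply: subitv; rewrite ?lexx// ltW.
have [d d0 Hd] := lift_unique_forward s1 s2 taub e0
  (fun t tb => base_cvg_sub sb (cb t (inb t tb)))
  (fun t tb => base_cvg_sub sb (cbb t (inb t tb)))
  (fun t tb => follows_sub sb (f t (inb t tb)))
  (fun t tb => follows_sub sb (fb t (inb t tb))) ll l1 l2 c1 c2.
exists d => // t tb td; rewrite -g ?inb// -gb ?inb//; exact: Hd.
Qed.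

(** Linear uniqueness over the common part transports the equality of the lifts from
    time [0] to time [tau]; beyond [tau] the normal flow is determined by its value
    there. *)
Lemma normal_unique_forward tau b gamma gammab u ub lam lamb :
  0 < tau -> tau < b ->
  lifts b gamma u lam -> lifts b gammab ub lamb ->
  (forall t, 0 <= t <= b -> u t = momenta lam t) ->
  (forall t, 0 <= t <= b -> ub t = momenta lamb t) ->
  (forall t, 0 <= t <= tau -> gamma t = gammab t) ->
  lam 0 = lamb 0 ->
  exists2 d, 0 < d & forall t, tau <= t <= b -> t < tau + d -> gamma t = gammab t.
Proof.
move=> tau0 taub L Lb uE ubE gE l0.
have inb t : tau <= t <= b -> 0 <= t <= b.
  by move=> /andP[h ->]; rewrite (le_trans (ltW tau0) h).
have intau t : 0 <= t <= tau -> 0 <= t <= b.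
  by move=> /andP[-> h]; rewrite (le_trans h (ltW taub)).
have Lt := lifts_sub (ltW taub) L.
have Lbt : lifts tau gamma ub lamb.
  by apply: lifts_base (lifts_sub (ltW taub) Lb) => t tt; rewrite gE.
have ut := lifts_control tau0 Lt Lbt.
have cu t : 0 <= t <= tau -> control_cvg `[0, tau] (momenta lam) t.
  by move=> tt; exact: momenta_cvg tt Lt.
have Lt' : lifts tau gamma (momenta lam) lam.
  by apply: lifts_ext Lt => t tt; rewrite uE// intau.
have Lbt' : lifts tau gamma (momenta lam) lamb.
  by apply: lifts_ext Lbt => t tt; rewrite -ut// uE// intau.
have ltau : lam tau = lamb tau.
  by apply: (lifts_unique cu Lt' Lbt' (s := 0)) => //; rewrite lexx ltW.
set c := chart_at (lam tau).1.
have ac : atlas c by exact: atlas_chart_at.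
have qc : dom c (lam tau).1 by exact: dom_chart_at.
apply: (lifts_unique_forward (e := 1) (U1 := hfun_coord c X1) (U2 := hfun_coord c X2)
  tau0 taub ltr01 L Lb ltau).
- exact: (loclip_hfun_coord (z := ctg_coord c (lam tau)) ac s1 qc erefl).
- exact: (loclip_hfun_coord (z := ctg_coord c (lam tau)) ac s2 qc erefl).
- by move=> t tb _ tc; rewrite /= uE ?inb// /momenta !(hfun_coordE _ ac tc).
- by move=> t tb _ tc; rewrite /= ubE ?inb// /momenta !(hfun_coordE _ ac tc).
Qed.

Definition Gnorm l : R := Num.sqrt (hfun X212 l ^+ 2 + hfun X112 l ^+ 2).
(** The control of the integral curves of [s] times [G_field], for [s = 1] or
    [s = -1]. *)
Definition Gcontrol (s : R) l : R * R :=
  (s * (- hfun X212 l / Gnorm l), s * (hfun X112 l / Gnorm l)).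

Lemma sum_squares_gt0 (a b : R) : ~ (a = 0 /\ b = 0) -> 0 < a ^+ 2 + b ^+ 2.
Proof.
move=> ab; rewrite lt_neqAle addr_ge0 ?sqr_ge0// andbT eq_sym.
by rewrite paddr_eq0 ?sqr_ge0// !sqrf_eq0; apply/negP => /andP[/eqP ? /eqP ?]; apply: ab.
Qed.

Lemma regular_sum_gt0 l : regular_set X1 X2 l ->
  0 < hfun X212 l ^+ 2 + hfun X112 l ^+ 2.
Proof.
move=> [[h1 h2 h12] n3]; apply: sum_squares_gt0 => -[h212 h112].
by apply: n3; split.
Qed.

Lemma Gnorm_gt0 l : regular_set X1 X2 l -> 0 < Gnorm l.
Proof. by move=> /regular_sum_gt0; rewrite sqrtr_gt0. Qed.

Lemma regular_neq0 l : regular_set X1 X2 l -> l.2 != 0.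
Proof.
move=> /regular_sum_gt0; apply: contraTneq => l0.
have h0 Y Z : hfun Y l ^+ 2 + hfun Z l ^+ 2 = 0.
  by rewrite !hfunE l0 !dotp0l expr0n /= addr0.
by have -> := h0 X212 X112; rewrite ltxx.
Qed.

Lemma Gcontrol_unit s l : regular_set X1 X2 l -> s * s = 1 ->
  (Gcontrol s l).1 ^+ 2 + (Gcontrol s l).2 ^+ 2 = 1.
Proof.
move=> rl ss; have N0 := Gnorm_gt0 rl.
have NN : Gnorm l ^+ 2 = hfun X212 l ^+ 2 + hfun X112 l ^+ 2.
  by rewrite sqr_sqrtr// ltW// regular_sum_gt0.
rewrite /Gcontrol /= !exprMn expr2 ss !mul1r sqrrN -mulrDl -NN exprVn.
by rewrite mulfV// expf_neq0// gt_eqF.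
Qed.

Lemma regular_lifts b gamma lam : regular_abnormal_lift X1 X2 b gamma lam ->
  exists2 s, s * s = 1 & lifts b gamma (fun t => Gcontrol s (lam t)) lam.
Proof.
move=> [g rl [[/base_cvgP cb f]|[/base_cvgP cb f]]].
  exists 1; first by rewrite mulr1.
  split; [exact: g|exact: cb|move=> t tb].
  by rewrite /follows /Gcontrol /= !mul1r; exact: (f t tb).
exists (-1); first by rewrite mulrNN mulr1.
split; [exact: g|exact: cb|move=> t tb].
have neg (V : lmodType R) (x y : R) (v w : V) :
    (-1 * x) *: v + (-1 * y) *: w = - (x *: v + y *: w).
  by rewrite !mulN1r !scaleNr opprD.
by rewrite /follows /Gcontrol /= neg; exact: (f t tb).
Qed.

Lemma regular_annihilates b gamma lam : regular_abnormal_lift X1 X2 b gamma lam ->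
  annihilates b lam.
Proof. by move=> [_ rl _] t /rl [[]]. Qed.

Lemma inv_norm_cvg (f g : R -> R) A (t x y : R) :
  f @ within A (nbhs t) --> x -> g @ within A (nbhs t) --> y ->
  0 < x ^+ 2 + y ^+ 2 ->
  (fun r => (Num.sqrt (f r ^+ 2 + g r ^+ 2))^-1) @ within A (nbhs t) -->
    (Num.sqrt (x ^+ 2 + y ^+ 2))^-1.
Proof.
move=> cf cg xy0.
have cs : (fun r => f r ^+ 2 + g r ^+ 2) @ within A (nbhs t) --> x ^+ 2 + y ^+ 2.
  exact: (cvgD (cvgM cf cf) (cvgM cg cg)).
have cq : (fun r => Num.sqrt (f r ^+ 2 + g r ^+ 2)) @ within A (nbhs t) -->
    Num.sqrt (x ^+ 2 + y ^+ 2).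
  exact: (continuous_cvg (h := Num.sqrt) _ (@sqrt_continuous _ _) cs).
by apply: cvgV cq; rewrite gt_eqF// sqrtr_gt0.
Qed.

Lemma Gcontrol_cvg b gamma u lam s : lifts b gamma u lam ->
  (forall t, 0 <= t <= b -> regular_set X1 X2 (lam t)) ->
  forall t, 0 <= t <= b -> control_cvg `[0, b] (fun t => Gcontrol s (lam t)) t.
Proof.
move=> L rl t tb.
have c112 := lifts_hfun_cvg s112 tb L; have c212 := lifts_hfun_cvg s212 tb L.
have cI := inv_norm_cvg c212 c112 (regular_sum_gt0 (rl t tb)).
split.
- exact: (cvgM (cvg_cst s) (cvgM (cvgN c212) cI)).
- exact: (cvgM (cvg_cst s) (cvgM c112 cI)).
Qed.

(** Differentiating [hfun X1 = hfun X2 = 0] along the lift gives [hfun X12 = 0], as the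
    control never vanishes; differentiating again gives the second relation. *)
Lemma annihilating_h12 b gamma u lam : 0 < b -> lifts b gamma u lam ->
  annihilates b lam ->
  (forall t, 0 <= t <= b -> (u t).1 ^+ 2 + (u t).2 ^+ 2 = 1) ->
  forall t, 0 <= t <= b -> hfun X12 (lam t) = 0 /\
    (u t).1 * hfun X112 (lam t) + (u t).2 * hfun X212 (lam t) = 0.
Proof.
move=> b0 L an u1.
have zero Y (sY : smooth_field Y) t : (forall s, 0 <= s <= b -> hfun Y (lam s) = 0) ->
    0 <= t <= b -> (u t).1 * hfun (lie_bracket X1 Y) (lam t) +
     (u t).2 * hfun (lie_bracket X2 Y) (lam t) = 0.
  move=> Y0 tb; have h := lifts_hfun_derivative sY tb L.
  have h0 : has_derivative_within `[0, b] (hfun Y \o lam) t 0.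
    apply: (hdw_local ltr01 _ _ (hdw_cst `[0, b] (0 : R) t)); first by rewrite /= Y0.
    by move=> s sb _; split=> //; rewrite /= Y0//; move: sb; rewrite /= in_itv.
  exact: hdw_unique (non_isolated_itv b0 tb) h h0.
have solve (x y h h11 h22 h21 : R) : x ^+ 2 + y ^+ 2 = 1 -> h11 = 0 -> h22 = 0 ->
    h21 = - h -> x * h11 + y * h21 = 0 -> x * h + y * h22 = 0 -> h = 0.
  move=> xy -> -> ->; rewrite mulr0 add0r mulr0 addr0 => e1 e2.
  have -> : h = x * (x * h) - y * (y * - h).
    by rewrite !mulrN opprK !mulrA -!expr2 -mulrDl xy mul1r.
  by rewrite e1 e2 !mulr0 subr0.
have h12 t : 0 <= t <= b -> hfun X12 (lam t) = 0.
  move=> tb.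
  have e1 := zero _ s1 t (fun s sb => (an s sb).1) tb.
  have e2 := zero _ s2 t (fun s sb => (an s sb).2) tb.
  have hxx X : hfun (lie_bracket X X) (lam t) = 0.
    by rewrite hfunE lie_bracketxx /dotp big1// => i _; rewrite mxE mulr0.
  have h21 : hfun (lie_bracket X2 X1) (lam t) = - hfun X12 (lam t).
    exact: etrans (congr1 (dotp _) (lie_bracketC X2 X1 _)) (dotp_Nr _ _).
  exact: (solve _ _ _ _ _ _ (u1 t tb) (hxx X1) (hxx X2) h21 e1 e2).
by move=> t tb; split; [exact: h12|exact: (zero _ s12 t h12 tb)].
Qed.

End Final.

(** * Branching *)

Section Core.
Context {R : realType} {n : nat} {M : manifold R n}.
Implicit Types (c : chart R M n) (q : M) (X Y : M -> 'rV[R]_n) (l : cotangent M)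
  (lam : R -> cotangent M) (A : set R) (gamma : R -> M).
Local Notation E := 'rV[R]_n.

(** A unit vector orthogonal to [(p, q)] is determined by the sign of its pairing with
    [(- q, p)]. *)
Lemma unit_orthogonal (x y p q s : R) : x ^+ 2 + y ^+ 2 = 1 -> x * p + y * q = 0 ->
  s * s = 1 -> 0 < s * (- x * q + y * p) ->
  (x, y) = (s * (- q / Num.sqrt (q ^+ 2 + p ^+ 2)),
            s * (p / Num.sqrt (q ^+ 2 + p ^+ 2))).
Proof.
move=> xy pq ss m0; set m := s * _ in m0.
have mm : m ^+ 2 = q ^+ 2 + p ^+ 2.
  have -> : m ^+ 2 = (s * s) * ((x ^+ 2 + y ^+ 2) * (q ^+ 2 + p ^+ 2)
      - (x * p + y * q) ^+ 2) by rewrite /m; lra.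
  by rewrite ss xy pq expr0n /= subr0 !mul1r.
have -> : Num.sqrt (q ^+ 2 + p ^+ 2) = m by rewrite -mm sqrtr_sqr gtr0_norm.
have mn0 : m != 0 by rewrite gt_eqF.
have e1 : x * m = s * - q.
  have -> : x * m = s * (y * (x * p + y * q) - (x ^+ 2 + y ^+ 2) * q).
    by rewrite /m; lra.
  by rewrite xy pq mulr0 mul1r sub0r.
have e2 : y * m = s * p.
  have -> : y * m = s * ((x ^+ 2 + y ^+ 2) * p - x * (x * p + y * q)).
    by rewrite /m; lra.
  by rewrite xy pq mulr0 mul1r subr0.
congr (_, _).
  by rewrite mulrA -e1 mulfK.
by rewrite mulrA -e2 mulfK.
Qed.

Lemma unit_pairing (p q s : R) : s * s = 1 -> 0 < q ^+ 2 + p ^+ 2 ->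
  s * (- (s * (- q / Num.sqrt (q ^+ 2 + p ^+ 2))) * q
    + s * (p / Num.sqrt (q ^+ 2 + p ^+ 2)) * p) = Num.sqrt (q ^+ 2 + p ^+ 2).
Proof.
move=> ss r0; set m := Num.sqrt _.
have m0 : m != 0 by rewrite gt_eqF// sqrtr_gt0.
have mm : m * m = q ^+ 2 + p ^+ 2 by rewrite -expr2 sqr_sqrtr ?ltW.
have -> : s * (- (s * (- q / m)) * q + s * (p / m) * p) =
    (s * s) * ((q ^+ 2 + p ^+ 2) / m) by lra.
by rewrite ss -mm mulfK// mul1r.
Qed.

Lemma loclip_unit_quotient (V : normedModType R) (f g h : V -> R) z (s : R) :
  loclip f z -> loclip g z -> loclip h z -> 0 < g z ^+ 2 + h z ^+ 2 ->
  loclip (fun y => s * (f y / Num.sqrt (g y ^+ 2 + h y ^+ 2))) z.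
Proof.
move=> lf lg lh gh0.
have l2 : loclip (fun y => g y ^+ 2 + h y ^+ 2) z.
  exact: loclipD (@loclip_scale _ _ R^o _ _ _ lg lg) (@loclip_scale _ _ R^o _ _ _ lh lh).
have l3 := loclip_real_comp (phi := fun y => (Num.sqrt y)^-1) l2 (loclip_inv_sqrt gh0).
exact: (@loclip_scale _ _ R^o _ _ _ (loclip_cst s z) (@loclip_scale _ _ R^o _ _ _ lf l3)).
Qed.

Variables (X1 X2 : M -> 'rV[R]_n).
Hypotheses (s1 : smooth_field X1) (s2 : smooth_field X2) (ind : independent X1 X2).

Local Notation X12 := (lie_bracket X1 X2).
Local Notation X112 := (lie_bracket X1 X12).
Local Notation X212 := (lie_bracket X2 X12).

Let s12 : smooth_field X12. Proof. exact: lie_bracket_smooth. Qed.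
Let s112 : smooth_field X112. Proof. exact: lie_bracket_smooth. Qed.
Let s212 : smooth_field X212. Proof. exact: lie_bracket_smooth. Qed.

(** At [tau] the lift [xi] agrees with [nu], hence it stays regular for a while; being
    an abnormal lift along a unit control, it is there an integral curve of [s] times
    [G_field], exactly as [nu] is. *)
Lemma regular_unique_forward tau b gamma gammab u xi nu s :
  0 < tau -> tau < b -> s * s = 1 ->
  lifts X1 X2 b gamma u xi ->
  lifts X1 X2 b gammab (fun t => Gcontrol X1 X2 s (nu t)) nu ->
  annihilates X1 X2 b xi -> regular_set X1 X2 (nu tau) ->
  (forall t, 0 <= t <= b -> control_cvg `[0, b] u t) ->
  (forall t, 0 <= t <= b -> (u t).1 ^+ 2 + (u t).2 ^+ 2 = 1) ->
  xi tau = nu tau -> u tau = Gcontrol X1 X2 s (nu tau) ->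
  exists2 d, 0 < d & forall t, tau <= t <= b -> t < tau + d -> gamma t = gammab t.
Proof.
move=> tau0 taub ss Lx Ln ax rn cu u1 xn ut.
have b0 : 0 < b by exact: lt_trans taub.
have taub' : 0 <= tau <= b by rewrite !ltW.
have H := annihilating_h12 s1 s2 b0 Lx ax u1.
(* the sign of phi selects one of the two unit vectors orthogonal to
   (h112, h212); it is constant near tau by continuity *)
pose phi t := s * (- (u t).1 * hfun X212 (xi t) + (u t).2 * hfun X112 (xi t)).
have N0 := Gnorm_gt0 rn.
have phi0 : 0 < phi tau.
  have -> : phi tau = Gnorm X1 X2 (nu tau).
    by rewrite /phi ut xn; exact: unit_pairing ss (regular_sum_gt0 rn).
  exact: N0.
have cphi : phi @ within `[0, b] (nbhs tau) --> phi tau.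
  have [c1 c2] := cu tau taub'.
  have c112 := lifts_hfun_cvg s1 s2 s112 taub' Lx.
  have c212 := lifts_hfun_cvg s1 s2 s212 taub' Lx.
  exact: (cvgM (cvg_cst s) (cvgD (cvgM (cvgN c1) c212) (cvgM c2 c112))).
have [e e0 He] := (within_cvgP _ _ _ _).1 cphi _ phi0.
have uG t : tau <= t <= b -> t < tau + e -> u t = Gcontrol X1 X2 s (xi t).
  move=> /andP[taut tb] te.
  have tb' : 0 <= t <= b by rewrite tb andbT (le_trans (ltW tau0)).
  have tI : `[0, b]%classic t by rewrite /= in_itv.
  have td : `|t - tau| < e by rewrite ger0_norm ?subr_ge0// ltrBlDl.
  have near_pos (x y : R) : `|x - y| < y -> 0 < x.
    by rewrite ltr_norml ltrBrDl subrr => /andP[].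
  have phit := near_pos _ _ (He t tI td).
  have [_ pq] := H t tb'.
  have := unit_orthogonal (u1 t tb') pq ss phit.
  by rewrite -surjective_pairing.
set c := chart_at (xi tau).1.
have ac : atlas c by exact: atlas_chart_at.
have qc : dom c (xi tau).1 by exact: dom_chart_at.
pose q112 := hfun_coord c X112; pose q212 := hfun_coord c X212.
have l112 : loclip q112 (ctg_coord c (xi tau)).
  exact: (loclip_hfun_coord (z := ctg_coord c (xi tau)) ac s112 qc erefl).
have l212 : loclip q212 (ctg_coord c (xi tau)).
  exact: (loclip_hfun_coord (z := ctg_coord c (xi tau)) ac s212 qc erefl).
have r0gen Y Z : 0 < hfun Y (xi tau) ^+ 2 + hfun Z (xi tau) ^+ 2 ->
    0 < hfun_coord c Y (ctg_coord c (xi tau)) ^+ 2 +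
        hfun_coord c Z (ctg_coord c (xi tau)) ^+ 2.
  by rewrite !(hfun_coordE _ ac qc).
have r0 : 0 < q212 (ctg_coord c (xi tau)) ^+ 2 + q112 (ctg_coord c (xi tau)) ^+ 2.
  by apply: r0gen; rewrite xn; exact: regular_sum_gt0 rn.
have GEgen Y Z l : dom c l.1 ->
    (s * (- hfun Y l / Num.sqrt (hfun Y l ^+ 2 + hfun Z l ^+ 2)),
     s * (hfun Z l / Num.sqrt (hfun Y l ^+ 2 + hfun Z l ^+ 2))) =
    let f := hfun_coord c Y (ctg_coord c l) in
    let g := hfun_coord c Z (ctg_coord c l) in
    (s * (- f / Num.sqrt (f ^+ 2 + g ^+ 2)), s * (g / Num.sqrt (f ^+ 2 + g ^+ 2))).
  by move=> lc; rewrite !(hfun_coordE _ ac lc).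
have GE l : dom c l.1 -> Gcontrol X1 X2 s l =
    (s * (- q212 (ctg_coord c l) /
       Num.sqrt (q212 (ctg_coord c l) ^+ 2 + q112 (ctg_coord c l) ^+ 2)),
     s * (q112 (ctg_coord c l) /
       Num.sqrt (q212 (ctg_coord c l) ^+ 2 + q112 (ctg_coord c l) ^+ 2))).
  exact: (GEgen X212 X112 l).
apply: (lifts_unique_forward s1 s2 tau0 taub e0 Lx Ln xn
  (loclip_unit_quotient s (loclipN l212) l212 l112 r0)
  (loclip_unit_quotient s l112 l212 l112 r0)).
- by move=> t tb te tc; rewrite (uG t tb te); exact: GE.
- by move=> t tb te tc; exact: GE.
Qed.

Lemma one_dimensional_quotient (V W : {vspace E}) k (v w : E) : \dim V = k ->
  \dim W = k.+1 -> (V <= W)%VS -> v \in W -> w \in W ->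
  w \in V \/ exists a, v - a *: w \in V.
Proof.
move=> dV dW VW vW wW; have [wV|wV] := boolP (w \in V); [by left|right].
have VwW : (V + <[w]> <= W)%VS by rewrite subv_add VW -memvE.
have dVw : \dim (V + <[w]>) = k.+1.
  have w0 : w != 0 by apply: contraNneq wV => ->; rewrite mem0v.
  rewrite dimv_disjoint_sum ?dV ?dim_vline ?w0 ?addn1//.
  apply/eqP; rewrite -subv0; apply/subvP => x; rewrite memv_cap => /andP[xV].
  move=> /vlineP[a xa]; rewrite memv0; apply/negPn/negP => x0; case/negP: wV.
  have a0 : a != 0 by apply: contraNneq x0 => a0; rewrite xa a0 scale0r.
  by rewrite -[w](scalerK a0) -xa memvZ.
have eq : (V + <[w]>)%VS = W by apply/eqP; rewrite eqEdim VwW dVw dW leqnn.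
move: vW; rewrite -eq => /memv_addP[x xV [y /vlineP[a ->] ->]].
by exists a; rewrite addrK.
Qed.

(** Either [nu] on [[0, tau]] extends to an abnormal lift of [gamma], or a combination
    of [lamb] and [nu] starts at the initial covector of a normal lift of [gamma]. *)
Lemma no_regular_normal_branch tau b gamma gammab lam lamb nu s k (V W : {vspace E}) :
  0 < tau -> tau < b -> s * s = 1 ->
  lifts X1 X2 b gamma (momenta X1 X2 lam) lam ->
  lifts X1 X2 b gammab (momenta X1 X2 lamb) lamb ->
  lifts X1 X2 b gammab (fun t => Gcontrol X1 X2 s (nu t)) nu ->
  (forall t, 0 <= t <= b -> regular_set X1 X2 (nu t)) ->
  (forall t, 0 <= t <= b ->
     (momenta X1 X2 lam t).1 ^+ 2 + (momenta X1 X2 lam t).2 ^+ 2 = 1) ->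
  (forall t, 0 <= t <= tau -> gammab t = gamma t) ->
  [set v | v \in W] = abnormal_covectors X1 X2 gamma tau ->
  [set v | v \in V] = abnormal_covectors X1 X2 gamma b ->
  \dim W = k.+1 -> \dim V = k ->
  exists2 d, 0 < d & forall t, tau <= t <= b -> t < tau + d -> gamma t = gammab t.
Proof.
move=> tau0 taub ss L Lb Ln rn unit gE WE VE dW dV.
have b0 : 0 < b by exact: lt_trans taub.
have z0 : 0 <= (0 : R) <= tau by rewrite lexx ltW.
have z0b : 0 <= (0 : R) <= b by rewrite lexx ltW.
have tt : 0 <= tau <= tau by rewrite lexx ltW.
have intau t : 0 <= t <= tau -> 0 <= t <= b.
  by move=> /andP[-> h]; rewrite (le_trans h (ltW taub)).
have ttb := intau tau tt.
set u := momenta X1 X2 lam in L unit *.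
have cu t : 0 <= t <= b -> control_cvg `[0, b] u t.
  by move=> tb; exact: (momenta_cvg s1 s2 tb L).
have Lt := lifts_sub (ltW taub) L.
have cut t : 0 <= t <= tau -> control_cvg `[0, tau] u t.
  by move=> tb; exact: (momenta_cvg s1 s2 tb Lt).
have Lbt0 := lifts_base gE (lifts_sub (ltW taub) Lb).
have Lnt0 := lifts_base gE (lifts_sub (ltW taub) Ln).
have uub := lifts_control s1 s2 ind tau0 Lt Lbt0.
have uun := lifts_control s1 s2 ind tau0 Lt Lnt0.
have Lbt : lifts X1 X2 tau gamma u lamb.
  by apply: lifts_ext Lbt0 => t h; rewrite uub.
have Lnt : lifts X1 X2 tau gamma u nu.
  by apply: lifts_ext Lnt0 => t h; rewrite uun.
have an : annihilates X1 X2 b nu by move=> t /rn [[]].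
have ant : annihilates X1 X2 tau nu by move=> t /intau /an.
have gl t : 0 <= t <= b -> (lam t).1 = gamma t by have [g _ _] := L; exact: g.
have glb t : 0 <= t <= b -> (lamb t).1 = gammab t by have [g _ _] := Lb; exact: g.
have gln t : 0 <= t <= b -> (nu t).1 = gammab t by have [g _ _] := Ln; exact: g.
have nuW : (nu 0).2 \in W.
  have : [set v | v \in W] (nu 0).2.
    by rewrite WE; exact: (covector_of_lifts s1 s2 tau0 cut Lnt ant).
  by [].
(* the controls of lam and lamb agree on [0, tau], so the difference
   annihilates the distribution *)
pose eta := lift_comb 1 (-1) lamb lam.
have Leta : lifts X1 X2 tau gamma u eta by exact: lifts_comb.
have aeta : annihilates X1 X2 tau eta.
  move=> t h; have e : (lamb t).1 = (lam t).1.
    by rewrite glb ?gl ?intau// gE.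
  have := uub t h; rewrite /u /momenta => -[e1 e2].
  by split; rewrite hfun_comb// ?e1 ?e2 mul1r mulN1r subrr.
have etaW : (eta 0).2 \in W.
  have : [set v | v \in W] (eta 0).2.
    by rewrite WE; exact: (covector_of_lifts s1 s2 tau0 cut Leta aeta).
  by [].
have VW : (V <= W)%VS.
  apply/subvP => v vV; have : [set v | v \in V] v by [].
  rewrite VE => /(lifts_of_covector s1 s2 ind b0 cu L)[xi [Lx ax] x0].
  have : [set v | v \in W] (xi 0).2.
    rewrite WE; apply: (covector_of_lifts s1 s2 tau0 cut (lifts_sub (ltW taub) Lx)).
    by move=> t /intau /ax.
  by rewrite x0.
have extend v : v \in V -> exists2 xi,
    lifts X1 X2 b gamma u xi /\ annihilates X1 X2 b xi & xi 0 = (gamma 0, v).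
  move=> vV; have : [set v | v \in V] v by [].
  by rewrite VE => /(lifts_of_covector s1 s2 ind b0 cu L).
have [nuV|[a etaV]] := one_dimensional_quotient dV dW VW etaW nuW.
  have [xi [Lx ax] x0] := extend _ nuV.
  have xn0 : xi 0 = nu 0 by rewrite x0 -(gE 0 z0) -(gln 0 z0b); case: (nu 0).
  have xn : xi tau = nu tau.
    exact: (lifts_unique s1 s2 cut (lifts_sub (ltW taub) Lx) Lnt z0 tt xn0).
  apply: (regular_unique_forward tau0 taub ss Lx Ln ax (rn tau ttb) cu unit xn).
  exact: uun.
have [xi [Lx ax] x0] := extend _ etaV.
have gx t : 0 <= t <= b -> (xi t).1 = gamma t by have [g _ _] := Lx; exact: g.
(* eta(0) = xi(0) + a nu(0), that is lamb(0) - a nu(0) = lam(0) + xi(0) *)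
pose sig := lift_comb 1 1 lam xi.
pose sigb := lift_comb 1 (- a) lamb nu.
have ubn := lifts_control s1 s2 ind b0 Lb Ln.
have Lnb : lifts X1 X2 b gammab (momenta X1 X2 lamb) nu.
  by apply: lifts_ext Ln => t h; rewrite ubn.
have Lsig : lifts X1 X2 b gamma u sig by exact: lifts_comb.
have Lsigb : lifts X1 X2 b gammab (momenta X1 X2 lamb) sigb by exact: lifts_comb.
apply: (normal_unique_forward s1 s2 ind tau0 taub Lsig Lsigb).
- move=> t tb; have e : (lam t).1 = (xi t).1 by rewrite gl// gx.
  have [a1 a2] := ax t tb.
  by rewrite /u /momenta !hfun_comb// a1 a2 !mul1r !addr0.
- move=> t tb; have e : (lamb t).1 = (nu t).1 by rewrite glb// gln.
  have [a1 a2] := an t tb.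
  by rewrite /momenta !hfun_comb// a1 a2 !mulr0 !mul1r !addr0.
- by move=> t h; rewrite gE.
- rewrite /sig /sigb /lift_comb x0 /= gl// glb// gE//; congr (_, _).
  rewrite /eta /lift_comb /= !scale1r scaleN1r addrA addrCA subrr addr0.
  by rewrite scaleNr.
Qed.

End Core.

Section Branching.
Context {R : realType} {n : nat} {M : manifold R n}.

Lemma vspace_of_setE (A : set 'rV[R]_n) : (0 < \dim (vspace_of_set A))%N ->
  [set v | v \in vspace_of_set A] = A.
Proof.
rewrite /vspace_of_set; case: xgetP => [V _ //|_].
by rewrite dimv0.
Qed.

Lemma frame_independent (S : sub_riemannian M 2) (X1 X2 : M -> 'rV[R]_n) :
  orthonormal_frame S X1 X2 -> independent X1 X2.
Proof.
move=> [_ _ span _ _] q a b a' b' e.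
have dS : \dim (Defs.distribution S q) = 2 by have [h _] := distribution_smooth S.
have fr : free [:: X1 q; X2 q] by rewrite /free -span dS.
have : (a - a') *: X1 q + (b - b') *: X2 q = 0.
  by rewrite !scalerBl addrACA -opprD e subrr.
have f2 := @freeP _ _ 2 [tuple X1 q; X2 q] fr (fun i => [:: a - a'; b - b']`_i).
rewrite !big_ord_recl big_ord0 /= addr0 in f2.
move=> /f2 h; have := h ord0; have := h (lift ord0 ord0) => /= h1 h0.
by split; apply/eqP; rewrite -subr_eq0; apply/eqP.
Qed.

(** The regular lift [mu] of [gamma] only serves to show that [gamma] has unit speed. *)
Lemma branch_not_normal (S : sub_riemannian M 2) (X1 X2 : M -> 'rV[R]_n)
    (T tau b : R) (k : nat) (gamma gbar : R -> M) lam mu lamb nu :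
  orthonormal_frame S X1 X2 -> 0 < tau -> tau < T -> tau < b -> (1 <= k)%N ->
  normal_lift X1 X2 T gamma lam -> regular_abnormal_lift X1 X2 T gamma mu ->
  dim_abnormal X1 X2 gamma tau = k.+1 ->
  (forall t, tau < t <= T -> dim_abnormal X1 X2 gamma t = k) ->
  normal_lift X1 X2 b gbar lamb -> regular_abnormal_lift X1 X2 b gbar nu ->
  ~ branches_at tau gamma gbar.
Proof.
move=> hX tau0 tauT taub k1 nl rl dtau dt nlb rlb [gE br].
have ind := frame_independent hX; have [s1 s2 _ _ _] := hX.
(* gbar and gamma are compared on their common interval of definition *)
pose t' := Num.min T b.
have t'T : t' <= T by rewrite ge_min lexx.
have t'b : t' <= b by rewrite ge_min lexx orbT.
have taut' : tau < t' by rewrite lt_min tauT.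
have L := lifts_sub t'T (normal_lifts s1 s2 nl).
have Lb := lifts_sub t'b (normal_lifts s1 s2 nlb).
have [s ss Ln0] := regular_lifts rlb; have Ln := lifts_sub t'b Ln0.
have [r rr Lm0] := regular_lifts rl; have Lm := lifts_sub t'T Lm0.
have t'0 : 0 < t' by exact: lt_trans taut'.
have rn t : 0 <= t <= t' -> regular_set X1 X2 (nu t).
  by move=> /andP[t0 tt]; have [_ h _] := rlb; apply: h; rewrite t0 (le_trans tt).
have rm t : 0 <= t <= t' -> regular_set X1 X2 (mu t).
  by move=> /andP[t0 tt]; have [_ h _] := rl; apply: h; rewrite t0 (le_trans tt).
have unit t : 0 <= t <= t' ->
    (momenta X1 X2 lam t).1 ^+ 2 + (momenta X1 X2 lam t).2 ^+ 2 = 1.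
  move=> tt; rewrite (lifts_control s1 s2 ind t'0 L Lm tt).
  exact: Gcontrol_unit (rm t tt) rr.
have dt' : dim_abnormal X1 X2 gamma t' = k by apply: dt; rewrite taut' t'T.
have WE : [set v | v \in vspace_of_set (abnormal_covectors X1 X2 gamma tau)] =
    abnormal_covectors X1 X2 gamma tau.
  by apply: vspace_of_setE; rewrite -[\dim _]/(dim_abnormal _ _ _ _) dtau.
have VE : [set v | v \in vspace_of_set (abnormal_covectors X1 X2 gamma t')] =
    abnormal_covectors X1 X2 gamma t'.
  by apply: vspace_of_setE; rewrite -[\dim _]/(dim_abnormal _ _ _ _) dt'.
have [d d0 Hd] := no_regular_normal_branch s1 s2 ind tau0 taut' ss L Lb Ln rn unit
  gE WE VE dtau dt'.
pose m := Num.min d (t' - tau).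
have m0 : 0 < m by rewrite lt_min d0 subr_gt0.
have : \forall e \near 0^'+, exists2 t, 0 <= t <= tau + e & 0 < e < m /\ gbar t <> gamma t.
  near=> e; have [t te tg] : exists2 t, 0 <= t <= tau + e & gbar t <> gamma t.
    by near: e; exact: br.
  by exists t => //; split=> //; apply/andP; split; near: e;
    [exact: nbhs_right_gt|exact: nbhs_right_lt].
move=> /filter_ex[e [t /andP[t0 te] [/andP[e0]]]].
rewrite lt_min => /andP[ed et] []; have [ttau|taut] := leP t tau.
  by apply: gE; rewrite t0.
apply/esym/Hd; last by apply: le_lt_trans te _; rewrite ltrD2l.
by rewrite (ltW taut) /=; apply: le_trans te _; rewrite -lerBrDl ltW.
Unshelve. all: by end_near. Qed.

End Branching.

Theorem proposition3p17 (R : realType) (n : nat) (M : manifold R n)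
    (S : sub_riemannian M 2) (X1 X2 : M -> 'rV[R]_n)
    (hX : orthonormal_frame S X1 X2)
    (T tau : R) (k : nat) (gamma : R -> M)
    (gamma_normal : normal_geodesic X1 X2 T gamma)
    (gamma_regular : regular_abnormal_geodesic X1 X2 T gamma)
    (htau : 0 < tau < T) (hk : (1 <= k)%N)
    (hdisc : ~ {for tau, continuous (dim_abnormal X1 X2 gamma)})
    (hdim_tau : dim_abnormal X1 X2 gamma tau = k.+1)
    (hdim_after : forall t, tau < t <= T -> dim_abnormal X1 X2 gamma t = k) :
  (forall gbar : R -> M,
      normal_geodesic X1 X2 T gbar -> branches_at tau gamma gbar ->
      ~ (exists lam, regular_abnormal_lift X1 X2 T gbar lam)) /\
  (forall (b : R) (gbar : R -> M),
      tau < b -> regular_abnormal_geodesic X1 X2 b gbar ->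
      branches_at tau gamma gbar -> strictly_abnormal X1 X2 b gbar).
Proof.
case/andP: htau => tau0 tauT.
have [_ [lam nl]] := gamma_normal; have [_ [mu rl]] := gamma_regular.
split.
  move=> gbar [_ [lamb nlb]] br [nu rlb].
  exact: (branch_not_normal hX tau0 tauT tauT hk nl rl hdim_tau hdim_after nlb rlb br).
move=> b gbar taub [_ [nu rlb]] br; split; last first.
  move=> [lamb nlb].
  exact: (branch_not_normal hX tau0 tauT taub hk nl rl hdim_tau hdim_after nlb rlb br).
have [s1 s2 _ _ _] := hX; have [s ss Ln] := regular_lifts rlb.
have [_ rn _] := rlb; exists nu.
apply: (abnormal_of_lifts s1 s2 (lt_trans tau0 taub) _ Ln).
- exact: (Gcontrol_cvg s1 s2 s Ln rn).
- exact: (regular_annihilates rlb).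
- by move=> t /rn /regular_neq0.
Qed.
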